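(* Let $V$, $\eta$, $\Lambda_p$, $\psi_p$, $\mathcal{G}_{p,\tau}$, $U_p^\bot$ and $K_{2,p,\tau}$ be as in the context. Then for each $p\geqslant 1$ such that $\Lambda_1<\dots<\Lambda_p$ are discrete eigenvalues below the essential spectrum of $-\frac{d^2}{dy^2}+V(y)$, and for each $\tau\in\{-1,+1\}$, $$\operatorname{Re} K_{2,p,\tau}=\frac12\int_{\mathbb{R}^2}\left(\frac{\eta^2(x)}{2}V''(y)\psi_p^2(y)-\eta(x)V'(y)\psi_p(y)U_p^\bot(x,y)\right)dx\,dy+\sum_{j=1}^{p-1}\frac{\mathcal{I}_{p,j}^2\,\mathcal{H}_{p,j}}{4\sqrt{\Lambda_p-\Lambda_j}},$$ $$\tau\operatorname{Im}K_{2,p,\tau}=-\sum_{j=1}^{p-1}\frac{\mathcal{I}_{p,j}^2}{4\sqrt{\Lambda_p-\Lambda_j}}\,\bigl|\hat\eta\bigl(\sqrt{\Lambda_p-\Lambda_j}\bigr)\bigr|^2,$$ where $$\mathcal{I}_{p,j}=\int_{\mathbb{R}}\psi_p(y)\psi_j(y)V'(y)\,dy,\qquad \mathcal{H}_{p,j}=\frac1\pi\,\mathrm{v.p.}\int_{\mathbb{R}}\frac{|\hat\eta(s)|^2}{\sqrt{\Lambda_p-\Lambda_j}-s}\,ds,\qquad \hat\eta(s)=\int_{\mathbb{R}}\eta(x)e^{\mathrm{i}sx}\,dx,$$ v.p. denotes the Cauchy principal value, and empty sums (for $p=1$) are zero.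
   Context: Standing assumptions on $V$: $V:\mathbb{R}\to\mathbb{R}$ admits an analytic continuation to the strip $\{y+\mathrm{i}h: y\in\mathbb{R},\ |h|<h_0\}$ for some $h_0>0$, and there are constants $C_1\in\mathbb{R}$, $C_2,\dots,C_5>0$ with $V(y)\geqslant C_1$, $|V'(y)|\leqslant C_2|V(y)|+C_3$, $|V(y+\mathrm{i}h)|\leqslant C_4|V(y)|+C_5$ for all $y\in\mathbb{R}$, $|h|<h_0$. The self-adjoint operator $\mathcal{L}_0=-\frac{d^2}{dy^2}+V(y)$ in $L_2(\mathbb{R})$, with domain $W_2^2(\mathbb{R})\cap L_2(\mathbb{R},(1+|V(y)|^2)\,dy)$, has at least two discrete eigenvalues below its essential spectrum (which may be empty). These eigenvalues are simple and are listed in ascending order $\Lambda_1<\Lambda_2<\dots$ (finitely or infinitely many), with real-valued eigenfunctions $\psi_1,\psi_2,\dots$ orthonormal in $L_2(\mathbb{R})$. Assumptions on $\eta$: $\eta:\mathbb{R}\to\mathbb{R}$ is piecewise continuous with $|\eta(x)|\leqslant Ce^{-a|x|}$ for all $x$, for some constants $C,a>0$. For $\tau\in\{-1,+1\}$ and a function $f(x,y)$, put $$\mathcal{G}_{p,\tau}(f)(x,y)=\sum_{j=1}^{p-1}\frac{\mathrm{i}\tau\psi_j(y)}{2\sqrt{\Lambda_p-\Lambda_j}}\int_{\mathbb{R}^2}e^{\mathrm{i}\tau\sqrt{\Lambda_p-\Lambda_j}\,|x-x_1|}\psi_j(y_1)f(x_1,y_1)\,dx_1dy_1-\frac12\psi_p(y)\int_{\mathbb{R}^2}|x-x_1|\psi_p(y_1)f(x_1,y_1)\,dx_1dy_1+U_p^\bot(x,y),$$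 where $U_p^\bot\in W_2^2(\mathbb{R}^2)$ is the unique solution of $$(-\partial_x^2-\partial_y^2+V(y)-\Lambda_p)U_p^\bot=f(x,y)-\sum_{j=1}^p f_j(x)\psi_j(y),\qquad f_j(x)=\int_{\mathbb{R}}f(x,y)\psi_j(y)\,dy,$$ satisfying $\int_{\mathbb{R}}U_p^\bot(x,y)\psi_j(y)\,dy=0$ for $j=1,\dots,p$. Throughout, this is used with $f(x,y)=\eta(x)V'(y)\psi_p(y)$, and $U_p^\bot$ in the claim denotes the corresponding function for this $f$. Finally, $$K_{2,p,\tau}=\frac12\int_{\mathbb{R}^2}\left(\frac{\eta^2(x)}{2}V''(y)\psi_p^2(y)-\eta(x)V'(y)\psi_p(y)\,\mathcal{G}_{p,\tau}(\eta V'\psi_p)(x,y)\right)dx\,dy .$$ *)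

(* Defs.v *)
From HB Require Import structures.
From mathcomp Require Import all_boot all_order all_algebra.
From mathcomp Require Import complex.
From mathcomp Require Import all_classical all_reals all_analysis.

Set Implicit Arguments.
Unset Strict Implicit.
Unset Printing Implicit Defensive.

Import Order.TTheory GRing.Theory Num.Theory.
Import numFieldNormedType.Exports.

Local Open Scope classical_set_scope.
Local Open Scope ring_scope.
Local Open Scope complex_scope.

Local Notation Re := (@complex.Re _).
Local Notation Im := (@complex.Im _).

Notation leb R := (@lebesgue_measure R).
Notation leb2 R := (@lebesgue_measure R \x @lebesgue_measure R)%E.

Section ComplexValued.
Context {R : realType}.

Definition expi (t : R) : R[i] := cos t +i* sin t.

Definition sqmod (z : R[i]) : R := Re z ^+ 2 + Im z ^+ 2.

Definition cint d (T : measurableType d) (mu : {measure set T -> \bar R})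
    (f : T -> R[i]) : R[i] :=
  (\int[mu]_t Re (f t)) +i* (\int[mu]_t Im (f t)).

(* Local expandability in a convergent power series; R[i]^o carries the usual
   topology of the complex plane. *)
Definition analytic_at (F : R[i] -> R[i]) (z0 : R[i]) : Prop :=
  exists a : nat -> R[i], \forall z \near (z0 : R[i]^o),
    series (fun n => a n * (z - z0) ^+ n : R[i]^o) @ \oo --> (F z : R[i]^o).

End ComplexValued.

Section Sobolev.
Context {R : realType}.

(* C^1 functions with compact support.  By mollification they give the same
   weak derivatives of L_2 functions as smooth compactly supported ones. *)
Definition test_function (E : normedModType R) (phi : E -> R) : Prop :=
  [/\ forall v z, derivable phi z v,
      forall v, continuous (fun z => 'D_v phi z)
    & compact (closure [set z | phi z != 0])].

(* First-order weak derivatives of functions on the line and, in the direction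
   [v], on the plane; second-order ones are obtained by iteration. *)
Definition weak_deriv1 (u g : R -> R) : Prop :=
  forall phi : R -> R, test_function phi ->
    \int[leb R]_y (u y * 'D_1 phi y) = - \int[leb R]_y (g y * phi y).

Definition weak_deriv2 (v : R * R) (u g : R * R -> R) : Prop :=
  forall phi : R * R -> R, test_function phi ->
    \int[leb2 R]_z (u z * 'D_v phi z) = - \int[leb2 R]_z (g z * phi z).

(* Complex L_2(R), as functions rather than classes: equalities between
   elements are almost everywhere. *)
Definition L2 (u : R -> R[i]) : Prop :=
  (Re \o u \in Lfun (leb R) 2%:E) /\ (Im \o u \in Lfun (leb R) 2%:E).

Definition weak_derivC (u g : R -> R[i]) : Prop :=
  weak_deriv1 (Re \o u) (Re \o g) /\ weak_deriv1 (Im \o u) (Im \o g).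

Definition dotL2 (u v : R -> R[i]) : R[i] :=
  cint (leb R) (fun y => u y * conjc (v y)).

Definition sqnormL2 (u : R -> R[i]) : R := \int[leb R]_y sqmod (u y).

End Sobolev.

(* An unbounded operator A in L_2(R) is given by its graph: [A u w] means that
   u belongs to the domain and that A u = w. *)
Section UnboundedOperators.
Context {R : realType}.
Implicit Type A : (R -> R[i]) -> (R -> R[i]) -> Prop.

Definition densely_defined A : Prop :=
  forall f, L2 f -> forall e : R, 0 < e ->
    exists u w, A u w /\ sqnormL2 (fun y => f y - u y) < e.

(* The graph of A coincides with the graph of its adjoint. *)
Definition self_adjoint A : Prop :=
  densely_defined A /\
  forall v w, L2 v -> L2 w ->
    (A v w <-> forall u Au, A u Au -> dotL2 Au v = dotL2 u w).

(* A - z is a bijection from the domain onto L_2(R) with bounded inverse. *)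
Definition resolvent_set A : set R[i] := [set z |
  exists M : R, forall f, L2 f ->
    exists u w, [/\ A u w,
      {ae leb R, forall y, w y - z * u y = f y},
      sqnormL2 u <= M * sqnormL2 f
    & forall u' w', A u' w' ->
        {ae leb R, forall y, w' y - z * u' y = f y} ->
        {ae leb R, forall y, u' y = u y}]].

Definition spectrum A : set R[i] := ~` resolvent_set A.

Definition in_eigenspace A (z : R[i]) (u : R -> R[i]) : Prop :=
  A u (fun y => z * u y).

Definition discrete_spectrum A : set R[i] := [set z |
  [/\ exists u, in_eigenspace A z u /\ ~ {ae leb R, forall y, u y = 0},
      exists2 e : R, 0 < e &
        forall z', spectrum A z' -> `|z' - z| < e%:C -> z' = z
    & exists n (b : 'I_n -> R -> R[i]), forall u, in_eigenspace A z u ->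
        exists c : 'I_n -> R[i],
          {ae leb R, forall y, u y = \sum_(i < n) c i * b i y}]].

Definition essential_spectrum A : set R[i] :=
  spectrum A `\` discrete_spectrum A.

Definition discrete_eigenvalue_below A (lam : R) : Prop :=
  discrete_spectrum A lam%:C /\
  forall z, essential_spectrum A z -> lam < Re z.

End UnboundedOperators.

Section Problem.
Context {R : realType}.
Implicit Types (V eta : R -> R) (Lam : nat -> R) (psi : nat -> R -> R).

Definition admissible_potential V : Prop :=
  exists (h0 : R) (F : R[i] -> R[i]), [/\ 0 < h0,
    forall z, `|Im z| < h0 -> analytic_at F z,
    forall y : R, F y%:C = (V y)%:C
  & exists C1 C2 C3 C4 C5 : R,
    [/\ [/\ 0 < C2, 0 < C3, 0 < C4 & 0 < C5],
        forall y, C1 <= V y,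
        forall y, `|derive1 V y| <= C2 * `|V y| + C3
      & forall y h, `|h| < h0 -> `|F (y +i* h)| <= (C4 * `|V y| + C5)%:C]].

(* - d^2/dy^2 + V with domain W_2^2(R) inter L_2(R, (1 + |V|^2) dy). *)
Definition schrodinger V (u w : R -> R[i]) : Prop :=
  exists u1 u2 : R -> R[i],
    [/\ [/\ L2 u, L2 u1, L2 u2, weak_derivC u u1 & weak_derivC u1 u2],
        (\int[leb R]_y ((1 + `|V y| ^+ 2) * sqmod (u y))%:E < +oo)%E,
        L2 w
      & {ae leb R, forall y, w y = - u2 y + (V y)%:C * u y}].

(* Indices start from 1; [N = Some n] stands for n eigenvalues below the
   essential spectrum, [N = None] for infinitely many. *)
Definition eigen_index (N : option nat) (j : nat) : bool :=
  (0 < j)%N && (if N is Some n then (j <= n)%N else true).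

Record spectral_setting V (N : option nat) Lam psi : Prop := SpectralSetting {
  ss_self_adjoint : self_adjoint (schrodinger V);
  ss_at_least_two : eigen_index N 2;
  ss_ascending : forall j k, eigen_index N j -> eigen_index N k ->
    (j < k)%N -> Lam j < Lam k;
  ss_enumeration : forall lam : R,
    discrete_eigenvalue_below (schrodinger V) lam <->
    exists2 j, eigen_index N j & Lam j = lam;
  ss_eigenfunction : forall j, eigen_index N j ->
    in_eigenspace (schrodinger V) (Lam j)%:C (fun y => (psi j y)%:C);
  ss_simple : forall j, eigen_index N j -> forall u,
    in_eigenspace (schrodinger V) (Lam j)%:C u ->
    exists c : R[i], {ae leb R, forall y, u y = c * (psi j y)%:C};
  ss_orthonormal : forall j k, eigen_index N j -> eigen_index N k ->
    \int[leb R]_y (psi j y * psi k y) = (j == k)%:R }.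

(* One-sided limits everywhere, finitely many discontinuities in every bounded
   interval. *)
Definition piecewise_continuous eta : Prop :=
  (forall x : R, cvg (eta @ x^'+) /\ cvg (eta @ x^'-)) /\
  forall a b : R, finite_set
    [set x | a <= x <= b /\ ~ (eta x' @[x' --> x] --> eta x)].

Definition exponentially_decaying eta : Prop :=
  exists C a : R, [/\ 0 < C, 0 < a &
    forall x, `|eta x| <= C * expR (- a * `|x|)].

Definition coef psi (f : R * R -> R) (j : nat) (x : R) : R :=
  \int[leb R]_y (f (x, y) * psi j y).

(* U is the function U_p^\bot associated with f; the data are real, hence so
   is this unique solution. *)
Definition is_Uperp V Lam psi (p : nat) (f U : R * R -> R) : Prop :=
  (exists Ux Uy Uxx Uxy Uyx Uyy : R * R -> R,
    [/\ [/\ U \in Lfun (leb2 R) 2%:E, Ux \in Lfun (leb2 R) 2%:E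
          & Uy \in Lfun (leb2 R) 2%:E] /\
        [/\ Uxx \in Lfun (leb2 R) 2%:E, Uxy \in Lfun (leb2 R) 2%:E,
            Uyx \in Lfun (leb2 R) 2%:E & Uyy \in Lfun (leb2 R) 2%:E],
        weak_deriv2 (1, 0) U Ux /\ weak_deriv2 (0, 1) U Uy,
        weak_deriv2 (1, 0) Ux Uxx /\ weak_deriv2 (0, 1) Ux Uxy,
        weak_deriv2 (1, 0) Uy Uyx /\ weak_deriv2 (0, 1) Uy Uyy
      & {ae leb2 R, forall z : R * R,
          - Uxx z - Uyy z + (V z.2 - Lam p) * U z =
          f z - \sum_(1 <= j < p.+1) coef psi f j z.1 * psi j z.2}]) /\
  forall j, (1 <= j <= p)%N ->
    {ae leb R, forall x, \int[leb R]_y (U (x, y) * psi j y) = 0}.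

Definition wavenum Lam (p j : nat) : R := Num.sqrt (Lam p - Lam j).

(* The operator G_{p,tau} applied to f; its last summand U_p^\bot is passed as
   the argument U, to be constrained by is_Uperp. *)
Definition Gop Lam psi (p : nat) (tau : R) (f U : R * R -> R)
    (z : R * R) : R[i] :=
  \sum_(1 <= j < p)
    'i * (tau * psi j z.2 / (2 * wavenum Lam p j))%:C *
    cint (leb2 R) (fun w : R * R =>
      expi (tau * wavenum Lam p j * `|z.1 - w.1|) * (psi j w.2 * f w)%:C)
  - (2^-1 * psi p z.2 *
      \int[leb2 R]_w (`|z.1 - w.1| * psi p w.2 * f w))%:C
  + (U z)%:C.

Definition source V eta psi (p : nat) (z : R * R) : R :=
  eta z.1 * derive1 V z.2 * psi p z.2.

Definition K2 V eta Lam psi (p : nat) (tau : R) (U : R * R -> R) : R[i] :=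
  2^-1 * cint (leb2 R) (fun z : R * R =>
    (eta z.1 ^+ 2 / 2 * derive1n 2 V z.2 * psi p z.2 ^+ 2)%:C
    - (source V eta psi p z)%:C *
      Gop Lam psi p tau (source V eta psi p) U z).

Definition fourier eta (s : R) : R[i] :=
  cint (leb R) (fun x => (eta x)%:C * expi (s * x)).

(* Cauchy principal value at c of the integral of f over the line. *)
Definition pv_integral (f : R -> R) (c : R) : R :=
  lim ((\int[leb R]_(s in [set s : R | (e < `|s - c|)%R]) f s) @[e --> 0^'+]).

Definition Ipj V psi (p j : nat) : R :=
  \int[leb R]_y (psi p y * psi j y * derive1 V y).

Definition Hpj eta Lam (p j : nat) : R :=
  pi^-1 * pv_integral
    (fun s => sqmod (fourier eta s) / (wavenum Lam p j - s)) (wavenum Lam p j).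

End Problem.

(* Main.v *)
Require Import Defs.
From HB Require Import structures.
From mathcomp Require Import all_boot all_order all_algebra.
From mathcomp Require Import complex.
From mathcomp Require Import all_classical all_reals all_analysis.
From mathcomp Require Import measurable_realfun.
From mathcomp Require Import ring lra.

Set Implicit Arguments.
Unset Strict Implicit.
Unset Printing Implicit Defensive.

Import Order.TTheory GRing.Theory Num.Theory.
Import numFieldNormedType.Exports.

Local Open Scope classical_set_scope.
Local Open Scope ring_scope.

(* Since [psi_p] is a bound state, the virial identity [I_{p,p} = 0] holds: the
   energy [psi_p'^2 - (V - Lam_p) psi_p^2] is integrable, so it vanishes along
   sequences tending to both infinities, and its derivative is [- V' psi_p^2].
   Hence the term of [G_{p,tau}] with kernel [|x - x_1|] contributes nothing.

   Every oscillating term separates variables and yields [I_{p,j}^2] times the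
   double integral of [eta x * eta x_1] against [sin (k |x - x_1|)] or
   [cos (k |x - x_1|)], with [k = sqrt (Lam_p - Lam_j)].  The cosine integral is
   [|eta^ k|^2].  For the sine integral, write [g = |eta^|^2], a cosine transform;
   the principal value of [g s / (k - s)] is the integral over [u > 0] of
   [(g (k - u) - g (k + u)) / u], which Abel summation and
   [int_0^oo e^(- e u) sin (u t) / u du = atan (t / e)] evaluate as
   [pi int int eta x eta x_1 sin (k |x - x_1|)].

   Integrability of [V'' psi_p^2] needs [|V''| <= A |V| + B], which is Cauchy's
   estimate on squares of fixed size, since [|V| <= 2 |V y| + const] near [y]. *)

(** * Integration *)

(** Three obstacles shape the proof. The real-valued integral is a total function, so each use of
    linearity or Fubini must be paid for by a domination; most estimates below serve that purpose.
    The eigenfunction is an L_2 function with weak derivatives, whose values can be trusted only at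
    Lebesgue points; the energy is therefore evaluated only there, and between two such points it is
    followed along continuous primitives. Finally, [eta] may jump, so decay of its Fourier transform
    cannot be relied on to control the principal value at infinity. Integrability of [|eta^|^2]
    takes its place: its Abel means are integrals of [eta x * eta x_1] against the Cauchy kernel
    [e / (e^2 + (x - x_1)^2)], whose mass is pi for every [e], and one factor [eta] is bounded while
    the other is integrable. Analyticity is given as a power series at each point, with a radius
    depending on the point. The maximum principle suits this form, since it looks at one point at a
    time. *)

Section reflection.
Context {R : realType}.
Local Notation mu := (@lebesgue_measure R).

Let refl (k : R) : R -> measurableTypeR R := fun x => k - x.

Let measurable_refl k : measurable_fun setT (refl k).
Proof. exact: (@measurable_funB _ _ R setT (cst k) id). Qed.

Let push_refl k A : measurable A -> mu A = pushforward mu (refl k) A.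
Proof.
move=> mA; apply: lebesgue_measure_unique;
  [exact: measurable_refl|move=> ? _ [[a b]] _ <-|by []].
rewrite /pushforward/=.
(* Reflection exchanges the open and the closed end, which does not change the length. *)
rewrite [X in _ = mu X](_ : _ = `[k - b, k - a[%classic); last first.
  by apply/seteqP; split => x /=; rewrite !in_itv/= /refl => /andP[? ?];
    apply/andP; split; lra.
rewrite !lebesgue_measure_itv/= !lte_fin.
have -> : (k - b < k - a) = (a < b) by apply/idP/idP; lra.
by case: ifP => //; rewrite -!EFinB => _; congr EFin; ring.
Qed.

Lemma ge0_integral_reflect (k : R) (f : R -> \bar R) : measurable_fun setT f ->
  (forall x, 0 <= f x)%E ->
  (\int[mu]_x f (k - x)%R = \int[mu]_x f x)%E.
Proof.
move=> mf f0.
transitivity (\int[pushforward mu (refl k)]_x f x)%E.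
  by rewrite ge0_integral_pushforward//; exact: measurable_refl.
apply: eq_measure_integral => [|? A mA _]; first exact: measurable_refl.
exact/esym/push_refl.
Qed.

Lemma integral_reflect (k : R) (f : R -> \bar R) : measurable_fun setT f ->
  (\int[mu]_x f (k - x)%R = \int[mu]_x f x)%E.
Proof.
move=> mf; rewrite integralE [RHS]integralE; congr (_ - _)%E.
- under eq_integral do rewrite funepos_comp/=.
  exact: (@ge0_integral_reflect k _ (measurable_funepos mf) (funepos_ge0 f)).
- under eq_integral do rewrite funeneg_comp/=.
  exact: (@ge0_integral_reflect k _ (measurable_funeneg mf) (funeneg_ge0 f)).
Qed.

Lemma Rintegral_reflect (k : R) (f : R -> R) : measurable_fun setT f ->
  \int[mu]_x f (k - x) = \int[mu]_x f x.
Proof.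
move=> mf; rewrite /Rintegral; congr fine.
by apply: (@integral_reflect k (EFin \o f)); exact/measurable_EFinP.
Qed.

Lemma integrable_reflect (k : R) (f : R -> R) : mu.-integrable setT (EFin \o f) ->
  mu.-integrable setT (EFin \o (fun x => f (k - x))).
Proof.
move=> /integrableP[mf foo]; apply/integrableP; split.
  exact: (measurableT_comp mf (@measurable_refl k)).
rewrite (@integral_reflect k (fun x => `|(f x)%:E|%E)) //.
exact: measurableT_comp.
Qed.

End reflection.

Section integral_tools.
Context d (T : measurableType d) {R : realType}.
Variable mu : {measure set T -> \bar R}.

Lemma Rdominated_cvg (D : set T) (f_ : nat -> T -> R) (f g : T -> R) :
  measurable D -> (forall n, measurable_fun D (f_ n)) ->
  (forall x, D x -> f_ n x @[n --> \oo] --> f x) ->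
  mu.-integrable D (EFin \o g) ->
  (forall n x, D x -> `|f_ n x| <= g x) ->
  \int[mu]_(x in D) f_ n x @[n --> \oo] --> \int[mu]_(x in D) f x.
Proof.
move=> mD mf_ f_f ig f_g.
have mf : measurable_fun D f by exact: (measurable_fun_cvg _ f_f).
have [|||||intf _ cvg_int] := @dominated_convergence _ _ _ mu D mD
  (fun n x => (f_ n x)%:E) (EFin \o f) (EFin \o g).
- by move=> n; exact/measurable_EFinP.
- exact/measurable_EFinP.
- by apply: aeW => x Dx; apply: cvg_EFin; [exact: nearW|exact: f_f].
- exact: ig.
- by apply: aeW => x n Dx /=; rewrite lee_fin f_g.
rewrite /Rintegral; apply: fine_cvg; rewrite fineK//.
exact: integrable_fin_num.
Qed.

Lemma RintegrableZl (D : set T) (k : R) (f : T -> R) : measurable D ->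
  mu.-integrable D (EFin \o f) ->
  mu.-integrable D (EFin \o (fun x => k * f x)).
Proof. by move=> mD intf; exact: (integrableZl mD k intf). Qed.

Lemma RintegrableD (D : set T) (f g : T -> R) : measurable D ->
  mu.-integrable D (EFin \o f) -> mu.-integrable D (EFin \o g) ->
  mu.-integrable D (EFin \o (fun x => f x + g x)).
Proof. by move=> mD intf intg; exact: (integrableD mD intf intg). Qed.

Lemma RintegrableB (D : set T) (f g : T -> R) : measurable D ->
  mu.-integrable D (EFin \o f) -> mu.-integrable D (EFin \o g) ->
  mu.-integrable D (EFin \o (fun x => f x - g x)).
Proof. by move=> mD intf intg; exact: (integrableB mD intf intg). Qed.

Lemma Rintegrable_norm (D : set T) (f : T -> R) : measurable D ->
  mu.-integrable D (EFin \o f) ->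
  mu.-integrable D (EFin \o (fun x => `|f x|)).
Proof. by move=> mD intf; exact: (integrable_abse intf). Qed.

Lemma Rle_integrable (D : set T) (f g : T -> R) : measurable D ->
  measurable_fun D f -> (forall x, D x -> `|f x| <= g x) ->
  mu.-integrable D (EFin \o g) -> mu.-integrable D (EFin \o f).
Proof.
move=> mD mf fg; apply: le_integrable => //; first exact/measurable_EFinP.
by move=> x Dx; rewrite /= lee_fin (le_trans (fg _ Dx))// ler_norm.
Qed.

Lemma Rintegrable_measurable (D : set T) (f : T -> R) :
  mu.-integrable D (EFin \o f) -> measurable_fun D f.
Proof. by move=> /(measurable_int mu) /measurable_EFinP. Qed.

Lemma bounded_integrableM (D : set T) (f g : T -> R) (K : R) : measurable D ->
  mu.-integrable D (EFin \o f) -> measurable_fun D g ->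
  (forall x, D x -> `|g x| <= K) ->
  mu.-integrable D (EFin \o (fun x => f x * g x)).
Proof.
move=> mD intf mg gK.
have intKf : mu.-integrable D (EFin \o (fun x => K * `|f x|)).
  apply: (@eq_integrable _ _ _ _ _ _ (fun x => K%:E * `|(f x)%:E|)%E) => //.
  by apply: integrableZl => //; exact: integrable_abse.
apply: (le_integrable _ _ _ intKf) => //.
  apply/measurable_EFinP/measurable_funM => //.
  by apply/measurable_EFinP; exact: (measurable_int mu).
move=> x Dx; rewrite /= !lee_fin normrM mulrC.
by rewrite [leRHS]ger0_norm ?ler_wpM2r ?mulr_ge0 ?gK// (le_trans _ (gK _ Dx)).
Qed.

End integral_tools.

Section product.
Context d1 d2 (T1 : measurableType d1) (T2 : measurableType d2) {R : realType}.
Variables (m1 : {sigma_finite_measure set T1 -> \bar R}).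
Variables (m2 : {sigma_finite_measure set T2 -> \bar R}).

Lemma integrable_tensor (f : T1 -> R) (g : T2 -> R) :
  m1.-integrable setT (EFin \o f) -> m2.-integrable setT (EFin \o g) ->
  (m1 \x m2)%E.-integrable setT (EFin \o (fun z => f z.1 * g z.2)).
Proof.
move=> /[dup] intf /integrableP[mf foo] /[dup] intg /integrableP[mg goo].
apply/integrable12ltyP.
  apply/measurable_EFinP/measurable_funM.
  - by apply: (measurableT_comp _ measurable_fst); exact/measurable_EFinP.
  - by apply: (measurableT_comp _ measurable_snd); exact/measurable_EFinP.
rewrite (eq_integral (fun x => `|(f x)%:E| * \int[m2]_y `|(g y)%:E|))%E; last first.
  move=> x _; rewrite -ge0_integralZl//.
  - by apply: eq_integral => y _; rewrite /= normrM EFinM.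
  - exact: measurableT_comp.
rewrite ge0_integralZr//; last by apply: integral_ge0.
  by rewrite lte_mul_pinfty// ?integral_ge0// ge0_fin_numE// integral_ge0.
exact: measurableT_comp.
Qed.

(** Fubini makes the inner integral finite almost everywhere only; on the remaining null set [fine]
    changes its value, hence the passage through [ae_eq_integral]. *)
Lemma Rintegral_prod (f : T1 * T2 -> R) :
  (m1 \x m2)%E.-integrable setT (EFin \o f) ->
  \int[(m1 \x m2)%E]_z f z = \int[m1]_x \int[m2]_y f (x, y).
Proof.
move=> intf; rewrite {1}/Rintegral -(integral12_prod_meas1 intf).
rewrite {2}/Rintegral; congr fine; apply: ae_eq_integral => //.
- exact: measurable_fubini_F intf.
- apply/measurable_EFinP; apply: measurableT_comp => //.
  exact: measurable_fubini_F intf.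
have := integrable_ae measurableT (integrable_fubini_F intf).
by apply: filterS => x /= + _ => /(_ I) /fineK/esym.
Qed.

Lemma Rintegral_prod_swap (f : T1 * T2 -> R) :
  (m1 \x m2)%E.-integrable setT (EFin \o f) ->
  \int[m1]_x \int[m2]_y f (x, y) = \int[m2]_y \int[m1]_x f (x, y).
Proof.
move=> intf; rewrite -Rintegral_prod// {1}/Rintegral -(integral21_prod_meas1 intf).
rewrite {2}/Rintegral; congr fine; apply: ae_eq_integral => //.
- exact: measurable_fubini_G intf.
- apply/measurable_EFinP; apply: measurableT_comp => //.
  exact: measurable_fubini_G intf.
have := ae_integrable2 intf.
apply: filterS => x /= + _ => /(integrable_fin_num measurableT).
by move=> /fineK/esym.
Qed.

Lemma Rintegral_tensor (f : T1 -> R) (g : T2 -> R) :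
  m1.-integrable setT (EFin \o f) -> m2.-integrable setT (EFin \o g) ->
  \int[(m1 \x m2)%E]_z (f z.1 * g z.2) = (\int[m1]_x f x) * \int[m2]_y g y.
Proof.
move=> intf intg; rewrite Rintegral_prod/=; last exact: integrable_tensor.
under eq_Rintegral do rewrite RintegralZl//.
by rewrite RintegralZr.
Qed.

(** With every section integrable, [fine] alters no inner integral, and the integrand agrees
    everywhere with the one that Fubini provides. *)
Lemma integrable_Rintegral_prod (f : T1 * T2 -> R) :
  (m1 \x m2)%E.-integrable setT (EFin \o f) ->
  (forall x, m2.-integrable setT (EFin \o (fun y => f (x, y)))) ->
  m1.-integrable setT (EFin \o (fun x => \int[m2]_y f (x, y))).
Proof.
move=> intf intfx; apply: eq_integrable (integrable_fubini_F intf) => // x _.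
by rewrite /fubini_F /= /Rintegral fineK//; exact: (integrable_fin_num measurableT (intfx x)).
Qed.

(* The canonical sigma-finite structure of [m1 \x m2] is shadowed in the
   library by the one for probabilities. *)
Definition prodm : set (T1 * T2) -> \bar R := (m1 \x m2)%E.

HB.instance Definition _ := Measure.copy prodm (m1 \x m2)%E.

Lemma sigma_finite_prodm : sigma_finite setT prodm.
Proof.
have /sigma_finiteP[F [TF ndF Foo]] := sigma_finiteT m1.
have /sigma_finiteP[G [TG ndG Goo]] := sigma_finiteT m2.
exists (fun n => F n `*` G n).
  rewrite -setXTT TF TG predeqE => -[x y]; split.
    move=> [/= [n _ Fnx] [k _ Gky]]; exists (maxn n k) => //; split.
    - by move: x Fnx; exact/subsetPset/ndF/leq_maxl.
    - by move: y Gky; exact/subsetPset/ndG/leq_maxr.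
  by move=> [n _ []/= ? ?]; split; exists n.
move=> k; have [? ?] := Foo k; have [? ?] := Goo k.
split; first exact: measurableX.
by rewrite [prodm _]product_measure1E// lte_mul_pinfty// ge0_fin_numE.
Qed.

HB.instance Definition _ := Measure_isSigmaFinite.Build _ _ _ prodm
  sigma_finite_prodm.

End product.

(** * Laplace transforms of the cosine and of the cardinal sine *)

Section laplace.
Context {R : realType}.
Local Notation mu := (@lebesgue_measure R).

Lemma is_derive_continuous (F f : R -> R) :
  (forall x, is_derive x (1 : R) F (f x)) -> continuous F.
Proof.
move=> dF x; apply/differentiable_continuous/derivable1_diffP.
by case: (dF x).
Qed.

Lemma is_derive_FTC2 (f F : R -> R) (a b : R) : a < b -> continuous f ->
  (forall x, is_derive x (1 : R) F (f x)) ->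
  \int[mu]_(x in `[a, b]) f x = F b - F a.
Proof.
move=> ab cf dF; have cF := is_derive_continuous dF.
rewrite /Rintegral (@continuous_FTC2 _ f F)//.
- exact: continuous_subspaceT.
- split.
  + by move=> x _; case: (dF x).
  + exact/cvg_at_right_filter/cF.
  + exact/cvg_at_left_filter/cF.
- by move=> x _; rewrite derive1E; apply: derive_val.
Qed.

(** Dominated convergence on []0, n]] with dominating function [|f|]; integrability of [f] is what
    makes the limit of [F] along the integers sufficient. *)
Lemma is_derive_FTC2y (f F : R -> R) (l : R) :
  continuous f -> (forall x, is_derive x (1 : R) F (f x)) ->
  mu.-integrable `]0, +oo[ (EFin \o f) -> F n%:R @[n --> \oo] --> l ->
  \int[mu]_(x in `]0, +oo[) f x = l - F 0.
Proof.
move=> cf dF intf Fl.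
have cvg1 : \int[mu]_(x in `]0, +oo[) (f \_ `]0, n%:R]) x @[n --> \oo] -->
    \int[mu]_(x in `]0, +oo[) f x.
  apply: (@Rdominated_cvg _ _ _ mu `]0, +oo[%classic
    (fun n => f \_ `]0, n%:R]) f (fun x => `|f x|)).
  - exact: measurable_itv.
  - move=> n; apply: measurable_funTS.
    apply/(measurable_restrictT _ _).1 => //.
    by apply: measurable_funTS; exact: continuous_measurable_fun.
  - move=> x /=; rewrite in_itv/= andbT => x0.
    apply: cvg_near_cst; near=> n; rewrite patchE mem_set//= in_itv/= x0/=.
    by near: n; exact: nbhs_infty_ger.
  - exact: Rintegrable_norm.
  - by move=> n x _; rewrite patchE; case: ifP => // _; rewrite normr0.
apply: (cvg_unique _ cvg1) => //.
apply: (@cvg_trans _ (F n%:R - F 0 @[n --> \oo])); last first.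
  by apply: cvgB => //; exact: cvg_cst.
apply: near_eq_cvg; near=> n.
rewrite -Rintegral_mkcondr.
have -> : `]0%R, +oo[%classic `&` `]0%R, n%:R]%classic = `]0, n%:R]%classic :> set R.
  by apply/seteqP; split => x /=; rewrite !in_itv/= ?andbT; [case|move=> /andP[-> ->]].
rewrite Rintegral_itv_obnd_cbnd; last first.
  apply: (integrableS _ _ _ intf) => //.
  by move=> x /=; rewrite !in_itv/= => /andP[->].
rewrite (is_derive_FTC2 _ cf dF)// ltr0n.
by near: n; exact: nbhs_infty_gt.
Unshelve. all: by end_near. Qed.

Lemma cvg_expR_lin (e : R) : 0 < e -> expR (- e * n%:R) @[n --> \oo] --> (0 : R).
Proof.
move=> e0; under eq_fun do rewrite mulNr.
have ey : (e * n%:R : R) @[n --> \oo] --> +oo%R.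
  apply/cvgryPge => A; near=> n; rewrite -ler_pdivrMl//.
  by near: n; exact: nbhs_infty_ger.
exact: (cvg_comp _ _ ey (@cvgr_expR R)).
Unshelve. all: by end_near. Qed.

Lemma integrable_expRN (e : R) : 0 < e ->
  mu.-integrable `[0, +oo[ (EFin \o (fun x : R => expR (- e * x))).
Proof.
move=> e0.
(* Up to the factor [e^-1] this is the density of the exponential law. *)
have -> : (fun x : R => expR (- e * x)) = (fun x : R => e^-1 * (e * expR (- e * x))).
  by apply/funext => x; rewrite mulrA mulVf ?mul1r// gt_eqF.
apply: RintegrableZl => //.
have := integrable_exponential_pdf e0.
rewrite /exponential_pdf -restrict_EFin => /integrable_restrict.
by rewrite setTI; apply.
Qed.

Lemma integrable_expRN_oy (e : R) : 0 < e ->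
  mu.-integrable `]0, +oo[ (EFin \o (fun x : R => expR (- e * x))).
Proof.
move=> /integrable_expRN; apply: integrableS => //.
by move=> x /=; rewrite !in_itv/= !andbT => /ltW.
Qed.

Lemma continuous_expRN (e : R) : continuous (fun x : R => expR (- e * x)).
Proof.
move=> x; apply: continuous_comp; first exact: mulrl_continuous.
exact: continuous_expR.
Qed.

Lemma normr_sin_le (x : R) : `|sin x| <= `|x|.
Proof.
wlog x0 : x / 0 <= x => [h|].
  have [/h//|/ltW] := leP 0 x; rewrite -oppr_ge0 => /h.
  by rewrite sinN !normrN.
have := @MVT_segment R sin cos 0 x x0 (fun z _ => is_derive_sin z).
case; first by apply: continuous_subspaceT => z; exact: continuous_sin.
move=> c _; rewrite sin0 !subr0 => ->; rewrite normrM ler_piMl//.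
exact: cos_max.
Qed.

Lemma Rintegral_expRN_cos (e t : R) : 0 < e ->
  \int[mu]_(u in `]0, +oo[) (expR (- e * u) * cos (u * t)) = e / (e ^+ 2 + t ^+ 2).
Proof.
move=> e0.
have d0 : 0 < e ^+ 2 + t ^+ 2 by rewrite ltr_pwDl ?exprn_gt0// sqr_ge0.
(* Real part of [exp ((i t - e) u) / (i t - e)]. *)
pose F (u : R) : R := expR (- e * u) * (t * sin (u * t) - e * cos (u * t)) / (e ^+ 2 + t ^+ 2).
have cc : continuous (fun u : R => cos (u * t)).
  by move=> x; apply: continuous_comp; [exact: mulrr_continuous|exact: continuous_cos].
transitivity (0 - F 0); last first.
  by rewrite /F mulr0 expR0 mul0r sin0 cos0 mulr0 mulr1 mul1r !sub0r mulNr opprK.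
apply: is_derive_FTC2y.
- move=> x; apply: cvgM; [exact: continuous_expRN|exact: cc].
- move=> x; rewrite /F.
  apply: is_derive_eq.
  by rewrite /GRing.scale/=; field; rewrite gt_eqF.
- apply: (bounded_integrableM (K := 1)) => //.
  + exact: integrable_expRN_oy.
  + by apply: measurable_funTS; exact: continuous_measurable_fun.
  + by move=> *; exact: cos_max.
- have bd (u : R) : `|F u| <= expR (- e * u) * ((`|t| + e) / (e ^+ 2 + t ^+ 2)).
    rewrite /F -mulrA normrM ger0_norm ?expR_ge0// ler_wpM2l ?expR_ge0//.
    rewrite normrM [X in _ * X]gtr0_norm ?invr_gt0// ler_wpM2r//.
      by rewrite invr_ge0 ltW.
    rewrite (le_trans (ler_normB _ _))// !normrM (gtr0_norm e0) lerD//.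
      by rewrite ler_piMr// sin_max.
    by rewrite ler_piMr ?cos_max// ltW.
  apply: norm_cvg0.
  apply: (@squeeze_cvgr _ _ _ _ (fun=> 0)
    (fun n => expR (- e * n%:R) * ((`|t| + e) / (e ^+ 2 + t ^+ 2)))).
  + by apply: nearW => n /=; rewrite normr_ge0/= bd.
  + exact: cvg_cst.
  + rewrite -[X in _ --> X](mul0r ((`|t| + e) / (e ^+ 2 + t ^+ 2))).
    by apply: cvgM; [exact: cvg_expR_lin|exact: cvg_cst].
Qed.

Definition expR_sinc (e t u : R) := expR (- e * u) * (sin (u * t) / u).

Lemma measurable_expR_sinc (e t : R) :
  measurable_fun (`]0, +oo[%classic : set R) (expR_sinc e t).
Proof.
apply: open_continuous_measurable_fun => //.
move=> u /[!inE]/=; rewrite in_itv/= andbT => u0.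
apply: cvgM; first exact: continuous_expRN.
apply: cvgM; last by apply: cvgV; [rewrite gt_eqF|exact: cvg_id].
by apply: continuous_comp; [exact: mulrr_continuous|exact: continuous_sin].
Qed.

Lemma normr_expR_sinc (e t u : R) : 0 < u ->
  `|expR_sinc e t u| <= expR (- e * u) * `|t|.
Proof.
move=> u0; rewrite normrM ger0_norm ?expR_ge0// ler_wpM2l ?expR_ge0//.
rewrite normrM normfV ler_pdivrMr ?normr_gt0 ?gt_eqF//.
by rewrite (le_trans (normr_sin_le _))// normrM mulrC.
Qed.

Lemma integrable_expR_sinc (e t : R) : 0 < e ->
  mu.-integrable `]0, +oo[ (EFin \o expR_sinc e t).
Proof.
move=> e0.
have int1 : mu.-integrable `]0, +oo[ (EFin \o (fun u => expR (- e * u) * `|t|)).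
  apply: (bounded_integrableM (K := `|t|)) => //.
    exact: integrable_expRN_oy.
  by move=> *; rewrite normr_id.
apply: le_integrable int1 => //.
  by apply/measurable_EFinP; exact: measurable_expR_sinc.
move=> u /=; rewrite in_itv/= andbT => u0; rewrite lee_fin.
by rewrite [leRHS]ger0_norm ?mulr_ge0 ?expR_ge0// normr_expR_sinc.
Qed.

(** Both sides vanish at [t = 0] and have the same derivative in [t]: under the integral sign the
    factor [1 / u] cancels, which leaves the Laplace transform of the cosine. The derivative in [t]
    is dominated by [exp (- e u)], uniformly in [t]. *)
Lemma Rintegral_expR_sinc (e t : R) : 0 < e ->
  \int[mu]_(u in `]0, +oo[) expR_sinc e t u = atan (t / e).
Proof.
move=> e0; pose h t := \int[mu]_(u in `]0, +oo[) expR_sinc e t u.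
have dpar (s u : R) : 0 < u ->
    is_derive s (1 : R) (fun x => expR_sinc e x u) (expR (- e * u) * cos (u * s)).
  move=> u0; rewrite /expR_sinc; apply: is_derive_eq.
  by rewrite /GRing.scale/=; field; rewrite gt_eqF.
have dh (s : R) : is_derive s (1 : R) h (e / (e ^+ 2 + s ^+ 2)).
  have ss : `](s - 1), (s + 1)[%classic s by rewrite /= in_itv/=; apply/andP; split; lra.
  have H1 (x : R) : `](s - 1), (s + 1)[%classic x ->
      mu.-integrable `]0, +oo[ (EFin \o expR_sinc e x).
    by move=> _; exact: integrable_expR_sinc.
  have H2 (x u : R) : `](s - 1), (s + 1)[%classic x -> `]0, +oo[%classic u ->
      derivable (expR_sinc e ^~ u) x 1.
    by move=> _ /=; rewrite in_itv/= andbT => /(dpar x) ?; apply: ex_derive.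
  have H3 (u : R) : 0 <= expR (- e * u) by exact: expR_ge0.
  have H4 (x u : R) : `](s - 1), (s + 1)[%classic x -> `]0, +oo[%classic u ->
      `|partial1of2 (expR_sinc e) x u| <= expR (- e * u).
    move=> _ /=; rewrite in_itv/= andbT => /(dpar x) ?.
    rewrite partial1of2E derive_val normrM ger0_norm ?expR_ge0//.
    by rewrite ler_piMr ?expR_ge0 ?cos_max.
  have mD : measurable (`]0, +oo[%classic : set (measurableTypeR R)) by exact: measurable_itv.
  split.
    exact: (derivable_under_integral mD ss H1 H2 H3 (integrable_expRN_oy e0) H4).
  rewrite -derive1E.
  rewrite (differentiation_under_integral mD ss H1 H2 H3 (integrable_expRN_oy e0) H4).
  rewrite -Rintegral_expRN_cos//; apply: eq_Rintegral => u.
  rewrite inE/= in_itv/= andbT => /(dpar s) ?.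
  by rewrite partial1of2E derive_val.
have d0 (s : R) : is_derive s (1 : R) (fun x => h x - atan (x / e)) 0.
  have de : 0 < e ^+ 2 + s ^+ 2 by rewrite ltr_pwDl ?exprn_gt0// sqr_ge0.
  apply: is_derive_eq.
  by rewrite /GRing.scale/=; field; rewrite !gt_eqF.
have := is_derive_0_is_cst t 0 d0; rewrite mul0r atan0 subr0.
have -> : h 0 = 0.
  rewrite /h (@eq_Rintegral _ _ _ _ _ (cst 0)); last by move=> u _; rewrite /expR_sinc mulr0 sin0 mul0r mulr0.
  by rewrite Rintegral_cst// mul0r.
by move/subr0_eq.
Qed.

End laplace.

(** * Principal values of cosine transforms *)

Section sine_transform.
Context {R : realType} d (T : measurableType d).
Variable nu : {sigma_finite_measure set T -> \bar R}.
Variables (w t : T -> R).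
Local Notation mu := (@lebesgue_measure R).
Local Notation Rp := (`]0, +oo[%classic : set R).

(* Used with [w z = eta z.1 * eta z.2] and [t z = z.1 - z.2], where it is the
   squared modulus of the Fourier transform of [eta]. *)
Definition cos_transform (s : R) : R := \int[nu]_z (w z * cos (s * t z)).
Local Notation g := cos_transform.

Hypothesis mt : measurable_fun setT t.
Hypothesis iw : nu.-integrable setT (EFin \o w).
Hypothesis iwt : nu.-integrable setT (EFin \o (fun z => w z * t z)).

Let mw : measurable_fun setT w. Proof. exact: Rintegrable_measurable iw. Qed.

Let mcos s : measurable_fun setT (fun z => cos (s * t z)).
Proof.
apply: (measurableT_comp (f := @cos R)).
  by apply: continuous_measurable_fun; exact: continuous_cos.
exact: measurable_funM.
Qed.

Let msin s : measurable_fun setT (fun z => sin (s * t z)).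
Proof.
apply: (measurableT_comp (f := @sin R)).
  by apply: continuous_measurable_fun; exact: continuous_sin.
exact: measurable_funM.
Qed.

Lemma integrable_cos_transform s :
  nu.-integrable setT (EFin \o (fun z => w z * cos (s * t z))).
Proof. by apply: (bounded_integrableM (K := 1)) => // x _; exact: cos_max. Qed.

Lemma cos_transformN s : g (- s) = g s.
Proof. by apply: eq_Rintegral => z _; rewrite mulNr cosN. Qed.

Lemma cos_transformB k u :
  g (k - u) - g (k + u) = \int[nu]_z (w z * (2 * sin (k * t z) * sin (u * t z))).
Proof.
rewrite /g -RintegralB//; try exact: integrable_cos_transform.
apply: eq_Rintegral => z _; rewrite mulrBl mulrDl cosB cosD; ring.
Qed.

Let M := \int[nu]_z `|w z * t z|.

Let M0 : 0 <= M. Proof. exact: Rintegral_ge0. Qed.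

(** From [|sin (u t)| <= |u| |t|]. This Lipschitz bound, with the first moment [M] as its constant,
    removes the singularity of the folded kernel at [u = 0] and also yields continuity. *)
Lemma cos_transformB_le k u : `|g (k - u) - g (k + u)| <= 2 * M * `|u|.
Proof.
have isin : nu.-integrable setT
    (EFin \o (fun z => w z * (2 * sin (k * t z) * sin (u * t z)))).
  apply: (bounded_integrableM (K := 2)) => //.
    by apply: measurable_funM => //; exact: measurable_funM.
  move=> x _; rewrite -mulrA normrM gtr0_norm// ler_piMr//.
  by rewrite normrM mulr_ile1 ?sin_max.
rewrite cos_transformB (le_trans (le_normr_Rintegral _ _))//.
have im : nu.-integrable setT (EFin \o (fun z => 2 * `|u| * `|w z * t z|)).
  by apply: RintegrableZl => //; exact: Rintegrable_norm.
apply: (@le_trans _ _ (\int[nu]_z (2 * `|u| * `|w z * t z|))).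
  apply: le_Rintegral => //; first exact: Rintegrable_norm.
  move=> z _; rewrite !normrM (gtr0_norm (_ : 0 < 2 :> R))//.
  rewrite [leRHS](_ : _ = `|w z| * (2 * 1 * (`|u| * `|t z|))); last by ring.
  rewrite ler_wpM2l// ler_pM ?mulr_ge0 ?ler_wpM2l ?sin_max//.
  by rewrite (le_trans (normr_sin_le _))// normrM.
rewrite (RintegralZl _ measurableT (Rintegrable_norm measurableT iwt)) -/M.
by rewrite mulrAC lexx.
Qed.

Lemma continuous_cos_transform : continuous g.
Proof.
have M1 : 0 < M + 1 by rewrite ltr_wpDl.
move=> s; apply/cvgrPdist_le => e e0; near=> s'.
(* [cos_transformB_le] is applied around the midpoint of [s] and [s'], with half their distance as
   [u]. *)
have -> : g s - g s' = g ((s + s') / 2 - (s' - s) / 2) - g ((s + s') / 2 + (s' - s) / 2).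
  by congr (g _ - g _); lra.
rewrite (le_trans (cos_transformB_le _ _))//.
rewrite normrM [X in _ * (_ * X)]gtr0_norm; last by rewrite invr_gt0.
rewrite [leLHS](_ : _ = M * `|s' - s|); last by field.
rewrite (@le_trans _ _ ((M + 1) * `|s' - s|))//.
  by rewrite ler_wpM2r// lerDl.
rewrite -ler_pdivlMl// distrC; near: s'.
apply/nbhs_ballP; exists ((M + 1)^-1 * e) => [|x]; first by apply: mulr_gt0 => //; rewrite invr_gt0.
by rewrite /ball/= => /ltW.
Unshelve. all: by end_near. Qed.

Let mg : measurable_fun setT g.
Proof. exact: continuous_measurable_fun continuous_cos_transform. Qed.

Section fubini.
Variables (f : R -> R).
Hypothesis if_ : mu.-integrable Rp (EFin \o f).

Let patch_f : mu.-integrable setT (EFin \o (f \_ Rp)).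
Proof.
have -> : EFin \o (f \_ Rp) = (EFin \o f) \_ Rp by rewrite restrict_EFin.
by apply/integrable_restrict => //; rewrite setTI.
Qed.

Lemma Rintegral_cos_transform :
  \int[mu]_(u in Rp) (f u * g u) =
  \int[nu]_z (w z * \int[mu]_(u in Rp) (f u * cos (u * t z))).
Proof.
pose h (x : T * R) := w x.1 * (f \_ Rp) x.2 * cos (x.2 * t x.1).
have ih : (nu \x mu)%E.-integrable setT (EFin \o h).
  apply: (bounded_integrableM (K := 1)) => //.
  - by apply: integrable_tensor.
  - apply: (measurableT_comp (f := @cos R)).
      by apply: continuous_measurable_fun; exact: continuous_cos.
    apply: measurable_funM; first exact: measurable_snd.
    by apply: measurableT_comp => //; exact: measurable_fst.
  - by move=> x _; exact: cos_max.
have := Rintegral_prod_swap ih; rewrite /h/= => E.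
rewrite [LHS]Rintegral_mkcond.
transitivity (\int[mu]_y \int[nu]_x (w x * (f \_ Rp) y * cos (y * t x))).
  apply: eq_Rintegral => u _.
  rewrite -[RHS]/(Rintegral _ _ _).
  under [RHS]eq_Rintegral do rewrite mulrAC mulrC.
  rewrite RintegralZl//; last exact: integrable_cos_transform.
  by rewrite !patchE; case: ifP; rewrite ?mul0r.
rewrite -E; apply: eq_Rintegral => z _.
have icz : mu.-integrable Rp (EFin \o (fun u => f u * cos (u * t z))).
  apply: (bounded_integrableM (K := 1)) => //.
    apply: measurable_funTS; apply: (measurableT_comp (f := @cos R)).
      by apply: continuous_measurable_fun; exact: continuous_cos.
    exact: measurable_funM.
  by move=> x _; exact: cos_max.
rewrite -RintegralZl// [RHS]Rintegral_mkcond; apply: eq_Rintegral => u _.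
by rewrite !patchE; case: ifP; rewrite ?mulr0 ?mul0r// mulrA.
Qed.

End fubini.

(** Fubini, then the cardinal sine integral in [u]. The factor [exp (- e u) / u] is not integrable
    near 0, so the domination must keep it together with [sin (u t)]: the quotient is at most [|t|],
    which leaves the integrable product of [2 |w t|] and [exp (- e u)]. *)
Lemma Rintegral_expR_cos_transformB k e : 0 < e ->
  \int[mu]_(u in Rp) (expR (- e * u) * ((g (k - u) - g (k + u)) / u)) =
  \int[nu]_z (w z * (2 * sin (k * t z) * atan (t z / e))).
Proof.
move=> e0.
pose q := (fun u : R => expR (- e * u) / u) \_ Rp.
have mq : measurable_fun setT q.
  apply/(measurable_restrictT _ _).1 => //.
  apply: open_continuous_measurable_fun => //.
  move=> u /[!inE]/=; rewrite in_itv/= andbT => u0.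
  apply: cvgM; first exact: continuous_expRN.
  by apply: cvgV; [rewrite gt_eqF|exact: cvg_id].
pose h (x : T * R) := w x.1 * (2 * sin (k * t x.1)) * (q x.2 * sin (x.2 * t x.1)).
have mh : measurable_fun setT h.
  apply: measurable_funM.
    apply: (measurableT_comp (f := fun z => w z * (2 * sin (k * t z)))); last exact: measurable_fst.
    by apply: measurable_funM => //; exact: measurable_funM.
  apply: measurable_funM; first by apply: measurableT_comp => //; exact: measurable_snd.
  apply: (measurableT_comp (f := @sin R)).
    by apply: continuous_measurable_fun; exact: continuous_sin.
  apply: measurable_funM; first exact: measurable_snd.
  by apply: measurableT_comp => //; exact: measurable_fst.
have ih : (nu \x mu)%E.-integrable setT (EFin \o h).
  have idom : (nu \x mu)%E.-integrable setT (EFin \o (fun x : T * R =>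
      (2 * `|w x.1 * t x.1|) * ((fun u : R => expR (- e * u)) \_ Rp) x.2)).
    apply: (integrable_tensor (f := fun z => 2 * `|w z * t z|)).
      by apply: RintegrableZl => //; exact: Rintegrable_norm.
    rewrite -restrict_EFin; apply/integrable_restrict => //; rewrite setTI.
    exact: integrable_expRN_oy.
  apply: Rle_integrable idom => //.
    move=> x _; rewrite /h /q !patchE; case: ifPn => [|_]; last first.
      by rewrite mul0r !mulr0 normr0.
    rewrite inE/= in_itv/= andbT => x0.
    rewrite [leRHS](_ : _ = `|w x.1| * 2 * (expR (- e * x.2) * `|t x.1|)); last first.
      by rewrite normrM; ring.
    rewrite normrM ler_pM//.
      by rewrite normrM ler_wpM2l// normrM gtr0_norm// ler_piMr// sin_max.
    rewrite -mulrA [X in _ * X]mulrC.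
    exact: normr_expR_sinc.
have := Rintegral_prod_swap ih; rewrite /h/= => E.
rewrite [LHS]Rintegral_mkcond.
transitivity (\int[mu]_y \int[nu]_x (w x * (2 * sin (k * t x)) * (q y * sin (y * t x)))).
  apply: eq_Rintegral => u _.
  rewrite [RHS](_ : _ = \int[nu]_x (q u * (w x * (2 * sin (k * t x) * sin (u * t x))))); last first.
    by apply: eq_Rintegral => z _; ring.
  rewrite RintegralZl//.
    by rewrite -cos_transformB /q !patchE; case: ifP => _; rewrite ?mul0r// -mulrA [_^-1 * _]mulrC.
  apply: (bounded_integrableM (K := 2)) => //.
    by apply: measurable_funM => //; exact: measurable_funM.
  move=> x _; rewrite -mulrA normrM gtr0_norm// ler_piMr//.
  by rewrite normrM mulr_ile1 ?sin_max.
rewrite -E; apply: eq_Rintegral => z _.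
rewrite -Rintegral_expR_sinc// (mulrA (w z) (2 * sin (k * t z))).
rewrite -RintegralZl//; last exact: integrable_expR_sinc.
rewrite [RHS]Rintegral_mkcond; apply: eq_Rintegral => u _.
rewrite /q /expR_sinc !patchE; case: ifP => _; last by rewrite mul0r mulr0.
ring.
Qed.

Hypothesis g_ge0 : forall s, 0 <= g s.
Variable K : R.
(* [e / (e ^ 2 + t ^ 2)] is the Abel mean of [cos (u t)] over the half-line, so
   this bound makes the nonnegative function [g] integrable. *)
Hypothesis hK : forall e : R, 0 < e ->
  \int[nu]_z (w z * (e / (e ^+ 2 + t z ^+ 2))) <= K.

Let e_ (n : nat) : R := n.+1%:R^-1.

Let e_gt0 n : 0 < e_ n. Proof. by rewrite /e_ invr_gt0. Qed.

Let e_cvg u : expR (- e_ n * u) @[n --> \oo] --> (1 : R).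
Proof.
rewrite -(@expR0 R); apply: continuous_cvg; first exact: continuous_expR.
rewrite -[X in _ --> X](mul0r u); apply: cvgM; last exact: cvg_cst.
by rewrite -oppr0; apply: cvgN; exact: cvg_harmonic.
Qed.

(** Since [g] is nonnegative, [exp (- e_ n u) * g u] increases to [g u], so monotone convergence
    applies. By Fubini each integral is the left-hand side of [hK], hence at most [K]. *)
Let integrable_gp : mu.-integrable Rp (EFin \o g).
Proof.
have mgp : measurable_fun Rp g by exact: measurable_funTS.
have gbd s : `|g s| <= \int[nu]_z `|w z|.
  rewrite (le_trans (le_normr_Rintegral _ _))//; first exact: integrable_cos_transform.
  apply: le_Rintegral => //.
  - exact/Rintegrable_norm/integrable_cos_transform.
  - exact: Rintegrable_norm.
  - by move=> z _; rewrite normrM ler_piMr// cos_max.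
have ige n : mu.-integrable Rp (EFin \o (fun u => expR (- e_ n * u) * g u)).
  apply: (bounded_integrableM (K := \int[nu]_z `|w z|)) => //.
  exact: integrable_expRN_oy.
have mn n : measurable_fun Rp (fun u => (expR (- e_ n * u) * g u)%:E).
  by have := measurable_int mu (ige n).
have ge0n n x : Rp x -> (0 <= (expR (- e_ n * x) * g x)%:E)%E.
  by move=> _; rewrite lee_fin mulr_ge0// expR_ge0.
have homon x : Rp x -> {homo (fun n => (expR (- e_ n * x) * g x)%:E) : n m / (n <= m)%N >-> (n <= m)%E}.
  rewrite /= in_itv/= andbT => x0 n m nm; rewrite lee_fin ler_wpM2r// ler_expR.
  rewrite !mulNr lerN2 ler_wpM2r ?(ltW x0)// /e_.
  by rewrite lef_pV2 ?posrE// ler_nat.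
have H := @cvg_monotone_convergence _ _ _ mu Rp (measurable_itv _) _ mn ge0n homon.
apply/integrableP; split; first exact/measurable_EFinP.
have -> : (\int[mu]_(x in Rp) `|(EFin \o g) x| =
    \int[mu]_(x in Rp) limn (fun n => (expR (- e_ n * x) * g x)%:E))%E.
  apply: eq_integral => u _ /=; apply/esym/cvg_lim => //; apply: cvg_EFin.
    exact: nearW.
  rewrite ger0_norm// -[X in _ --> X]mul1r; apply: cvgM; last exact: cvg_cst.
  exact: e_cvg.
apply: (@le_lt_trans _ _ K%:E); last by rewrite ltry.
rewrite -(cvg_lim _ H)//; apply: lime_le; first exact: cvgP H.
apply: nearW => n.
rewrite -[leLHS]fineK; last exact: integrable_fin_num (ige n).
rewrite lee_fin -/(Rintegral mu Rp (fun u => expR (- e_ n * u) * g u)).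
rewrite Rintegral_cos_transform; last exact: integrable_expRN_oy.
apply: le_trans (hK (e_gt0 n)); rewrite le_eqVlt; apply/orP; left; apply/eqP.
by apply: eq_Rintegral => z _; rewrite Rintegral_expRN_cos.
Qed.

Lemma integrable_cos_transformT : mu.-integrable setT (EFin \o g).
Proof.
have mR0 : measurable (`[0, +oo[%classic : set R) by exact: measurable_itv.
have i1 : mu.-integrable `[0, +oo[ (EFin \o g).
  have /integrableP[_ h] := integrable_gp.
  apply/integrableP; split; first by apply/measurable_EFinP; exact: measurable_funTS.
  rewrite -integral_itv_obnd_cbnd//.
  by apply: measurableT_comp => //; apply/measurable_EFinP; exact: measurable_funTS.
(* As [g] is even, [G] and its reflection together dominate it; at 0 both contribute, so an
   inequality is proved rather than an equality. *)
pose G := g \_ `[0, +oo[.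
have iG : mu.-integrable setT (EFin \o G).
  by rewrite /G -restrict_EFin; apply/integrable_restrict => //; rewrite setTI.
have iGN := integrable_reflect 0 iG.
apply: Rle_integrable (RintegrableD measurableT iG iGN) => //.
move=> x _; rewrite ger0_norm// /G !patchE !mem_setE !in_itv/= !andbT sub0r oppr_ge0.
have [x0|x0] := leP 0 x; first by rewrite lerDl; case: ifP.
rewrite (ltW x0) cos_transformN; change (g x <= 0 + g x); by rewrite add0r.
Qed.

(** The integrand [g s / (k - s)] folded about [k]: the points [s = k - u] and [s = k + u] are taken
    together. *)
Definition hilbert_kernel k u : R := (g (k - u) - g (k + u)) / u.
Local Notation D := hilbert_kernel.

Let gD k : measurable_fun setT (fun u : R => g (k + u)).
Proof. by apply: measurableT_comp => //; exact: measurable_funD. Qed.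

Let gB k : measurable_fun setT (fun u : R => g (k - u)).
Proof. by apply: measurableT_comp => //; exact: measurable_funB. Qed.

Let measurable_inv : measurable_fun (Rp : set R) (@GRing.inv R).
Proof.
apply: open_continuous_measurable_fun => //.
move=> u /[!inE]/=; rewrite in_itv/= andbT => u0.
by apply: cvgV; [rewrite gt_eqF|exact: cvg_id].
Qed.

(** On []0, 1]] the Lipschitz bound gives the constant [2 M]; beyond 1 the division by [u] only
    helps, and the translates of the integrable [g] dominate. *)
Lemma integrable_hilbert_kernel k : mu.-integrable Rp (EFin \o D k).
Proof.
have iR := integrable_reflect k integrable_cos_transformT.
have iR' : mu.-integrable setT (EFin \o (fun u => g (k + u))).
  have := integrable_reflect (- k) integrable_cos_transformT.
  by apply: eq_integrable => // u _ /=; rewrite -opprD cos_transformN.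
have mD : measurable_fun Rp (D k).
  apply: measurable_funM; last exact: measurable_inv.
  apply: measurable_funB; apply: measurable_funTS; [exact: gB|exact: gD].
have i1 : mu.-integrable Rp (EFin \o (fun u : R => 2 * M * \1_(`]0, 1]) u)).
  apply: RintegrableZl => //.
  by apply: (integrableS measurableT) => //; exact: integrable_indic_itv.
have i2 : mu.-integrable Rp (EFin \o (fun u => g (k - u) + g (k + u))).
  by apply: (integrableS measurableT) => //; exact: RintegrableD.
apply: Rle_integrable (RintegrableD _ i1 i2) => //.
move=> u /=; rewrite in_itv/= andbT => u0.
have [u1|u1] := leP u 1.
  rewrite indicE mem_set/= ?in_itv/= ?u0// mulr1.
  rewrite (@le_trans _ _ (2 * M))//; last by rewrite lerDl addr_ge0.
  rewrite normrM normfV ler_pdivrMr ?normr_gt0 ?gt_eqF//.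
  exact: cos_transformB_le.
rewrite (@le_trans _ _ (g (k - u) + g (k + u)))//; last first.
  by rewrite lerDr mulr_ge0 ?mulr_ge0// indicE.
rewrite normrM normfV ler_pdivrMr ?normr_gt0 ?gt_eqF//.
rewrite (le_trans (ler_normB _ _))// !ger0_norm// ?(ltW u0)//.
by rewrite ler_peMr ?addr_ge0// ltW.
Qed.

(** The damping [exp (- e_ n u)] is removed on both sides. On the right [atan (t / e_ n)] tends to
    [pi / 2] times the sign of [t], and this sign turns [sin (k t)] into [sin (k |t|)]. *)
Lemma Rintegral_hilbert_kernel k :
  \int[mu]_(u in Rp) D k u = pi * \int[nu]_z (w z * sin (k * `|t z|)).
Proof.
have c1 : \int[mu]_(u in Rp) (expR (- e_ n * u) * D k u) @[n --> \oo] -->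
    \int[mu]_(u in Rp) D k u.
  apply: (@Rdominated_cvg _ _ _ mu Rp (fun n u => expR (- e_ n * u) * D k u)
    (D k) (fun u => `|D k u|)).
  - exact: measurable_itv.
  - move=> n; apply: measurable_funM.
      by apply: measurable_funTS; exact: continuous_measurable_fun (@continuous_expRN _ _).
    exact: Rintegrable_measurable (integrable_hilbert_kernel k).
  - move=> u _; rewrite -[X in _ --> X]mul1r; apply: cvgM; last exact: cvg_cst.
    exact: e_cvg.
  - exact: Rintegrable_norm (integrable_hilbert_kernel k).
  - move=> n u /=; rewrite in_itv/= andbT => u0; rewrite normrM ler_piMl//.
    by rewrite ger0_norm ?expR_ge0// expR_le1 mulNr oppr_le0 mulr_ge0// ltW.
apply: (cvg_unique _ c1) => //.
have -> : (fun n => \int[mu]_(u in Rp) (expR (- e_ n * u) * D k u)) =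
    (fun n => \int[nu]_z (w z * (2 * sin (k * t z) * atan (t z / e_ n)))).
  by apply/funext => n; exact: Rintegral_expR_cos_transformB.
rewrite -RintegralZl//; last first.
  apply: (bounded_integrableM (K := 1)) => //; last by move=> *; exact: sin_max.
  apply: (measurableT_comp (f := @sin R)).
    by apply: continuous_measurable_fun; exact: continuous_sin.
  by apply: measurable_funM => //; exact: measurableT_comp.
apply: (@Rdominated_cvg _ _ _ nu setT
  (fun n z => w z * (2 * sin (k * t z) * atan (t z / e_ n)))
  (fun z => pi * (w z * sin (k * `|t z|))) (fun z => `|w z| * pi)) => //.
- move=> n; apply: measurable_funM => //; apply: measurable_funM.
    exact: measurable_funM.
  apply: (measurableT_comp (f := @atan R)).
    by apply: continuous_measurable_fun; exact: continuous_atan.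
  exact: measurable_funM.
- move=> z _; rewrite mulrCA; apply: cvgM; first exact: cvg_cst.
  have at0 (x : R) : 0 < x -> atan (x / e_ n) @[n --> \oo] --> pi / 2.
    move=> x0.
    have xy : (x / e_ n : R) @[n --> \oo] --> +oo%R.
      apply/cvgryPge => A; near=> n; rewrite /e_ invrK -ler_pdivrMl//.
      rewrite (@le_trans _ _ n%:R) ?ler_nat//.
      by near: n; exact: nbhs_infty_ger.
    exact: (cvg_comp _ _ xy (@cvgy_atan R)).
  have [tz0|tz0|->] := ltgtP (t z) 0.
  + rewrite ltr0_norm// (_ : pi * _ = 2 * sin (k * t z) * (- (pi / 2))); last first.
      by rewrite mulrN sinN; field.
    apply: cvgM; first exact: cvg_cst.
    under eq_fun do rewrite -[t z]opprK mulNr atanN.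
    by apply: cvgN; apply: at0; rewrite oppr_gt0.
  + rewrite gtr0_norm// (_ : pi * _ = 2 * sin (k * t z) * (pi / 2)); last by field.
    by apply: cvgM; [exact: cvg_cst|exact: at0].
  + rewrite normr0 mulr0 sin0 !mulr0.
    by under eq_fun do rewrite mul0r; exact: cvg_cst.
- under eq_fun do rewrite mulrC.
  by apply: RintegrableZl => //; exact: Rintegrable_norm.
- move=> n z _; rewrite normrM ler_wpM2l// !normrM gtr0_norm//.
  have a1 : `|atan (t z / e_ n)| <= pi / 2.
    by rewrite ler_norml !ltW// ?atan_gtNpi2 ?atan_ltpi2.
  have := sin_max (k * t z); have := normr_ge0 (sin (k * t z)).
  have := normr_ge0 (atan (t z / e_ n)); have := pi_gt0 R; nra.
Unshelve. all: by end_near. Qed.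

Lemma Rintegral_truncated_hilbert k e : 0 < e ->
  \int[mu]_(s in [set s : R | e < `|s - k|]) (g s / (k - s)) =
  \int[mu]_(u in `]e, +oo[) D k u.
Proof.
move=> e0.
have mA : measurable ([set s : R | e < `|s - k|] : set R).
  have -> : [set s : R | e < `|s - k|] = ~` `[k - e, k + e]%classic.
    apply/seteqP; split => s /=; rewrite in_itv/=.
      by move=> h; apply/negP; move: h; rewrite real_ltNge ?num_real// ler_distl.
    by move=> /negP; rewrite real_ltNge ?num_real// ler_distl.
  by apply: measurableC; exact: measurable_itv.
(* [F1] carries the points [s < k - e] through [u = k - s]. [F2] carries those with [s > k + e]; it
   enters reflected, because there [k - s] is negative. *)
pose F1 := (fun u => g (k - u) / u) \_ `]e, +oo[.
pose F2 := (fun u => g (k + u) / u) \_ `]e, +oo[.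
have meo : measurable (`]e, +oo[%classic : set R) by exact: measurable_itv.
have minve : measurable_fun (`]e, +oo[%classic : set R) (@GRing.inv R).
  apply: measurable_funS measurable_inv => //.
  by move=> x /=; rewrite !in_itv/= !andbT; exact: lt_trans.
have iF (f : R -> R) : mu.-integrable setT (EFin \o f) ->
    mu.-integrable setT (EFin \o ((fun u => f u / u) \_ `]e, +oo[)).
  move=> if_; rewrite -restrict_EFin; apply/integrable_restrict => //; rewrite setTI.
  apply: (bounded_integrableM (K := e^-1)) => //.
    exact: (integrableS measurableT).
  move=> u /=; rewrite in_itv/= andbT => eu.
  have u0 := lt_trans e0 eu.
  rewrite ger0_norm; last by rewrite invr_ge0 ltW.
  by rewrite lef_pV2 ?posrE// ltW.
have iR' : mu.-integrable setT (EFin \o (fun u => g (k + u))).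
  have := integrable_reflect (- k) integrable_cos_transformT.
  by apply: eq_integrable => // u _ /=; rewrite -opprD cos_transformN.
have iF1 : mu.-integrable setT (EFin \o F1).
  exact: iF (integrable_reflect k integrable_cos_transformT).
have iF2 : mu.-integrable setT (EFin \o F2) by exact: iF.
rewrite Rintegral_mkcond.
transitivity (\int[mu]_u (F1 u - F2 (0 - u))).
  have iF2' := integrable_reflect 0 iF2.
  have mFF : measurable_fun setT (fun u => F1 u - F2 (0 - u)).
    exact: Rintegrable_measurable (RintegrableB measurableT iF1 iF2').
  rewrite -(Rintegral_reflect k mFF); apply: eq_Rintegral => s _.
  rewrite /F1 /F2 !patchE !mem_setE !in_itv/= !andbT.
  rewrite (_ : k - (k - s) = s); last by ring.
  rewrite (_ : k + (0 - (k - s)) = s); last by ring.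
  (* Outside its domain a restriction takes the value [point], which is 0 here. *)
  have p0 : (point : R) = 0 by []; rewrite !p0.
  case: ifPn => [h0|h0].
    have h : e < `|s - k| := h0.
    have [ks|ks] := ltP e (k - s).
      rewrite ifF ?subr0//; apply/negbTE; rewrite -leNgt; lra.
    rewrite ifT ?sub0r.
      by rewrite invrN mulrN opprK.
    have [sk0|sk0] := ltP (s - k) 0.
      by move: h; rewrite ltr0_norm// opprB ltNge ks.
    by move: h; rewrite ger0_norm// opprB.
  have : ~~ (e < `|s - k|) := h0.
  rewrite -leNgt ler_norml => /andP[h1 h2].
  by rewrite !ifF ?subr0//; apply/negbTE; rewrite -leNgt; lra.
rewrite RintegralB//; last exact: integrable_reflect.
rewrite (Rintegral_reflect 0 (Rintegrable_measurable iF2)) -RintegralB//.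
rewrite [RHS]Rintegral_mkcond; apply: eq_Rintegral => u _.
by rewrite /F1 /F2 !patchE; case: ifP; rewrite ?subr0// /D mulrBl.
Qed.

(** After folding, the truncated integrals run over []e, +oo[] with an integrand that is integrable
    up to 0, so the limit is no longer singular. *)
Theorem pv_cos_transform k :
  \int[mu]_(s in [set s : R | e < `|s - k|]) (g s / (k - s)) @[e --> 0^'+] -->
  pi * \int[nu]_z (w z * sin (k * `|t z|)).
Proof.
rewrite -Rintegral_hilbert_kernel; apply/cvg_at_rightP => e_n [en0 en_cvg].
have EE n : \int[mu]_(u in `]e_n n, +oo[) D k u =
    \int[mu]_(u in Rp) (D k \_ `]e_n n, +oo[) u.
  rewrite -Rintegral_mkcondr; congr Rintegral; apply/seteqP; split => x /=.
    by rewrite !in_itv/= !andbT => h; split => //; exact: lt_trans h.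
  by case.
rewrite (_ : (fun n => _) = (fun n => \int[mu]_(u in Rp) (D k \_ `]e_n n, +oo[) u)); last first.
  by apply/funext => n; rewrite -EE; exact: Rintegral_truncated_hilbert.
have iD := integrable_hilbert_kernel k.
apply: (@Rdominated_cvg _ _ _ mu Rp (fun n => D k \_ `]e_n n, +oo[)
    (D k) (fun u => `|D k u|)).
- exact: measurable_itv.
- move=> n; apply: measurable_funTS; apply/(measurable_restrictT _ _).1 => //.
  apply: measurable_funS (Rintegrable_measurable iD) => //.
  by move=> x /=; rewrite !in_itv/= !andbT; exact: lt_trans.
- move=> u /=; rewrite in_itv/= andbT => u0.
  apply: cvg_near_cst; near=> n; rewrite patchE mem_set//= in_itv/= andbT.
  by near: n; apply: (cvgr_lt 0).
- exact: Rintegrable_norm.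
- by move=> n u _; rewrite patchE; case: ifP => // _; rewrite normr0.
Unshelve. all: by end_near. Qed.

End sine_transform.

(** * The autocorrelation of the profile and its Fourier transform *)

Section profile.
Context {R : realType}.
Local Notation mu := (@lebesgue_measure R).
Variable eta : R -> R.
Hypothesis heta : piecewise_continuous eta.
Hypothesis hdecay : exponentially_decaying eta.

(** The set [D] of discontinuities is a countable union of finite sets. A point of continuity in the
    preimage of an open interval lies in the interior of that preimage, so the preimage is an open
    set up to countable sets. *)
Lemma piecewise_continuous_measurable : measurable_fun setT eta.
Proof.
pose D := [set x : R | ~ (eta x' @[x' --> x] --> eta x)].
have cD : countable D.
  have -> : D = \bigcup_n [set x : R | - n%:R <= x <= n%:R /\
      ~ (eta x' @[x' --> x] --> eta x)].
    apply/seteqP; split => [x Dx|x [n _ []]//].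
    exists (Num.Def.archi_bound `|x|) => //; split => //.
    by rewrite -ler_norml ltW// archi_boundP.
  apply: bigcup_countable => // n _; apply: finite_set_countable.
  exact: heta.2.
have mset1 : forall t : R, measurable [set t] by move=> t; exact: measurable_set1.
have mcount (A : set R) : countable A -> measurable A.
  by move=> cA; exact: countable_measurable.
move=> _; apply: (measurability _ (RGenOpens.measurableE R)) => //.
move=> /= _ [_ [a [b ->]] <-]; rewrite setTI.
set O := `]a, b[%classic : set R.
have oO : open O by exact: interval_open.
have -> : eta @^-1` O = (interior (eta @^-1` O) `\` D) `|` (eta @^-1` O `&` D).
  apply/seteqP; split => x /=; last by case=> [[/interior_subset]|[]].
  move=> Ox; have [Dx|nDx] := pselect (D x); [by right|left; split => //].
  have ex : eta x' @[x' --> x] --> eta x by exact: contrapT nDx.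
  by apply: ex; exact: open_nbhs_nbhs.
apply: measurableU.
  apply: measurableD; last exact: mcount.
  by apply: open_measurable; exact: open_interior.
by apply: mcount; apply: sub_countable cD; apply: subset_card_le => x [].
Qed.

Lemma integrable_exp_abs (a : R) : 0 < a ->
  mu.-integrable setT (EFin \o (fun x => expR (- a * `|x|))).
Proof.
move=> a0; pose G := (fun x : R => expR (- a * x)) \_ `[0, +oo[.
have iG : mu.-integrable setT (EFin \o G).
  rewrite /G -restrict_EFin; apply/integrable_restrict => //.
  by rewrite setTI; exact: integrable_expRN.
apply: Rle_integrable (RintegrableD measurableT iG (integrable_reflect 0 iG)) => //.
  apply: (measurableT_comp (f := fun x : R => expR (- a * x))) => //.
  exact: continuous_measurable_fun (@continuous_expRN _ _).
move=> x _; rewrite ger0_norm ?expR_ge0// /G !patchE !mem_setE !in_itv/= !andbT.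
have p0 : (point : R) = 0 by []; rewrite !p0.
rewrite sub0r oppr_ge0; have [x0|x0] := leP 0 x.
  by rewrite ger0_norm// lerDl; case: ifP => // _; exact: expR_ge0.
by rewrite (ltW x0) ltr0_norm// add0r.
Qed.

Let mprof := piecewise_continuous_measurable.

Lemma profile_bounded : exists C : R, 0 < C /\ forall x, `|eta x| <= C.
Proof.
have [C [a [C0 a0 h]]] := hdecay; exists C; split => // x.
rewrite (le_trans (h x))// ler_piMr ?(ltW C0)// expR_le1 mulNr oppr_le0.
by rewrite mulr_ge0// ltW.
Qed.

Lemma integrable_profile : mu.-integrable setT (EFin \o eta).
Proof.
have [C [a [C0 a0 h]]] := hdecay.
by apply: Rle_integrable (RintegrableZl C measurableT (integrable_exp_abs a0)).
Qed.

Lemma integrable_profileX : mu.-integrable setT (EFin \o (fun x => x * eta x)).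
Proof.
have [C [a [C0 a0 h]]] := hdecay.
(* Half of the decay rate absorbs the factor [x], since [|x| <= (2 / a) exp (a |x| / 2)]. *)
have a2 : 0 < a / 2 by rewrite divr_gt0.
apply: Rle_integrable (RintegrableZl (2 / a * C) measurableT (integrable_exp_abs a2)) => //.
  exact: measurable_funM.
move=> x _; rewrite normrM.
have -> : expR (- (a / 2) * `|x|) = expR (a / 2 * `|x|) * expR (- a * `|x|).
  by rewrite -expRD; congr expR; field.
rewrite (_ : _ * (_ * _) = (2 / a * expR (a / 2 * `|x|)) * (C * expR (- a * `|x|))); last by ring.
rewrite ler_pM// -ler_pdivrMl ?divr_gt0// invf_div.
by rewrite (le_trans _ (expR_ge1Dx _))// lerDr.
Qed.

Lemma integrable_profile_sqr : mu.-integrable setT (EFin \o (fun x => eta x ^+ 2)).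
Proof.
have [C [C0 h]] := profile_bounded.
by apply: (bounded_integrableM (K := C)) => //; exact: integrable_profile.
Qed.

Lemma Rintegral_cauchy (e : R) : 0 < e ->
  mu.-integrable setT (EFin \o (fun u => e / (e ^+ 2 + u ^+ 2))) /\
  \int[mu]_u (e / (e ^+ 2 + u ^+ 2)) = pi.
Proof.
move=> e0; pose f u := e / (e ^+ 2 + u ^+ 2).
have d0 (u : R) : 0 < e ^+ 2 + u ^+ 2 by rewrite ltr_pwDl ?exprn_gt0// sqr_ge0.
have f0 u : 0 <= f u by rewrite divr_ge0 ?ltW.
have cf : continuous f.
  move=> u; apply: cvgM; first exact: cvg_cst.
  apply: cvgV; first by rewrite gt_eqF.
  by apply: cvgD; [exact: cvg_cst|exact: exprn_continuous].
have dF (u : R) : is_derive u (1 : R) (fun u => atan (u / e)) (f u).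
  apply: is_derive_eq.
  by rewrite /GRing.scale/= /f; field; rewrite !gt_eqF.
have cF := is_derive_continuous dF.
have E : (\int[mu]_u (f u)%:E = pi%:E)%E.
  rewrite ge0_symfun_integralT//; last by move=> u; rewrite /f/= sqrrN.
  rewrite -set_itvcy (@ge0_continuous_FTC2y _ f (fun u => atan (u / e)) 0 (pi / 2))//.
  - by rewrite mul0r atan0 sube0 -EFinM mulrC divfK.
  - exact: continuous_subspaceT.
  - have xy : (x / e : R) @[x --> +oo%R] --> +oo%R.
      apply/cvgryPge => A; near=> x; rewrite ler_pdivlMr//.
    exact: (cvg_comp _ _ xy (@cvgy_atan R)).
  - exact/cvg_at_right_filter/cF.
  - by move=> x _; rewrite derive1E; apply: derive_val.
split; last by rewrite /Rintegral E.
suff: mu.-integrable setT (EFin \o f) by [].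
apply/integrableP; split.
  by apply/measurable_EFinP; exact: continuous_measurable_fun.
have -> : (\int[mu]_x `|(EFin \o f) x| = \int[mu]_u (f u)%:E)%E.
  by apply: eq_integral => u _ /=; rewrite (ger0_norm (f0 u)).
by rewrite E ltry.
Unshelve. all: by end_near. Qed.

Local Notation mu2 := (prodm mu mu).
Let w (z : R * R) := eta z.1 * eta z.2.
Let t (z : R * R) := z.1 - z.2.

Let mt : measurable_fun setT t.
Proof. by apply: measurable_funB; [exact: measurable_fst|exact: measurable_snd]. Qed.

Let iw : mu2.-integrable setT (EFin \o w).
Proof. exact: (integrable_tensor integrable_profile integrable_profile). Qed.

Let iwt : mu2.-integrable setT (EFin \o (fun z => w z * t z)).
Proof.
have i1 := integrable_tensor integrable_profileX integrable_profile.
have i2 := integrable_tensor integrable_profile integrable_profileX.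
apply: eq_integrable (RintegrableB measurableT i1 i2) => // z _ /=.
by congr EFin; rewrite /w /t; ring.
Qed.

Let mtrig (h : R -> R) s : continuous h -> measurable_fun setT (fun x : R => h (s * x)).
Proof.
move=> ch; apply: (measurableT_comp (f := h)); first exact: continuous_measurable_fun.
exact: measurable_funM.
Qed.

Lemma integrable_profile_cos s :
  mu.-integrable setT (EFin \o (fun x => eta x * cos (s * x))).
Proof.
apply: (bounded_integrableM (K := 1)) => //; first exact: integrable_profile.
  by apply: mtrig; exact: continuous_cos.
by move=> *; exact: cos_max.
Qed.

Lemma integrable_profile_sin s :
  mu.-integrable setT (EFin \o (fun x => eta x * sin (s * x))).
Proof.
apply: (bounded_integrableM (K := 1)) => //; first exact: integrable_profile.
  by apply: mtrig; exact: continuous_sin.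
by move=> *; exact: sin_max.
Qed.

Lemma sqmod_fourier s :
  sqmod (fourier eta s) = \int[mu2]_z (eta z.1 * eta z.2 * cos (s * (z.1 - z.2))).
Proof.
have ic := integrable_profile_cos s; have is_ := integrable_profile_sin s.
have icc := integrable_tensor ic ic; have iss := integrable_tensor is_ is_.
rewrite /sqmod /fourier /cint /=.
have -> : \int[mu]_x (eta x * cos (s * x) - 0 * sin (s * x)) =
    \int[mu]_x (eta x * cos (s * x)).
  by apply: eq_Rintegral => x _; rewrite mul0r subr0.
have -> : \int[mu]_x (eta x * sin (s * x) + 0 * cos (s * x)) =
    \int[mu]_x (eta x * sin (s * x)).
  by apply: eq_Rintegral => x _; rewrite mul0r addr0.
rewrite !expr2 -(Rintegral_tensor ic ic) -(Rintegral_tensor is_ is_).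
rewrite -(RintegralD measurableT icc iss).
by apply: eq_Rintegral => z _; rewrite mulrBr cosB; ring.
Qed.

(** One factor [eta] is bounded by [C]; the kernel then has mass [pi] in the second variable for
    each value of the first, whatever [e] is. The other factor is integrable. *)
Lemma profile_cauchy_bound : exists K : R, forall e : R, 0 < e ->
  \int[mu2]_z (w z * (e / (e ^+ 2 + t z ^+ 2))) <= K.
Proof.
have [C [C0 hC]] := profile_bounded.
exists (\int[mu]_x (`|eta x| * (C * pi))) => e e0.
have [ic cE] := Rintegral_cauchy e0.
pose f (u : R) := e / (e ^+ 2 + u ^+ 2).
have mf : measurable_fun setT f by exact: Rintegrable_measurable ic.
have d0 (u : R) : 0 < e ^+ 2 + u ^+ 2 by rewrite ltr_pwDl ?exprn_gt0// sqr_ge0.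
have f0 u : 0 <= f u by rewrite divr_ge0 ?ltW.
(* This bound blows up with [e] tending to 0; it serves integrability at fixed [e] only and does not
   enter the constant. *)
have fe u : `|f u| <= e^-1.
  rewrite ger0_norm// /f ler_pdivrMr// expr2 mulrDr mulKf ?gt_eqF// lerDl.
  by rewrite mulr_ge0 ?invr_ge0 ?sqr_ge0// ltW.
have iwf : mu2.-integrable setT (EFin \o (fun z => w z * f (t z))).
  apply: (bounded_integrableM (K := e^-1)) => //.
  exact: measurableT_comp.
have ifx (x : R) : mu.-integrable setT (EFin \o (fun y => f (x - y))).
  exact: integrable_reflect.
have iwx (x : R) : mu.-integrable setT (EFin \o (fun y => w (x, y) * f (t (x, y)))).
  apply: (bounded_integrableM (K := e^-1)) => //.
    exact: (RintegrableZl (eta x) measurableT integrable_profile).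
  exact: Rintegrable_measurable (ifx x).
rewrite [leLHS](Rintegral_prod iwf).
apply: le_Rintegral => //.
- exact: (integrable_Rintegral_prod iwf iwx).
- apply: (bounded_integrableM (K := `|C * pi|)) => //.
  exact: Rintegrable_norm integrable_profile.
move=> x _; apply: (@le_trans _ _ (\int[mu]_y (`|eta x| * C * f (x - y)))).
  apply: le_Rintegral => //; first exact: RintegrableZl.
  move=> y _; rewrite /w /t/= ler_wpM2r//.
  by rewrite (le_trans (ler_norm _))// normrM ler_wpM2l.
rewrite (RintegralZl _ measurableT (ifx x)) (Rintegral_reflect x mf) cE.
by rewrite mulrA.
Qed.

Theorem pv_sqmod_fourier k :
  pv_integral (fun s => sqmod (fourier eta s) / (k - s)) k =
  pi * \int[mu2]_z (eta z.1 * eta z.2 * sin (k * `|z.1 - z.2|)).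
Proof.
have [K hK] := profile_cauchy_bound.
have gE s : cos_transform mu2 w t s = sqmod (fourier eta s) by rewrite sqmod_fourier.
have g0 s : 0 <= cos_transform mu2 w t s.
  by rewrite gE /sqmod addr_ge0 ?sqr_ge0.
have := pv_cos_transform (nu := mu2) (k := k) mt iw iwt g0 hK.
under eq_fun do under eq_Rintegral do rewrite gE.
by move=> /cvg_lim => /(_ (@Rhausdorff R)).
Qed.

End profile.

(** * Weak derivatives and the virial identity *)

Section spline.
Context {R : realType}.
Local Notation mu := (@lebesgue_measure R).

Let r (t : R) : R := Num.max t 0.
Let q (t : R) : R := r t ^+ 2.

(** The squared positive part differs from its linearization at [t] by at most [h ^ 2], by cases on
    the signs of [t] and [h + t]. *)
Let q_derive (t : R) : is_derive t (1 : R) q (2 * r t).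
Proof.
have H : h^-1 *: (q (h + t) - q t) @[h --> 0^'] --> 2 * r t.
  apply/cvgrPdist_le => e e0; near=> h.
  have h0 : h != 0 by near: h; exact: nbhs_dnbhs_neq.
  have he : `|h| <= e by near: h; exact: dnbhs0_le.
  rewrite (le_trans _ he)// -(ler_pM2r (_ : 0 < `|h|)) ?normr_gt0//.
  rewrite -normrM mulrBl /GRing.scale/= -mulrA mulrCA mulrA.
  rewrite [X in _ - X](_ : _ = q (h + t) - q t); last by field.
  rewrite -expr2 -normrX ler_norml /q /r !maxEle.
  rewrite [`|h ^+ 2|]ger0_norm ?sqr_ge0//.
  by case: ifPn; rewrite -?ltNge => ?; case: ifPn; rewrite -?ltNge => ?;
    apply/andP; split; nra.
have der : derivable q t 1.
  apply/cvg_ex; exists (2 * r t).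
  by under eq_fun do rewrite scaler1.
split => //; rewrite -derive1E; exact/cvg_lim.
Unshelve. all: by end_near. Qed.

(* A C^1 quadratic spline and its derivative, of integral 1, whose rescalings
   form an approximate identity. *)
Definition smoothstep (t : R) : R := 2 * (q t - 2 * q (t - 2^-1) + q (t - 1)).
Definition hat (t : R) : R := 4 * (r t - 2 * r (t - 2^-1) + r (t - 1)).

Lemma is_derive_smoothstep (t : R) : is_derive t (1 : R) smoothstep (hat t).
Proof.
have d1 := q_derive t; have d2 := q_derive (t - 2^-1); have d3 := q_derive (t - 1).
rewrite /smoothstep.
apply: is_derive_eq.
by rewrite /GRing.scale/= /hat; ring.
Qed.

Lemma smoothstep_le0 t : t <= 0 -> smoothstep t = 0.
Proof. by move=> t0; rewrite /smoothstep /q /r !max_r; [ring|lra..]. Qed.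

Lemma smoothstep_ge1 t : 1 <= t -> smoothstep t = 1.
Proof. by move=> t1; rewrite /smoothstep /q /r !max_l; [field|lra..]. Qed.

Lemma smoothstep_itv t : 0 <= smoothstep t <= 1.
Proof.
rewrite /smoothstep /q /r !maxEle.
by do 3 case: ifPn; rewrite -?ltNge => *; apply/andP; split; nra.
Qed.

Lemma hat_ge0 t : 0 <= hat t.
Proof. by rewrite /hat /r !maxEle; do 3 case: ifPn; rewrite -?ltNge => *; lra. Qed.

Lemma hat_le2 t : hat t <= 2.
Proof. by rewrite /hat /r !maxEle; do 3 case: ifPn; rewrite -?ltNge => *; lra. Qed.

Lemma hat_out t : t <= 0 \/ 1 <= t -> hat t = 0.
Proof. by rewrite /hat /r !maxEle => -[] ?; do 3 case: ifPn; rewrite -?ltNge => *; lra. Qed.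

Lemma continuous_hat : continuous hat.
Proof.
have cr (c : R) : continuous (fun t => r (t - c)).
  move=> t; apply: (@continuous_max _ _ (fun t => t - c) (cst 0)).
    by apply: cvgB; [exact: cvg_id|exact: cvg_cst].
  exact: cvg_cst.
have cr0 : continuous r.
  have -> : r = (fun t => r (t - 0)) by apply/funext => t; rewrite subr0.
  exact: cr.
move=> t; apply: cvgM; first exact: cvg_cst.
apply: cvgD; last exact: cr.
apply: cvgB; first exact: cr0.
by apply: cvgM; [exact: cvg_cst|exact: cr].
Qed.

Section bump.
Variables (a b c : R).
Hypothesis (ab : a < b) (c1 : 1 <= c).

(** It climbs from 0 to 1 just to the right of [a] and descends just to the right of [b], in each
    case within [1 / c]. For [c >= 1] the support stays in [[a, b + 1]], and for large [c] the
    derivative is the difference of two approximate point masses. *)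
Definition bump (y : R) : R := smoothstep (c * (y - a)) - smoothstep (c * (y - b)).
Definition dbump (y : R) : R := c * hat (c * (y - a)) - c * hat (c * (y - b)).

Let c0 : 0 < c. Proof. exact: lt_le_trans c1. Qed.

Lemma is_derive_bump (y : R) : is_derive y (1 : R) bump (dbump y).
Proof.
have d1 (z x : R) : is_derive x (1 : R) (fun y => smoothstep (c * (y - z))) (c * hat (c * (x - z))).
  have ds := is_derive_smoothstep (c * (x - z)).
  have dl : is_derive x (1 : R) (fun y : R => c * (y - z)) c.
    by apply: is_derive_eq; rewrite /GRing.scale/=; ring.
  have := @is_derive1_comp _ smoothstep (fun y : R => c * (y - z)) x _ _ ds dl.
  by rewrite mulrC.
have da := d1 a y; have db := d1 b y.
rewrite /bump; exact: is_deriveB.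
Qed.

Lemma continuous_dbump : continuous dbump.
Proof.
have ch (z : R) : continuous (fun y => c * hat (c * (y - z))).
  move=> y; apply: cvgM; first exact: cvg_cst.
  apply: continuous_cvg; first exact: continuous_hat.
  apply: cvgM; first exact: cvg_cst.
  by apply: cvgB; [exact: cvg_id|exact: cvg_cst].
by move=> y; apply: cvgB; exact: ch.
Qed.

Lemma bump_le2 y : `|bump y| <= 1.
Proof.
have /andP[? ?] := smoothstep_itv (c * (y - a)).
have /andP[? ?] := smoothstep_itv (c * (y - b)).
by rewrite ler_norml /bump; apply/andP; split; lra.
Qed.

Lemma bump_out y : y < a \/ b + 1 < y -> bump y = 0.
Proof.
rewrite /bump => -[ya|by1].
  have ha : c * (y - a) <= 0 by rewrite pmulr_rle0//; lra.
  have hb : c * (y - b) <= 0 by rewrite pmulr_rle0// subr_le0 ltW// (lt_trans ya).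
  by rewrite (smoothstep_le0 ha) (smoothstep_le0 hb) subrr.
have h (z : R) : z <= b -> 1 <= c * (y - z).
  move=> zb; rewrite -[leLHS]mulr1 ler_pM// lerBrDl.
  by rewrite (le_trans _ (ltW by1))// lerD2r.
by rewrite (smoothstep_ge1 (h a (ltW ab))) (smoothstep_ge1 (h b (lexx b))) subrr.
Qed.

Lemma test_function_bump : test_function bump.
Proof.
have D v y : 'D_v bump y = v * dbump y.
  have [dy <-] := is_derive_bump y.
  have dfy : differentiable bump y by apply/derivable1_diffP.
  rewrite !deriveE// -[X in 'd _ _ X = _]mulr1.
  by have := linearZ_LR ('d bump y) v 1.
split.
- move=> v z; apply/diff_derivable/derivable1_diffP.
  by case: (is_derive_bump z).
- move=> v; have -> : (fun z => 'D_v bump z) = (fun z => v * dbump z) by apply/funext.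
  by move=> z; apply: cvgM; [exact: cvg_cst|exact: continuous_dbump].
- apply: (subclosed_compact _ (@segment_compact _ a (b + 1))).
    exact: closed_closure.
  have /closure_id -> : closed `[a, b + 1]%classic by exact: interval_closed.
  apply: closure_subset => z /= nz; rewrite in_itv/=.
  have [za|za] := ltP z a; first by rewrite bump_out ?eqxx// in nz; left.
  have [zb|//] := ltP (b + 1) z; by rewrite bump_out ?eqxx// in nz; right.
Qed.

End bump.

Lemma Rintegral_hat (a c : R) : 0 < c ->
  mu.-integrable setT (EFin \o (fun y => c * hat (c * (y - a)))) /\
  \int[mu]_y (c * hat (c * (y - a))) = 1.
Proof.
move=> c0.
have ac : a < a + c^-1 by rewrite ltrDl invr_gt0.
have ch : continuous (fun y => c * hat (c * (y - a))).
  move=> y; apply: cvgM; first exact: cvg_cst.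
  apply: continuous_cvg; first exact: continuous_hat.
  apply: cvgM; first exact: cvg_cst.
  by apply: cvgB; [exact: cvg_id|exact: cvg_cst].
have hE : (fun y => c * hat (c * (y - a))) =
    (fun y => c * hat (c * (y - a))) \_ `[a, a + c^-1].
  apply/funext => y; rewrite patchE mem_setE in_itv/=; case: ifPn => // h.
  rewrite hat_out ?mulr0//; move: h; rewrite negb_and -!ltNge => /orP[h|h].
    by left; rewrite pmulr_rle0//; lra.
  by right; rewrite -ler_pdivrMl// mulr1; lra.
split.
  rewrite hE -restrict_EFin; apply/integrable_restrict => //; rewrite setTI.
  apply: continuous_compact_integrable; first exact: segment_compact.
  exact: continuous_subspaceT.
rewrite hE -Rintegral_mkcond.
have dF (x : R) : is_derive x (1 : R) (fun y => smoothstep (c * (y - a))) (c * hat (c * (x - a))).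
  have ds := is_derive_smoothstep (c * (x - a)).
  have dl : is_derive x (1 : R) (fun y : R => c * (y - a)) c.
    by apply: is_derive_eq; rewrite /GRing.scale/=; ring.
  have := @is_derive1_comp _ smoothstep (fun y : R => c * (y - a)) x _ _ ds dl.
  by rewrite mulrC.
rewrite (is_derive_FTC2 ac ch dF) smoothstep_ge1 ?smoothstep_le0 ?subr0//.
  by rewrite subrr mulr0.
by rewrite addrAC subrr add0r divff// gt_eqF.
Qed.

End spline.

Section weak_derivative.
Context {R : realType}.
Local Notation mu := (@lebesgue_measure R).

Lemma Lfun_measurable d (T : measurableType d) (nu : {measure set T -> \bar R})
  (u : T -> R) : u \in Lfun nu 2%:E -> measurable_fun setT u.
Proof. by rewrite inE => /andP[]; rewrite inE. Qed.

Lemma Lfun2_mul_integrable d (T : measurableType d) (nu : {measure set T -> \bar R})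
  (u v : T -> R) : u \in Lfun nu 2%:E -> v \in Lfun nu 2%:E ->
  nu.-integrable setT (EFin \o (fun x => u x * v x)).
Proof. by move=> hu hv; apply/Lfun1_integrable; exact: Lfun2_mul_Lfun1. Qed.

(** From [|u| <= 1 + u ^ 2], the constant being integrable on a compact set. *)
Lemma Lfun2_compact_integrable (u : R -> R) (K : set R) :
  u \in Lfun mu 2%:E -> compact K -> mu.-integrable K (EFin \o u).
Proof.
move=> hu cK; have mK : measurable (K : set (measurableTypeR R)) by exact: compact_measurable.
have i1 : mu.-integrable K (EFin \o cst 1).
  apply: continuous_compact_integrable => //.
  by apply: continuous_subspaceT => x; exact: cvg_cst.
have i2 : mu.-integrable K (EFin \o (fun x => u x ^+ 2)).
  by apply: (integrableS measurableT) => //; exact: Lfun2_integrable_sqr.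
apply: Rle_integrable (RintegrableD mK i1 i2) => //.
  by apply: measurable_funTS; exact: Lfun_measurable hu.
move=> x _ /=; rewrite -[u x ^+ 2]real_normK ?num_real//.
by have := normr_ge0 (u x); nra.
Qed.

Lemma Lfun2_locally_integrable (u : R -> R) :
  u \in Lfun mu 2%:E -> locally_integrable setT u.
Proof.
move=> hu; split; [exact: Lfun_measurable hu|exact: openT|].
move=> K _ cK; have /integrableP[_] := Lfun2_compact_integrable hu cK.
by [].
Qed.

Lemma integrable_mul_hat (u : R -> R) (a c : R) : locally_integrable setT u ->
  0 < c -> mu.-integrable setT (EFin \o (fun y => u y * (c * hat (c * (y - a))))).
Proof.
move=> [mu_ _ lu] c0; set k := fun y => c * hat (c * (y - a)).
have ck : continuous k.
  move=> y; apply: cvgM; first exact: cvg_cst.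
  apply: continuous_cvg; first exact: continuous_hat.
  apply: cvgM; first exact: cvg_cst.
  by apply: cvgB; [exact: cvg_id|exact: cvg_cst].
have -> : (fun y => u y * k y) = (fun y => u y * k y) \_ `[a, a + c^-1].
  apply/funext => y; rewrite patchE mem_setE in_itv/=; case: ifPn => // h.
  rewrite /k hat_out ?mulr0//; move: h; rewrite negb_and -!ltNge => /orP[h|h].
    by left; rewrite pmulr_rle0//; lra.
  by right; rewrite -ler_pdivrMl// mulr1; lra.
rewrite -restrict_EFin; apply/integrable_restrict => //; rewrite setTI.
apply: (bounded_integrableM (K := 2 * c)) => //.
- apply/integrableP; split; first by apply/measurable_EFinP; exact: measurable_funTS.
  by apply: lu => //; exact: segment_compact.
- by apply: measurable_funTS; exact: continuous_measurable_fun.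
- move=> y _; rewrite /k ger0_norm; last by apply: mulr_ge0; [exact: ltW|exact: hat_ge0].
  by rewrite mulrC ler_wpM2r ?(ltW c0)// hat_le2.
Qed.

(** The kernel has mass 1, height at most [2 c], and vanishes outside a ball about [a] of radius
    comparable to [1 / c]. The error is thus a fixed multiple of the mean of [|u - u a|] over that
    ball, which tends to 0 at a Lebesgue point. *)
Lemma lebesgue_pt_hat (u : R -> R) (a : R) : locally_integrable setT u ->
  lebesgue_pt u a ->
  \int[mu]_y (u y * (n.+1%:R * hat (n.+1%:R * (y - a)))) @[n --> \oo] --> u a.
Proof.
move=> lu1 hua; have [mu_ _ lu] := lu1.
pose c (n : nat) : R := n.+1%:R.
have c0 n : 0 < c n by rewrite /c ltr0n.
pose B n : set (measurableTypeR R) := ball a (2 / c n).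
have mB n : measurable (B n) by exact: measurable_ball.
have r0 n : 0 < 2 / c n by rewrite divr_gt0.
have mBE n : mu (B n) = (4 / c n)%:E.
  rewrite lebesgue_measure_ball; last exact: ltW.
  by congr EFin; rewrite -mulr_natr; field; rewrite gt_eqF.
have iuB n : mu.-integrable (B n) (EFin \o u).
  have ic : mu.-integrable (closed_ball a (2 / c n)) (EFin \o u).
    apply/integrableP; split; first by apply/measurable_EFinP; exact: measurable_funTS.
    by apply: lu => //; rewrite closed_ball_itv//; exact: segment_compact.
  apply: integrableS ic => //; first exact: measurable_closed_ball.
  exact: subset_closed_ball.
have icB n (k : R) : mu.-integrable (B n) (EFin \o cst k).
  apply/integrableP; split; first exact/measurable_EFinP.
  rewrite (_ : (fun x => _) = cst `|k|%:E)// integral_cst//.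
  by rewrite [X in (_ * X)%E](mBE n) -EFinM ltry.
have iduB n : mu.-integrable (B n) (EFin \o (fun y => `|u y - u a|)).
  exact: (Rintegrable_norm (mB n) (RintegrableB (mB n) (iuB n) (icB n (u a)))).
have davgE n : fine (davg u a (2 / c n)) = c n / 4 * \int[mu]_(y in B n) `|u y - u a|.
  rewrite /davg /iavg -/(B n) mBE.
  rewrite inver ifF; last by rewrite gt_eqF// divr_gt0.
  rewrite fineM ?invf_div//.
  exact: (integrable_fin_num (mB n) (iduB n)).
have rcvg : 2 / c n @[n --> \oo] --> (0 : R).
  rewrite -(mulr0 2); apply: cvgM; first exact: cvg_cst.
  exact: cvg_harmonic.
have dcvg : fine (davg u a (2 / c n)) @[n --> \oo] --> (0 : R).
  apply: fine_cvg.
  by have /cvge_at_rightP := hua; apply; split.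
pose k n (y : R) := c n * hat (c n * (y - a)).
have k0 n y : ~ B n y -> k n y = 0.
  move=> nB; rewrite /k hat_out ?mulr0//.
  have [ya|ya] := leP y a; first by left; rewrite pmulr_rle0// subr_le0.
  right; rewrite -ler_pdivrMl// mulr1 leNgt; apply/negP => h; apply: nB.
  rewrite /B /ball/= distrC ger0_norm ?subr_ge0 ?(ltW ya)//.
  by rewrite (lt_trans h)// -[ltLHS]mul1r ltr_pM2r ?invr_gt0// ltr1n.
have kB n y : `|k n y| <= 2 * c n.
  rewrite /k ger0_norm; last by apply: mulr_ge0; [exact: ltW|exact: hat_ge0].
  by rewrite mulrC ler_wpM2r ?(ltW (c0 n))// hat_le2.
have toB n (f : R -> R) : \int[mu]_y (f y * k n y) = \int[mu]_(y in B n) (f y * k n y).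
  rewrite [RHS]Rintegral_mkcond; apply: eq_Rintegral => y _; rewrite patchE.
  by case: ifPn => // /negP nB; rewrite k0 ?mulr0// => By; apply: nB; exact: mem_set.
have [ik ik1] : (forall n, mu.-integrable setT (EFin \o k n)) /\
    (forall n, \int[mu]_y k n y = 1).
  by split=> n; have [] := Rintegral_hat a (c0 n).
(* Height [2 c] times the measure [4 / c] of the ball gives 8. *)
have bd n : `|\int[mu]_y (u y * k n y) - u a| <= 8 * fine (davg u a (2 / c n)).
  have ikB : mu.-integrable (B n) (EFin \o k n) by exact: (integrableS measurableT).
  have iuk : mu.-integrable (B n) (EFin \o (fun y => u y * k n y)).
    by apply: (integrableS measurableT) => //; exact: integrable_mul_hat.
  have -> : \int[mu]_y (u y * k n y) - u a =
      \int[mu]_(y in B n) ((u y - u a) * k n y).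
    rewrite toB -[X in _ - X]mulr1 -(ik1 n).
    have -> : \int[mu]_y k n y = \int[mu]_(y in B n) k n y.
      have := toB n (cst 1); under eq_Rintegral do rewrite mul1r.
      by under [in RHS]eq_Rintegral do rewrite mul1r.
    rewrite -RintegralZl// -RintegralB//; last exact: RintegrableZl.
    by apply: eq_Rintegral => y _; rewrite mulrBl.
  have idk : mu.-integrable (B n) (EFin \o (fun y => (u y - u a) * k n y)).
    apply: (bounded_integrableM (K := 2 * c n)) => //.
      exact: (RintegrableB (mB n) (iuB n) (icB n (u a))).
    exact: Rintegrable_measurable ikB.
  rewrite (le_trans (le_normr_Rintegral _ _))// davgE.
  rewrite [leRHS](_ : _ = 2 * c n * \int[mu]_(y in B n) `|u y - u a|); last by field.
  rewrite -RintegralZl//; apply: le_Rintegral => //.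
  - exact: Rintegrable_norm.
  - exact: RintegrableZl.
  - by move=> y _; rewrite normrM mulrC ler_wpM2r.
apply/cvgrPdist_le => e e0.
have e8 : 0 < e / 8 by rewrite divr_gt0.
have /cvgrPdist_le/(_ _ e8) := dcvg; apply: filterS => n.
rewrite sub0r normrN => h; rewrite distrC (le_trans (bd n))//.
by have := le_trans (ler_norm _) h; lra.
Qed.

(** The definition of the weak derivative is tested on [bump a b c] with [c] tending to infinity:
    the derivative of the bump picks out the values at the Lebesgue points [a] and [b], while the
    bump itself tends to an indicator function. *)
Lemma weak_deriv1_integral (u g : R -> R) (a b : R) :
  u \in Lfun mu 2%:E -> g \in Lfun mu 2%:E -> weak_deriv1 u g -> a < b ->
  lebesgue_pt u a -> lebesgue_pt u b ->
  \int[mu]_(y in `[a, b]) g y = u b - u a.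
Proof.
move=> hu hg wug ab ua ub.
have lu := Lfun2_locally_integrable hu.
pose c (n : nat) : R := n.+1%:R.
have c1 n : 1 <= c n by rewrite /c ler1n.
have c0 n : 0 < c n by rewrite (lt_le_trans _ (c1 n)).
have L : \int[mu]_y (u y * 'D_1 (bump a b (c n)) y) @[n --> \oo] --> u a - u b.
  have -> : (fun n => \int[mu]_y (u y * 'D_1 (bump a b (c n)) y)) =
      (fun n => \int[mu]_y (u y * (c n * hat (c n * (y - a)))) -
                \int[mu]_y (u y * (c n * hat (c n * (y - b))))).
    apply/funext => n; rewrite -RintegralB//; try exact: integrable_mul_hat.
    apply: eq_Rintegral => y _.
    by have [_ ->] := is_derive_bump a b (c n) y; rewrite mulrBr.
  by apply: cvgB; exact: lebesgue_pt_hat.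
(* The interval in the limit is open at [a], where every bump vanishes, and closed at [b], where
   every bump has already risen for large [c] and not yet begun to fall. *)
have Rr : \int[mu]_y (g y * bump a b (c n) y) @[n --> \oo] -->
    \int[mu]_y ((g \_ `]a, b]) y).
  pose dom := (fun y => `|g y|) \_ `[a, b + 1].
  have idom : mu.-integrable setT (EFin \o dom).
    rewrite /dom -restrict_EFin; apply/integrable_restrict => //; rewrite setTI.
    apply: Rintegrable_norm => //.
    by apply: Lfun2_compact_integrable => //; exact: segment_compact.
  apply: (@Rdominated_cvg _ _ _ mu setT (fun n y => g y * bump a b (c n) y)
    (g \_ `]a, b]) dom) => //.
  - move=> n; apply: measurable_funM; first exact: Lfun_measurable hg.
    exact: continuous_measurable_fun (is_derive_continuous (is_derive_bump a b (c n))).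
  - move=> y _; apply: cvg_near_cst; rewrite patchE mem_setE in_itv/=.
    have [ya|ay] := leP y a.
      near=> n; rewrite /bump !smoothstep_le0 ?subr0 ?mulr0// pmulr_rle0// subr_le0//.
      by rewrite (le_trans ya)// ltW.
    have big (z : R) : z < y -> \forall n \near \oo, smoothstep (c n * (y - z)) = 1.
      move=> zy; near=> n; apply: smoothstep_ge1.
      rewrite -ler_pdivrMr ?subr_gt0// mul1r (@le_trans _ _ n%:R) ?ler_nat//.
      by near: n; exact: nbhs_infty_ger.
    have [yb|yb] := leP y b.
      near=> n; rewrite /bump (_ : smoothstep (c n * (y - b)) = 0); last first.
        by rewrite smoothstep_le0// pmulr_rle0// subr_le0.
      rewrite (_ : smoothstep (c n * (y - a)) = 1) ?subr0 ?mulr1//.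
      by near: n; exact: big.
    near=> n; rewrite /bump (_ : smoothstep (c n * (y - b)) = 1); last first.
      by near: n; exact: big.
    rewrite (_ : smoothstep (c n * (y - a)) = 1) ?subrr ?mulr0//.
    by near: n; exact: big.
  - move=> n y _; rewrite /dom patchE mem_setE in_itv/=; case: ifPn => [_|].
      by rewrite normrM ler_piMr// bump_le2.
    rewrite negb_and -!ltNge => h; rewrite bump_out ?mulr0 ?normr0//.
    by case/orP: h => ?; [left|right].
have E n : \int[mu]_y (u y * 'D_1 (bump a b (c n)) y) = - \int[mu]_y (g y * bump a b (c n) y).
  by apply: wug; exact: test_function_bump.
have {}E : (fun n => \int[mu]_y (u y * 'D_1 (bump a b (c n)) y)) =
  (fun n => - \int[mu]_y (g y * bump a b (c n) y)) by apply/funext.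
move: L; rewrite E => L.
have : u a - u b = - \int[mu]_y ((g \_ `]a, b]) y).
  exact: (cvg_unique _ L (cvgN Rr)).
rewrite -Rintegral_mkcond Rintegral_itv_obnd_cbnd; last first.
  have ig : mu.-integrable `[a, b] (EFin \o g).
    by apply: Lfun2_compact_integrable => //; exact: segment_compact.
  apply: integrableS ig => // x /=; rewrite !in_itv/= => /andP[ax ->].
  by rewrite ltW.
by move=> H; rewrite -[LHS]opprK -H opprB.
Unshelve. all: by end_near. Qed.

End weak_derivative.

(** * The virial identity for a weak solution *)

Section virial.
Context {R : realType}.
Local Notation mu := (@lebesgue_measure R).

Lemma ae_impl (P Q : R -> Prop) : (forall x, P x -> Q x) ->
  {ae mu, forall x, P x} -> {ae mu, forall x, Q x}.
Proof. by move=> PQ; apply: (@filterS _ _ (ae_filter_ringOfSetsType mu)). Qed.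

Lemma ae_impl2 (P Q S : R -> Prop) : (forall x, P x -> Q x -> S x) ->
  {ae mu, forall x, P x} -> {ae mu, forall x, Q x} -> {ae mu, forall x, S x}.
Proof. by move=> PQS; apply: (@filterS2 _ _ (ae_filter_ringOfSetsType mu)). Qed.

Lemma ae_eq_Rintegral (D : set (measurableTypeR R)) (f g : R -> R) :
  measurable D -> measurable_fun D f -> measurable_fun D g ->
  {ae mu, forall x, D x -> f x = g x} ->
  \int[mu]_(x in D) f x = \int[mu]_(x in D) g x.
Proof.
move=> mD mf mg fg; rewrite /Rintegral; congr fine; apply: ae_eq_integral => //.
- exact/measurable_EFinP.
- exact/measurable_EFinP.
- by apply: filterS fg => x fg Dx; rewrite fg.
Qed.

(** Otherwise [|e| > d] almost everywhere on [D], whose measure is infinite. This yields points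
    where the energy is small and which are Lebesgue points as well. *)
Lemma integrable_ae_small (D : set (measurableTypeR R)) (e : R -> R)
    (P : R -> Prop) (d : R) :
  measurable D -> (mu D = +oo)%E -> mu.-integrable D (EFin \o e) ->
  {ae mu, forall x, P x} -> 0 < d -> exists x, [/\ D x, P x & `|e x| <= d].
Proof.
move=> mD Doo ie aeP d0; apply: contrapT => nex.
have /integrableP[me] := ie; apply/negP; rewrite -leNgt leye_eq; apply/eqP.
have : (\int[mu]_(x in D) (cst d%:E) x <= \int[mu]_(x in D) `|(EFin \o e) x|)%E.
  apply: ae_ge0_le_integral => //.
  - by move=> x _; rewrite /cst lee_fin ltW.
  - exact: measurableT_comp.
  - apply: ae_impl aeP => x Px Dx; rewrite /= lee_fin leNgt; apply/negP => h.
    by apply: nex; exists x; split => //; exact: ltW.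
rewrite integral_cst// [X in (_ * X)%E]Doo gt0_muley ?lte_fin// leye_eq.
by move=> /eqP.
Qed.

Variables (V V' : R -> R) (lam : R) (psi g h : R -> R).
Hypothesis dV : forall x, is_derive x (1 : R) V (V' x).
Hypothesis cV' : continuous V'.
Hypotheses (hpsi : psi \in Lfun mu 2%:E) (hg : g \in Lfun mu 2%:E)
  (hh : h \in Lfun mu 2%:E).
Hypotheses (wpsi : weak_deriv1 psi g) (wg : weak_deriv1 g h).
Hypothesis heq : {ae mu, forall y, h y = (V y - lam) * psi y}.

Let cV : continuous V. Proof. exact: is_derive_continuous dV. Qed.

Let good (y : R) := lebesgue_pt psi y /\ lebesgue_pt g y.

Let ae_good : {ae mu, forall y, good y}.
Proof.
have a1 := lebesgue_differentiation (Lfun2_locally_integrable hpsi).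
have a2 := lebesgue_differentiation (Lfun2_locally_integrable hg).
by apply: ae_impl2 a1 a2.
Qed.

(* For a classical solution the derivative of [energy] is [- V' psi ^ 2]. *)
Let energy (y : R) := g y ^+ 2 - (V y - lam) * psi y ^+ 2.

(** At good points [psi] and [g] equal the primitives [Psi] and [Gam] of their weak derivatives.
    Inserting these continuous functions into the integrands produces primitives that are
    differentiable in the classical sense, for which the energy law is a computation; at [A] and [B]
    nothing has changed. *)
Let energyB (A B : R) : good A -> good B -> A < B ->
  \int[mu]_(y in `[A, B]) (V' y * psi y ^+ 2) = energy A - energy B.
Proof.
move=> [pA gA] [pB gB] AB.
pose X := B + 1.
have BX : B < X by rewrite ltrDl.
have AX : A < X := lt_trans AB BX.
have cpt (f : R -> R) y : f \in Lfun mu 2%:E -> mu.-integrable `[A, y] (EFin \o f).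
  by move=> hf; apply: Lfun2_compact_integrable => //; exact: segment_compact.
pose Psi y := psi A + \int[mu]_(t in `[A, y]) g t.
pose Gam y := g A + \int[mu]_(t in `[A, y]) h t.
have cprim (f : R -> R) (c : R) : mu.-integrable `[A, X] (EFin \o f) ->
    {within `[A, X], continuous (fun y => c + \int[mu]_(t in `[A, y]) f t)}.
  move=> if_ y; apply: cvgD; first exact: cvg_cst.
  exact: (parameterized_integral_continuous (ltW AX) if_).
have cPsi : {within `[A, X], continuous Psi} by apply: cprim; exact: cpt.
have cGam : {within `[A, X], continuous Gam} by apply: cprim; exact: cpt.
have PsiE y : A <= y -> lebesgue_pt psi y -> psi y = Psi y.
  rewrite le_eqVlt => /predU1P[<- _|Ay py].
    by rewrite /Psi set_itv1 Rintegral_set1 addr0.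
  by rewrite /Psi (weak_deriv1_integral hpsi hg wpsi Ay pA py) addrC subrK.
have GamE y : A <= y -> lebesgue_pt g y -> g y = Gam y.
  rewrite le_eqVlt => /predU1P[<- _|Ay py].
    by rewrite /Gam set_itv1 Rintegral_set1 addr0.
  by rewrite /Gam (weak_deriv1_integral hg hh wg Ay gA py) addrC subrK.
have mwithin (f : R -> R) y : y <= X -> {within `[A, X], continuous f} ->
    measurable_fun (`[A, y]%classic : set (measurableTypeR R)) f.
  move=> yX cf; have mAX : measurable_fun (`[A, X]%classic : set (measurableTypeR R)) f.
    exact: subspace_continuous_measurable_fun.
  apply: measurable_funS mAX => //.
  by move=> x /=; rewrite !in_itv/= => /andP[-> /le_trans]; exact.
pose W y := (V y - lam) * Psi y.
have cVl : {within `[A, X], continuous (fun y => V y - lam)}.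
  apply: continuous_subspaceT => y; apply: cvgB; first exact: cV.
  exact: cvg_cst.
have cW : {within `[A, X], continuous W}.
  by move=> y; apply: cvgM; [exact: cVl|exact: cPsi].
have icont (f : R -> R) : {within `[A, X], continuous f} ->
    mu.-integrable `[A, X] (EFin \o f).
  by move=> cf; apply: continuous_compact_integrable => //; exact: segment_compact.
(* Second pass: the integrands are now [Gam] and [W], which are continuous, so the fundamental
   theorem of calculus gives derivatives at every interior point. *)
pose Psi2 y := psi A + \int[mu]_(t in `[A, y]) Gam t.
pose Gam2 y := g A + \int[mu]_(t in `[A, y]) W t.
have Psi2E y : y <= X -> Psi y = Psi2 y.
  move=> yX; rewrite /Psi /Psi2; congr (_ + _); apply: ae_eq_Rintegral => //.
  - by apply: measurable_funTS; exact: Lfun_measurable hg.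
  - exact: mwithin.
  - apply: ae_impl ae_good => x [_ gx] /=; rewrite in_itv/= => /andP[Ax _].
    exact: GamE.
have Gam2E y : y <= X -> Gam y = Gam2 y.
  move=> yX; rewrite /Gam /Gam2; congr (_ + _); apply: ae_eq_Rintegral => //.
  - by apply: measurable_funTS; exact: Lfun_measurable hh.
  - exact: mwithin.
  - apply: ae_impl2 ae_good heq => x [px _] hx /=; rewrite in_itv/= => /andP[Ax _].
    by rewrite hx /W PsiE.
have dprim (f : R -> R) (c x : R) : {within `[A, X], continuous f} ->
    A < x -> x < X -> is_derive x (1 : R) (fun y => c + \int[mu]_(t in `[A, y]) f t) (f x).
  move=> cf Ax xX.
  have cfx : {for x, continuous f}.
    by apply: (within_continuous_continuous AX cf); rewrite in_itv/= Ax xX.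
  have [d1 d2] := continuous_FTC1_closed xX (icont f cf) Ax cfx.
  have dd : is_derive x (1 : R) (fun y => \int[mu]_(t in `[A, y]) f t) (f x).
    exact: (DeriveDef d1 (etrans (esym (derive1E _ _)) d2)).
  have := is_deriveD (is_derive_cst c x 1) dd; rewrite add0r.
  exact.
pose E y := Gam2 y ^+ 2 - (V y - lam) * Psi2 y ^+ 2.
have dE x : A < x -> x < X -> is_derive x (1 : R) E (- (V' x * Psi2 x ^+ 2)).
  move=> Ax xX.
  have d1 := dprim Gam (psi A) x cGam Ax xX.
  have d2 := dprim W (g A) x cW Ax xX.
  have d3 := dV x.
  have e1 : Gam x = Gam2 x by apply: Gam2E; exact: ltW.
  have e2 : W x = (V x - lam) * Psi2 x by rewrite /W Psi2E ?ltW.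
  rewrite e1 in d1; rewrite e2 in d2.
  rewrite -/Psi2 in d1; rewrite -/Gam2 in d2.
  rewrite /E; apply: is_derive_eq.
  by rewrite /GRing.scale/=; ring.
have cPsi2 : {within `[A, X], continuous Psi2} by apply: cprim; exact: icont.
have cGam2 : {within `[A, X], continuous Gam2} by apply: cprim; exact: icont.
have cE : {within `[A, X], continuous E}.
  move=> y; apply: cvgB.
    by apply: cvgM; exact: cGam2.
  apply: cvgM; first exact: cVl.
  by apply: cvgM; exact: cPsi2.
have sub : (`[A, B]%classic : set R) `<=` `[A, X]%classic.
  by move=> x /=; rewrite !in_itv/= => /andP[-> /le_trans]; apply; exact: ltW.
have cEB := continuous_subspaceW sub cE.
have /(continuous_within_itvP _ AB)[_ EA EB] := cEB.
have cF : {within `[A, B], continuous (fun x => - (V' x * Psi2 x ^+ 2))}.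
  apply: (continuous_subspaceW sub) => y; apply: cvgN; apply: cvgM.
    exact: (continuous_subspaceT cV').
  by apply: cvgM; exact: cPsi2.
have F2 : \int[mu]_(x in `[A, B]) (- (V' x * Psi2 x ^+ 2)) = E B - E A.
  rewrite /Rintegral (@continuous_FTC2 _ _ E A B)//.
  - split => // x; rewrite in_itv/= => /andP[Ax xB].
    by have [] := dE x Ax (lt_trans xB BX).
  - move=> x; rewrite in_itv/= => /andP[Ax xB].
    by rewrite derive1E; have [_ ->] := dE x Ax (lt_trans xB BX).
have eA : E A = energy A.
  by rewrite /E /energy -Psi2E ?(ltW AX)// -Gam2E ?(ltW AX)// -PsiE// -GamE.
have eB : E B = energy B.
  by rewrite /E /energy -Psi2E ?(ltW BX)// -Gam2E ?(ltW BX)// -PsiE ?(ltW AB)// -GamE// ltW.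
rewrite -eA -eB -(opprB (E B)) -F2.
have iF : mu.-integrable `[A, B] (EFin \o (fun x => V' x * Psi2 x ^+ 2)).
  apply: continuous_compact_integrable; first exact: segment_compact.
  apply: (continuous_subspaceW sub) => y; apply: cvgM.
    exact: (continuous_subspaceT cV').
  by apply: cvgM; exact: cPsi2.
rewrite (_ : (fun x => - _) = (fun x => -1 * (V' x * Psi2 x ^+ 2))); last first.
  by apply/funext => x; rewrite mulN1r.
rewrite RintegralZl// mulN1r opprK.
apply: ae_eq_Rintegral => //.
- apply: measurable_funTS; apply: measurable_funM.
    exact: continuous_measurable_fun.
  by apply: measurable_funX; exact: Lfun_measurable hpsi.
- exact: Rintegrable_measurable iF.
- apply: ae_impl ae_good => x [px _] /=; rewrite in_itv/= => /andP[Ax xB].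
  by rewrite PsiE// Psi2E// (le_trans xB)// ltW.
Qed.

Hypothesis iV : mu.-integrable setT (EFin \o (fun y => (V y - lam) * psi y ^+ 2)).
Hypothesis iV' : mu.-integrable setT (EFin \o (fun y => V' y * psi y ^+ 2)).

Lemma Rintegral_virial : \int[mu]_y (V' y * psi y ^+ 2) = 0.
Proof.
(* The kinetic part is integrable because [g] is in L_2, the potential part by [iV]. *)
have ie : mu.-integrable setT (EFin \o energy).
  by apply: RintegrableB => //; exact: Lfun2_integrable_sqr.
have d0 n : (0 : R) < n.+1%:R^-1 by rewrite invr_gt0.
have exB n : exists x, [/\ `[n.+1%:R, +oo[%classic x, good x & `|energy x| <= n.+1%:R^-1].
  apply: integrable_ae_small => //.
  - by rewrite lebesgue_measure_itv/= ltry.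
  - exact: (integrableS measurableT).
have exA n : exists x, [/\ `]-oo, - n.+1%:R]%classic x, good x & `|energy x| <= n.+1%:R^-1].
  apply: integrable_ae_small => //.
  - by rewrite lebesgue_measure_itv/= ltNyr.
  - exact: (integrableS measurableT).
have [B hB] := choice exB; have [A hA] := choice exA.
have AB n : A n < B n.
  have [+ _ _] := hA n; have [+ _ _] := hB n; rewrite /= !in_itv/= andbT => b a.
  by rewrite (le_lt_trans a)// (lt_le_trans _ b)// (@lt_trans _ _ 0)// ?oppr_lt0.
have c1 : \int[mu]_x ((fun y => V' y * psi y ^+ 2) \_ `[A n, B n]) x @[n --> \oo] -->
    \int[mu]_y (V' y * psi y ^+ 2).
  apply: (@Rdominated_cvg _ _ _ mu setT
    (fun n => (fun y => V' y * psi y ^+ 2) \_ `[A n, B n])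
    (fun y => V' y * psi y ^+ 2) (fun y => `|V' y * psi y ^+ 2|)) => //.
  - move=> n; apply/(measurable_restrictT _ _).1 => //.
    by apply: measurable_funTS; exact: Rintegrable_measurable iV'.
  - move=> x _; apply: cvg_near_cst; near=> n; rewrite patchE mem_set//= in_itv/=.
    have xn : `|x| <= n.+1%:R.
      by rewrite (@le_trans _ _ n%:R) ?ler_nat//; near: n; exact: nbhs_infty_ger.
    have [+ _ _] := hA n; have [+ _ _] := hB n; rewrite /= !in_itv/= andbT => b a.
    move: xn; rewrite ler_norml => /andP[x1 x2].
    by rewrite (le_trans a)// (le_trans x2).
  - exact: Rintegrable_norm.
  - by move=> n x _; rewrite patchE; case: ifP => // _; rewrite normr0.
have c2 : \int[mu]_x ((fun y => V' y * psi y ^+ 2) \_ `[A n, B n]) x @[n --> \oo] --> (0 : R).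
  have E n : \int[mu]_x ((fun y => V' y * psi y ^+ 2) \_ `[A n, B n]) x =
      energy (A n) - energy (B n).
    rewrite -Rintegral_mkcond; have [_ gA _] := hA n; have [_ gB _] := hB n.
    exact: energyB.
  apply: norm_cvg0.
  apply: (@squeeze_cvgr _ _ _ _ (fun=> 0) (fun n => n.+1%:R^-1 + n.+1%:R^-1)).
  - apply: nearW => n /=; rewrite normr_ge0/= E.
    have [_ _ eA] := hA n; have [_ _ eB] := hB n.
    by rewrite (le_trans (ler_normB _ _))// lerD.
  - exact: cvg_cst.
  - by rewrite -(addr0 (0 : R)); apply: cvgD; exact: cvg_harmonic.
exact: (cvg_unique _ c1 c2).
Unshelve. all: by end_near. Qed.

End virial.

Local Open Scope complex_scope.
(** * Analytic potentials *)

Section modulus.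
Context {R : realType}.
Implicit Types z w : R[i].

(** The norm of [R[i]] takes its values in [R[i]]; this is the same number seen in [R], where order
    reasoning is available. *)
Definition modulus z : R := Num.sqrt (sqmod z).

Lemma modulusE z : `|z| = (modulus z)%:C.
Proof. by case: z => a b; rewrite normc_def. Qed.

Lemma modulus_ge0 z : 0 <= modulus z. Proof. exact: sqrtr_ge0. Qed.

Lemma sqr_modulus z : modulus z ^+ 2 = sqmod z.
Proof. by rewrite sqr_sqrtr// addr_ge0// sqr_ge0. Qed.

Lemma modulusM z w : modulus (z * w) = modulus z * modulus w.
Proof. by apply: complexI; rewrite rmorphM/= -!modulusE normrM. Qed.

Lemma modulusV z : modulus z^-1 = (modulus z)^-1.
Proof. by apply: complexI; rewrite fmorphV/= -!modulusE normfV. Qed.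

Lemma modulusX z n : modulus (z ^+ n) = modulus z ^+ n.
Proof. by apply: complexI; rewrite rmorphXn/= -!modulusE normrX. Qed.

Lemma modulusN z : modulus (- z) = modulus z.
Proof. by apply: complexI; rewrite -!modulusE normrN. Qed.

Lemma modulusD z w : modulus (z + w) <= modulus z + modulus w.
Proof. by rewrite -lecR rmorphD/= -!modulusE ler_normD. Qed.

Lemma modulusB z w : modulus (z - w) <= modulus z + modulus w.
Proof. by rewrite -(modulusN w) modulusD. Qed.

Lemma modulus0 : modulus 0 = 0.
Proof. by apply: complexI; rewrite -modulusE normr0. Qed.

Lemma modulus_eq0 z : (modulus z == 0) = (z == 0).
Proof. by rewrite -(inj_eq (@complexI R)) -modulusE normr_eq0. Qed.

Lemma modulus_gt0 z : (0 < modulus z) = (z != 0).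
Proof. by rewrite lt_neqAle modulus_ge0 andbT eq_sym modulus_eq0. Qed.

Lemma modulus_real (x : R) : modulus x%:C = `|x|.
Proof. by rewrite /modulus /sqmod/= expr0n addr0 sqrtr_sqr. Qed.

Lemma Re_le_modulus z : `|complex.Re z| <= modulus z.
Proof.
rewrite -(@ler_pXn2r _ 2)// ?nnegrE ?modulus_ge0// sqr_modulus.
by rewrite real_normK ?num_real// /sqmod lerDl sqr_ge0.
Qed.

Lemma Im_le_modulus z : `|complex.Im z| <= modulus z.
Proof.
rewrite -(@ler_pXn2r _ 2)// ?nnegrE ?modulus_ge0// sqr_modulus.
by rewrite real_normK ?num_real// /sqmod lerDr sqr_ge0.
Qed.

Lemma modulus_le z : modulus z <= `|complex.Re z| + `|complex.Im z|.
Proof.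
rewrite -(@ler_pXn2r _ 2)// ?nnegrE ?modulus_ge0 ?addr_ge0// sqr_modulus.
rewrite sqrrD !real_normK ?num_real// /sqmod addrAC lerDl.
by rewrite mulrn_wge0// mulr_ge0.
Qed.

(** If [|w| <= |z|], square [|z| - |w| <= |z + w|]; otherwise the left-hand side is not positive. *)
Lemma sqmodD_ge z w : sqmod z - 2 * (modulus z * modulus w) <= sqmod (z + w).
Proof.
have := modulusD (z + w) (- w); rewrite addrK modulusN => h.
rewrite -!sqr_modulus.
have h1 := modulus_ge0 (z + w); have h2 := modulus_ge0 z; have h3 := modulus_ge0 w.
by have [zw|zw] := leP (modulus w) (modulus z); nra.
Qed.

(** Convergence at the real point [rho] forces the terms to 0, hence bounds [|a n| rho ^ n]. Within
    half that radius the tail is geometric of ratio at most 1/2, which accounts for the factor 2. *)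
Lemma analytic_expansion (F : R[i] -> R[i]) z0 : analytic_at F z0 ->
  exists (a : nat -> R[i]) (rho M : R), [/\ 0 < rho, 0 <= M,
    forall n, modulus (a n) * rho ^+ n <= M &
    forall w m, modulus w <= rho / 2 ->
      modulus (F (z0 + w) - \sum_(0 <= n < m) a n * w ^+ n) <=
      2 * M * (modulus w / rho) ^+ m].
Proof.
move=> [a ha].
have [r r0 hr] : exists2 r : R, 0 < r & forall w, modulus w < r ->
    series (fun n => a n * w ^+ n : R[i]^o) @ \oo --> (F (z0 + w) : R[i]^o).
  move/nbhs_ballP : ha => [e /= e0 he].
  (* A positive element of [R[i]] has zero imaginary part. *)
  have re : e = (complex.Re e)%:C by case: e e0 {he} => x y; rewrite ltcE/= => /andP[/eqP-> _].
  exists (complex.Re e); first by rewrite -ltcR -re.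
  move=> w wr; have := he (z0 + w); rewrite [X in series X](_ : _ = (fun n => a n * w ^+ n : R[i]^o)); last first.
    by apply/funext => n; rewrite addrAC subrr add0r.
  apply; rewrite /ball/= opprD addrA subrr add0r normrN modulusE re ltcR//.
pose rho := r / 2.
have rho0 : 0 < rho by rewrite divr_gt0.
have [M M0 hM] : exists2 M, 0 <= M & forall n, modulus (a n) * rho ^+ n <= M.
  have rr : modulus rho%:C < r by rewrite modulus_real gtr0_norm// /rho; lra.
  have /cvg_series_cvg_0 : cvgn (series (fun n => a n * rho%:C ^+ n : R[i]^o)).
    by apply/cvg_ex; exists (F (z0 + rho%:C)); exact: hr.
  move=> /cvgrPdist_lt/(_ 1 ltr01) [k _ hk].
  exists (1 + \sum_(0 <= n < k) modulus (a n) * rho ^+ n).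
    rewrite addr_ge0// sumr_ge0// => n _.
    by rewrite mulr_ge0 ?modulus_ge0// exprn_ge0// ltW.
  have pos n : 0 <= modulus (a n) * rho ^+ n.
    by rewrite mulr_ge0 ?modulus_ge0// exprn_ge0// ltW.
  move=> n; have [nk|kn] := ltnP n k.
    rewrite big_mkord (bigD1 (Ordinal nk))//= addrCA lerDl addr_ge0// sumr_ge0//.
  rewrite (@le_trans _ _ 1)//; last by rewrite lerDl sumr_ge0.
  have := hk n kn; rewrite /= sub0r normrN modulusE -[1]/(1%:C) ltcR.
  by rewrite modulusM modulusX modulus_real gtr0_norm// => /ltW.
exists a, rho, M; split => // w m wrho.
have q0 : 0 <= modulus w / rho by rewrite divr_ge0 ?modulus_ge0// ltW.
have q1 : modulus w / rho <= 2^-1 by rewrite ler_pdivrMr// mulrC.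
(* The factor [1 - 2 ^ (- k)] strengthens the claim so that the induction on [k] closes. *)
have tail k : modulus (\sum_(m <= n < m + k) a n * w ^+ n) <=
    2 * M * (modulus w / rho) ^+ m * (1 - 2^-1 ^+ k).
  elim: k => [|k IH].
    by rewrite addn0 big_geq// modulus0 expr0 subrr mulr0.
  rewrite addnS big_nat_recr ?leq_addr//= (le_trans (modulusD _ _))//.
  rewrite (le_trans (lerD IH (lexx _)))// modulusM modulusX.
  have -> : modulus (a (m + k)%N) * modulus w ^+ (m + k) =
      (modulus (a (m + k)%N) * rho ^+ (m + k)) * (modulus w / rho) ^+ (m + k).
    by rewrite -mulrA -exprMn [rho * _]mulrC divfK ?gt_eqF.
  have h1 : (modulus (a (m + k)%N) * rho ^+ (m + k)) * (modulus w / rho) ^+ (m + k) <=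
      M * ((modulus w / rho) ^+ m * 2^-1 ^+ k).
    rewrite ler_pM ?exprn_ge0 ?mulr_ge0 ?modulus_ge0 ?invr_ge0 ?exprn_ge0 ?(ltW rho0)//.
    by rewrite exprD ler_wpM2l ?exprn_ge0// lerXn2r ?nnegrE ?invr_ge0.
  rewrite (le_trans (lerD (lexx _) h1))// exprS le_eqVlt; apply/orP; left; apply/eqP.
  by field.
have wr : modulus w < r by move: wrho rho0; rewrite /rho; lra.
apply/ler_addgt0Pr => e e0.
have eC0 : 0 < e%:C by rewrite -[0]/(0%:C) ltcR.
have /cvgrPdist_lt/(_ _ eC0) [k _ hk] := hr w wr.
have := hk (m + k)%N (leq_addl _ _); rewrite /= modulusE ltcR /series/= => h1.
rewrite (big_cat_nat (n := m)) ?leq_addr//= in h1.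
have -> : F (z0 + w) - \sum_(0 <= n < m) a n * w ^+ n =
  (F (z0 + w) - (\sum_(0 <= n < m) a n * w ^+ n + \sum_(m <= n < m + k) a n * w ^+ n)) +
  \sum_(m <= n < m + k) a n * w ^+ n.
  by rewrite opprD addrA subrK.
rewrite (le_trans (modulusD _ _))// addrC lerD//; last exact: ltW.
rewrite (le_trans (tail k))// ler_piMr//.
  by rewrite !mulr_ge0// exprn_ge0.
Qed.

End modulus.

(** * Termwise differentiation of real power series *)

Section real_analytic.
Context {R : realType}.

Definition power_series_at (V : R -> R) (y : R) (c : nat -> R) (rho M : R) :=
  [/\ 0 < rho, forall n, `|c n| * rho ^+ n <= M &
    forall t, `|t| < rho / 2 -> pseries c t @ \oo --> V (y + t)].

Lemma bounded_pseries_cvg (c : nat -> R) (rho M x : R) : 0 < rho ->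
  (forall n, `|c n| * rho ^+ n <= M) -> `|x| <= rho / 2 -> cvgn (pseries c x).
Proof.
move=> rho0 hc hx.
have q1 : `|x| / rho <= 2^-1 by rewrite ler_pdivrMr// mulrC.
apply: normed_cvg.
apply: (@series_le_cvg _ _ (fun n => M * 2^-1 ^+ n)).
- by move=> n; exact: normr_ge0.
- by move=> n; rewrite mulr_ge0 ?exprn_ge0 ?invr_ge0// (le_trans _ (hc 0%N))// mulr_ge0.
- move=> n; rewrite /pseries/= normrM normrX.
  rewrite (_ : `|c n| * `|x| ^+ n = (`|c n| * rho ^+ n) * (`|x| / rho) ^+ n).
    rewrite ler_pM ?exprn_ge0 ?mulr_ge0 ?divr_ge0 ?invr_ge0 ?exprn_ge0// ?(ltW rho0)//.
    by rewrite lerXn2r ?nnegrE ?invr_ge0 ?divr_ge0// ltW.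
  by rewrite -mulrA -exprMn [rho * _]mulrC divfK ?gt_eqF.
- apply: is_cvg_geometric_series.
  by rewrite ger0_norm ?invr_ge0// invf_lt1// ltr1n.
Qed.

(** Halving the radius absorbs the factor [n + 1], which is at most [2 ^ n]. *)
Lemma bounded_pseries_diffs (c : nat -> R) (rho M : R) : 0 < rho ->
  (forall n, `|c n| * rho ^+ n <= M) ->
  forall n, `|pseries_diffs c n| * (rho / 2) ^+ n <= M / rho.
Proof.
move=> rho0 hc n; rewrite /pseries_diffs normrM ger0_norm//.
rewrite ler_pdivlMr//.
rewrite (_ : _ * _ * rho = (`|c n.+1| * rho ^+ n.+1) * (n.+1%:R / 2 ^+ n)); last first.
  by rewrite expr_div_n exprS; ring.
rewrite (le_trans _ (hc n.+1))// ler_piMr ?mulr_ge0 ?exprn_ge0 ?(ltW rho0)//.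
by rewrite ler_pdivrMr ?exprn_gt0// mul1r -natrX ler_nat ltn_expl.
Qed.

Lemma power_series_at_derive (V : R -> R) y c rho M :
  power_series_at V y c rho M ->
  is_derive y (1 : R) V (c 1%N) /\
  power_series_at (derive1 V) y (pseries_diffs c) (rho / 4) (M / rho).
Proof.
move=> [rho0 hc hV].
have r2 : 0 < rho / 2 by rewrite divr_gt0.
have hc1 := bounded_pseries_diffs rho0 hc.
have hc2 := bounded_pseries_diffs r2 hc1.
(* The twice differentiated series has coefficients bounded at radius [rho / 4], and so converges up
   to half of that. *)
pose K := rho / 8.
have K0 : 0 < K by rewrite divr_gt0.
have Kn : `|K| = K by rewrite gtr0_norm.
have cK : cvgn (pseries c K).
  by apply: (bounded_pseries_cvg rho0 hc); rewrite Kn /K; lra.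
have cK1 : cvgn (pseries (pseries_diffs c) K).
  by apply: (bounded_pseries_cvg r2 hc1); rewrite Kn /K; lra.
have cK2 : cvgn (pseries (pseries_diffs (pseries_diffs c)) K).
  apply: (bounded_pseries_cvg _ hc2); first by rewrite divr_gt0.
  by rewrite Kn /K; lra.
have dV t : `|t| < K -> is_derive (y + t) (1 : R) V (limn (pseries (pseries_diffs c) t)).
  move=> tK.
  have tK' : `|t| < `|K| by rewrite Kn.
  have d0 := pseries_snd_diffs cK cK1 cK2 tK'.
  have ds : is_derive (y + t) (1 : R) (fun x : R => x - y) 1.
    by apply: is_derive_eq; rewrite subr0.
  have d0' : is_derive (y + t - y) (1 : R) (fun x => limn (pseries c x))
      (limn (pseries (pseries_diffs c) t)) by rewrite addrAC subrr add0r.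
  have dc := @is_derive1_comp _ (fun x => limn (pseries c x)) (fun x : R => x - y) _ _ _ d0' ds.
  rewrite mulr1 in dc.
  apply: near_eq_is_derive dc.
  near=> x; rewrite /=.
  have xK : `|x - y| < rho / 2.
    have : `|x - y - t| < K - `|t|.
      near: x; apply/nbhs_ballP; exists (K - `|t|); first by rewrite /= subr_gt0.
      by move=> x; rewrite /ball/= distrC opprD addrA.
    have := ler_normD (x - y - t) t; rewrite subrK; rewrite /K; lra.
  have := hV (x - y) xK; rewrite [y + _]addrC subrK => /cvg_lim ->//.
split.
  have := dV 0; rewrite normr0 addr0 => /(_ K0).
  have -> : limn (pseries (pseries_diffs c) 0) = c 1%N; last by [].
  apply/cvg_lim => //; apply: cvg_near_cst; near=> n.
  have n0 : (0 < n)%N by near: n; exact: nbhs_infty_gt.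
  rewrite /pseries /series/= -(prednK n0) big_nat_recl//= big1 ?addr0.
    by rewrite /pseries_diffs expr0 mulr1 mul1r.
  by move=> i _; rewrite expr0n mulr0.
split; first by rewrite divr_gt0.
- move=> n; rewrite (le_trans _ (hc1 n))// ler_wpM2l// lerXn2r ?nnegrE ?divr_ge0 ?ltW//; lra.
- move=> t t8.
  have tK : `|t| < K by rewrite /K; lra.
  have [_ dv] := dV t tK; rewrite derive1E dv.
  apply: (bounded_pseries_cvg r2 hc1); move: tK; rewrite /K; lra.
Unshelve. all: by end_near. Qed.

End real_analytic.

(** * The maximum principle from local expansions *)

Section maximum_principle.
Context {R : realType}.
Implicit Types (H : R[i] -> R[i]) (z w b : R[i]).

(* Second order expandability, which is all that the maximum principle uses. *)
Definition expandable2 H z := exists b0 b1 b2 (d K : R), [/\ 0 < d, 0 <= K &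
  forall w, modulus w < d ->
    modulus (H (z + w) - (b0 + b1 * w + b2 * w ^+ 2)) <= K * modulus w ^+ 3].

Lemma expandable2_continuous H z : expandable2 H z ->
  exists d C : R, [/\ 0 < d, 0 <= C & forall w, modulus w < d ->
    modulus (H (z + w) - H z) <= C * modulus w].
Proof.
move=> [b0 [b1 [b2 [d [K [d0 K0 h]]]]]].
have E : H z = b0.
  have := h 0; rewrite modulus0 !expr0n/= !mulr0 !addr0 => /(_ d0) m0; apply/eqP; rewrite -subr_eq0 -modulus_eq0.
  by rewrite eq_le m0 modulus_ge0.
exists (Num.min d 1), (modulus b1 + modulus b2 + K); split.
- by rewrite lt_min d0 ltr01.
- by rewrite !addr_ge0 ?modulus_ge0.
move=> w; rewrite lt_min => /andP[wd w1]; rewrite E.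
have -> : H (z + w) - b0 = (H (z + w) - (b0 + b1 * w + b2 * w ^+ 2)) +
    (b1 * w + b2 * w ^+ 2) by ring.
rewrite (le_trans (modulusD _ _))//.
have := modulusD (b1 * w) (b2 * w ^+ 2).
rewrite (modulusM b1) (modulusM b2 (w ^+ 2)) modulusX.
have := h w wd; have m0 := modulus_ge0 w.
have := modulus_ge0 b1; have := modulus_ge0 b2.
set m := modulus w in m0 w1 *; set A := modulus b1; set B := modulus b2.
move=> B0 A0 h1 h2.
have m2 : m ^+ 2 <= m by rewrite expr2 ler_piMl// ltW.
have m3 : m ^+ 3 <= m by rewrite exprS ler_piMr// (le_trans m2)// ltW.
have k1 : B * m ^+ 2 <= B * m by rewrite ler_wpM2l.
have k2 : K * m ^+ 3 <= K * m by rewrite ler_wpM2l.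
by rewrite !mulrDl; lra.
Qed.

(** The four points are [r] times the fourth roots of unity, over which [w], [w ^ 2] and [w ^ 2]
    times the conjugate of [w] all sum to 0. *)
Let sum4 b0 b1 b2 (r : R) :
  let P w := sqmod (b0 + b1 * w + b2 * w ^+ 2) in
  P (r +i* 0) + P (- r +i* 0) + P (0 +i* r) + P (0 +i* - r) =
  4 * (sqmod b0 + r ^+ 2 * sqmod b1 + r ^+ 4 * sqmod b2).
Proof.
case: b0 b1 b2 => [x0 y0] [x1 y1] [x2 y2]; rewrite /sqmod /= !expr2 /=; ring.
Qed.

Let sum4d d (r : R) :
  sqmod (d + (r +i* 0)) + sqmod (d + (- r +i* 0)) + sqmod (d + (0 +i* r)) +
  sqmod (d + (0 +i* - r)) = 4 * (sqmod d + r ^+ 2).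
Proof. by case: d => [x y]; rewrite /sqmod /=; ring. Qed.

(* The term in [e] makes the mean of the left-hand function over the four points
   [z1 +- r], [z1 +- i r] exceed its value at [z1] by [e r^2 + O(r^3)]: the cross
   terms cancel by [sum4]. *)
Lemma no_local_max H z1 d (e r0 : R) : expandable2 H z1 -> 0 < e -> 0 < r0 ->
  exists2 w, `|complex.Re w| <= r0 /\ `|complex.Im w| <= r0 &
    sqmod (H z1) + e * sqmod d < sqmod (H (z1 + w)) + e * sqmod (d + w).
Proof.
move=> [b0 [b1 [b2 [dl [K [dl0 K0 h]]]]]] e0 r00; apply: contrapT => nex.
have E : H z1 = b0.
  have := h 0; rewrite modulus0 !expr0n/= !mulr0 !addr0 => /(_ dl0) m0; apply/eqP; rewrite -subr_eq0 -modulus_eq0.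
  by rewrite eq_le m0 modulus_ge0.
pose S := modulus b0 + modulus b1 + modulus b2.
have S0 : 0 <= S by rewrite !addr_ge0 ?modulus_ge0.
have SK : 0 < 2 * S * K + 1 by rewrite ltr_wpDl// !mulr_ge0.
(* The bounds [dl / 2] and [r0] keep the four points admissible, 1 makes [S] a bound of the
   quadratic polynomial, and the last bound makes the gain [e r ^ 2] exceed the remainder
   [2 S K r ^ 3]. *)
pose r := Num.min (Num.min (dl / 2) r0) (Num.min 1 (e / (2 * S * K + 1) / 2)).
have rr0 : 0 < r by rewrite !lt_min !divr_gt0 ?r00 ?ltr01.
have rdl : r < dl by rewrite (@le_lt_trans _ _ (dl / 2))// ?ge_min ?lexx//; lra.
have rr : r <= r0 by rewrite !ge_min lexx !orbT.
have r1 : r <= 1 by rewrite !ge_min lexx !orbT.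
have re : 2 * S * K * r < e.
  have : r <= e / (2 * S * K + 1) / 2 by rewrite !ge_min lexx !orbT.
  rewrite ler_pdivlMr// ler_pdivlMr// => h1.
  have : 0 <= 2 * S * K by rewrite !mulr_ge0.
  by nra.
have ub w : `|complex.Re w| <= r -> `|complex.Im w| <= r ->
    sqmod (H (z1 + w)) + e * sqmod (d + w) <= sqmod b0 + e * sqmod d.
  move=> w1 w2; rewrite -E leNgt; apply/negP => hh; apply: nex.
  by exists w => //; split; exact: le_trans rr.
have lb w : modulus w = r ->
    sqmod (b0 + b1 * w + b2 * w ^+ 2) - 2 * (S * (K * r ^+ 3)) <= sqmod (H (z1 + w)).
  move=> wr; have wd : modulus w < dl by rewrite wr.
  set P := b0 + b1 * w + b2 * w ^+ 2.
  have hh := h w wd; rewrite wr -/P in hh.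
  have PS : modulus P <= S.
    rewrite (le_trans (modulusD _ _))// (le_trans (lerD (modulusD _ _) (lexx _)))//.
    rewrite (modulusM b1) (modulusM b2 (w ^+ 2)) modulusX wr /S !lerD// ler_piMr ?modulus_ge0//.
    by rewrite exprn_ile1// ltW.
  have := sqmodD_ge P (H (z1 + w) - P); rewrite addrCA subrr addr0.
  apply: le_trans; rewrite lerD2l lerN2 ler_pM2l//.
  by rewrite ler_pM ?modulus_ge0.
have rn : `|r| = r by rewrite gtr0_norm.
have m1 : modulus (r +i* 0) = r by rewrite /modulus /sqmod/= expr0n addr0 sqrtr_sqr.
have m2 : modulus (- r +i* 0) = r by rewrite /modulus /sqmod/= expr0n addr0 sqrtr_sqr normrN.
have m3 : modulus (0 +i* r) = r by rewrite /modulus /sqmod/= expr0n add0r sqrtr_sqr.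
have m4 : modulus (0 +i* - r) = r by rewrite /modulus /sqmod/= expr0n add0r sqrtr_sqr normrN.
have n0 : `|0 : R| <= r by rewrite normr0 ltW.
have nr : `|r| <= r by rewrite rn.
have nNr : `|- r| <= r by rewrite normrN rn.
have u1 := ub (r +i* 0) nr n0; have u2 := ub (- r +i* 0) nNr n0.
have u3 := ub (0 +i* r) n0 nr; have u4 := ub (0 +i* - r) n0 nNr.
have l1 := lb _ m1; have l2 := lb _ m2; have l3 := lb _ m3; have l4 := lb _ m4.
have := sum4 b0 b1 b2 r; have := sum4d d r => /= s1 s2.
have q1 : 0 <= r ^+ 2 * sqmod b1 by rewrite mulr_ge0 ?sqr_ge0// -sqr_modulus sqr_ge0.
have q2 : 0 <= r ^+ 4 * sqmod b2 by rewrite mulr_ge0 ?exprn_ge0 ?(ltW rr0)// -sqr_modulus sqr_ge0.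
have : e * r ^+ 2 <= 2 * (S * (K * r ^+ 3)) by nra.
rewrite (_ : 2 * _ = (2 * S * K * r) * r ^+ 2); last by ring.
by rewrite ler_pM2r ?exprn_gt0// leNgt re.
Qed.

(** The perturbed function [u] attains its maximum on a closed square. A maximum at distance at
    least [r] from the centre is excluded by the bound [B], and one inside the disc by
    [no_local_max]. Part of the square lies outside the disc, so the bound is required wherever
    [r <= modulus w]. *)
Lemma maximum_principle H z0 (r B : R) : 0 < r ->
  (forall w, `|complex.Re w| <= r -> `|complex.Im w| <= r -> expandable2 H (z0 + w)) ->
  (forall w, `|complex.Re w| <= r -> `|complex.Im w| <= r ->
    r <= modulus w -> modulus (H (z0 + w)) <= B) ->
  modulus (H z0) <= B.
Proof.
move=> r0 hH hB.
have B0 : 0 <= B.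
  have rr : `|r| <= r by rewrite gtr0_norm.
  have := hB (r +i* 0) rr; rewrite /= normr0 => /(_ (ltW r0)).
  rewrite {1}/modulus /sqmod/= expr0n addr0 sqrtr_sqr ler_norm => /(_ isT).
  exact: le_trans (modulus_ge0 _).
rewrite leNgt; apply/negP => hlt.
have h2 : B ^+ 2 < sqmod (H z0).
  by rewrite -sqr_modulus ltr_pXn2r// nnegrE modulus_ge0.
(* On the square [|w| ^ 2 <= 2 r ^ 2], so the perturbation uses up at most half of the gap between
   [|H z0| ^ 2] and [B ^ 2]. *)
pose e := (sqmod (H z0) - B ^+ 2) / (4 * r ^+ 2).
have e0 : 0 < e by rewrite divr_gt0 ?subr_gt0// mulr_gt0// exprn_gt0.
pose p2c (p : R * R) : R[i] := p.1 +i* p.2.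
pose u (p : R * R) : R := sqmod (H (z0 + p2c p)) + e * sqmod (p2c p).
pose Q := `[- r, r]%classic `*` `[- r, r]%classic : set (R * R).
have cQ : compact Q by apply: compact_setX; exact: segment_compact.
have Q0 : Q (0, 0).
  by split; rewrite /= in_itv/= oppr_le0 !ltW.
have inQ p : Q p -> `|p.1| <= r /\ `|p.2| <= r.
  by rewrite /Q /= !in_itv/= !ler_norml.
have cu : {within Q, continuous u}.
  apply: continuous_in_subspaceT => p /[!inE] /inQ [p1 p2].
  have [dl [C [dl0 C0 hC]]] := expandable2_continuous (hH (p2c p) p1 p2).
  pose L := modulus (H (z0 + p2c p)).
  apply/cvgrPdist_le => /= t t0.
  pose m := modulus (p2c p).
  pose A := C * (2 * L + C) + e * (2 * m + 1).
  have A0 : 0 <= A.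
    by rewrite addr_ge0// mulr_ge0 ?(ltW e0)// addr_ge0// mulr_ge0 ?modulus_ge0.
  have A1 : 0 < A + 1 by rewrite ltr_wpDl.
  pose del := Num.min (Num.min dl 1) (t / (A + 1)).
  have del0 : 0 < del by rewrite !lt_min dl0 ltr01 divr_gt0.
  have d2 : 0 < del / 2 by rewrite divr_gt0.
  near=> q.
  have qp : modulus (p2c q - p2c p) < del.
    have [q1 q2] : `|p.1 - q.1| < del / 2 /\ `|p.2 - q.2| < del / 2.
      near: q; exists (ball p.1 (del / 2), ball p.2 (del / 2)) => [|q []].
        by split; exact: nbhsx_ballx.
      by rewrite /ball/=.
    rewrite (le_lt_trans (modulus_le _))//= distrC [X in _ + X]distrC.
    by move: q1 q2; lra.
  set w := p2c q - p2c p in qp.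
  have qE : p2c q = p2c p + w by rewrite /w addrC subrK.
  move: qp; rewrite !lt_min => /andP[/andP[w1 w2] w3].
  have w0 := modulus_ge0 w.
  have HC := hC w w1; rewrite -addrA -qE in HC.
  have L1 : `|modulus (H (z0 + p2c q)) - L| <= C * modulus w.
    rewrite ler_norml; apply/andP; split.
      have := modulusB (H (z0 + p2c q)) (H (z0 + p2c q) - H (z0 + p2c p)).
      by rewrite subKr -/L; lra.
    have := modulusD (H (z0 + p2c q) - H (z0 + p2c p)) (H (z0 + p2c p)).
    by rewrite subrK -/L; lra.
  have L2 : `|modulus (p2c q) - m| <= modulus w.
    rewrite qE ler_norml; apply/andP; split.
      by have := modulusB (p2c p + w) w; rewrite addrK -/m; lra.
    by have := modulusD (p2c p) w; rewrite -/m; lra.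
  have sqd (x y k : R) : 0 <= x -> 0 <= y -> 0 <= k -> `|x - y| <= k ->
      `|y ^+ 2 - x ^+ 2| <= k * (2 * y + k).
    move=> x0 y0 k0 xy; rewrite subr_sqr normrM distrC ler_pM//.
    by rewrite ger0_norm ?addr_ge0//; move: xy; rewrite ler_norml => /andP[]; lra.
  have S1 := sqd _ _ _ (modulus_ge0 _) (modulus_ge0 _) (mulr_ge0 C0 w0) L1.
  have S2 := sqd _ _ _ (modulus_ge0 _) (modulus_ge0 _) w0 L2.
  rewrite /u -!sqr_modulus -/L -/m.
  have -> : L ^+ 2 + e * m ^+ 2 - (modulus (H (z0 + p2c q)) ^+ 2 + e * modulus (p2c q) ^+ 2) =
    (L ^+ 2 - modulus (H (z0 + p2c q)) ^+ 2) + e * (m ^+ 2 - modulus (p2c q) ^+ 2) by ring.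
  rewrite (le_trans (ler_normD _ _))// normrM (gtr0_norm e0).
  have L0 : 0 <= L by exact: modulus_ge0.
  have m0 : 0 <= m by exact: modulus_ge0.
  have T1 : C * modulus w * (2 * L + C * modulus w) <= modulus w * (C * (2 * L + C)).
    rewrite mulrAC [leRHS]mulrC ler_wpM2r// ler_wpM2l// lerD2l ler_piMr//.
    exact: ltW.
  have T2 : e * (modulus w * (2 * m + modulus w)) <= modulus w * (e * (2 * m + 1)).
    rewrite mulrCA ler_wpM2l// ler_wpM2l ?(ltW e0)// lerD2l.
    exact: ltW.
  have T3 : e * `|m ^+ 2 - modulus (p2c q) ^+ 2| <= e * (modulus w * (2 * m + modulus w)).
    by rewrite ler_wpM2l// ltW.
  rewrite (@le_trans _ _ (modulus w * A))//.
    rewrite /A mulrDr lerD//; first exact: (le_trans S1 T1).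
    exact: (le_trans T3 T2).
  rewrite ltr_pdivlMr// in w3.
  by rewrite (le_trans _ (ltW w3))// ler_wpM2l// lerDl.
have Qne : Q !=set0 by exists (0, 0).
have [p /[!inE] Qp pmax] := compact_EVT_max Qne cQ cu.
have [p1 p2] := inQ _ Qp.
have u0 : sqmod (H z0) <= u p.
  have := pmax (0, 0); rewrite inE => /(_ Q0); apply: le_trans.
  rewrite /u (_ : p2c (0, 0) = 0)// addr0 lerDl mulr_ge0 ?(ltW e0)//.
  by rewrite -sqr_modulus sqr_ge0.
have sq2 : sqmod (p2c p) <= 2 * r ^+ 2.
  rewrite /sqmod /= -(real_normK (num_real p.1)) -(real_normK (num_real p.2)).
  have q1 : `|p.1| ^+ 2 <= r ^+ 2 by rewrite lerXn2r ?nnegrE ?(ltW r0).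
  have q2 : `|p.2| ^+ 2 <= r ^+ 2 by rewrite lerXn2r ?nnegrE ?(ltW r0).
  by lra.
have er : e * (2 * r ^+ 2) = (sqmod (H z0) - B ^+ 2) / 2.
  by rewrite /e; field; rewrite gt_eqF.
have [bd|nbd] := leP r (modulus (p2c p)).
  have hb := hB (p2c p) p1 p2 bd.
  have : sqmod (H (z0 + p2c p)) <= B ^+ 2.
    by rewrite -sqr_modulus lerXn2r ?nnegrE ?modulus_ge0.
  have : e * sqmod (p2c p) <= e * (2 * r ^+ 2) by rewrite ler_wpM2l// ltW.
  by move: u0 h2; rewrite /u er; lra.
(* A displacement of this size in each coordinate does not leave the square. *)
have pr : 0 < (r - modulus (p2c p)) by rewrite subr_gt0.
have [w [wr wi]] := no_local_max (p2c p) (hH (p2c p) p1 p2) e0 pr.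
have c1 := Re_le_modulus (p2c p); have c2 := Im_le_modulus (p2c p).
have Qq : Q (p.1 + complex.Re w, p.2 + complex.Im w).
  split; rewrite /= in_itv/= -ler_norml.
    by rewrite (le_trans (ler_normD _ _))//; move: c1 => /=; lra.
  by rewrite (le_trans (ler_normD _ _))//; move: c2 => /=; lra.
have := pmax _ (mem_set Qq); rewrite /u /=.
have -> : p2c (p.1 + complex.Re w, p.2 + complex.Im w) = p2c p + w.
  by case: w {wr wi Qq}.
by rewrite addrA => h; rewrite ltNge h.
Unshelve. all: by end_near. Qed.

End maximum_principle.

Section cauchy_estimate.
Context {R : realType}.
Implicit Types (F : R[i] -> R[i]) (z w : R[i]).

Definition expansion F z0 (a : nat -> R[i]) (rho M : R) :=
  [/\ 0 < rho, 0 <= M, forall n, modulus (a n) * rho ^+ n <= M &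
    forall w m, modulus w <= rho / 2 ->
      modulus (F (z0 + w) - \sum_(0 <= n < m) a n * w ^+ n) <=
      2 * M * (modulus w / rho) ^+ m].

Definition second_quotient F z0 c0 c1 c2 z : R[i] :=
  if z == z0 then c2 else (F z - c0 - c1 * (z - z0)) / (z - z0) ^+ 2.

Lemma expansion0 F z0 a rho M : expansion F z0 a rho M -> F z0 = a 0%N.
Proof.
move=> [rho0 M0 _ /(_ 0 1%N)]; rewrite modulus0 mul0r expr1 mulr0 addr0.
rewrite big_nat1 expr0 mulr1 => /(_ (ltW (divr_gt0 rho0 (ltr0Sn R 1)))) h.
by apply/eqP; rewrite -subr_eq0 -modulus_eq0 eq_le h modulus_ge0.
Qed.

(** The singularity is removable: the expansion of [F] to fifth order, shifted by two, leaves a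
    cubic remainder. *)
Lemma expandable2_second_quotient F z0 a (rho M : R) : expansion F z0 a rho M ->
  expandable2 (second_quotient F z0 (a 0%N) (a 1%N) (a 2%N)) z0.
Proof.
move=> [rho0 M0 _ ha]; rewrite /second_quotient.
exists (a 2%N), (a 3%N), (a 4%N), (rho / 2), (2 * M / rho ^+ 5); split.
- by rewrite divr_gt0.
- by rewrite divr_ge0 ?mulr_ge0 ?exprn_ge0 ?(ltW rho0).
move=> w wr; have [->|w0] := eqVneq w 0.
  rewrite addr0 eqxx !expr0n/= !mulr0 !addr0 subrr modulus0.
  by rewrite expr0n mulr0.
rewrite -subr_eq0 addrAC subrr add0r (negbTE w0).
have := ha w 5%N (ltW wr).
rewrite !big_nat_recr//= big_geq// add0r expr0 mulr1 expr1.
set E := F _ - (_ + _) => hE.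
have -> : (F (z0 + w) - a 0%N - a 1%N * w) / w ^+ 2 - (a 2%N + a 3%N * w + a 4%N * w ^+ 2) =
    E / w ^+ 2 by rewrite /E; field.
have m0 : 0 < modulus w by rewrite modulus_gt0.
rewrite modulusM modulusV (modulusX w 2) ler_pdivrMr ?exprn_gt0//.
rewrite (le_trans hE)// le_eqVlt; apply/orP; left; apply/eqP.
by field; rewrite gt_eqF.
Qed.

Lemma expandable2_second_quotient_neq F z0 z1 c0 c1 c2 P (rho M : R) :
  expansion F z1 P rho M -> z1 != z0 ->
  expandable2 (second_quotient F z0 c0 c1 c2) z1.
Proof.
move=> [rho0 M0 _ hP]; rewrite /second_quotient -subr_eq0.
set d := z1 - z0 => d0.
pose G0 := P 0%N - c0 - c1 * d; pose G1 := P 1%N - c1; pose G2 := P 2%N.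
(* Long division of [G0 + G1 w + G2 w ^ 2] by [(d + w) ^ 2], up to order 2. *)
pose b0 := G0 / d ^+ 2; pose b1 := (G1 - 2 * d * b0) / d ^+ 2.
pose b2 := (G2 - b0 - 2 * d * b1) / d ^+ 2.
have md : 0 < modulus d by rewrite modulus_gt0.
exists b0, b1, b2, (Num.min (rho / 2) (Num.min (modulus d / 2) 1)),
  ((2 * M / rho ^+ 3 + (modulus (b1 + 2 * d * b2) + modulus b2)) * 4 / modulus d ^+ 2); split.
- by rewrite !lt_min !divr_gt0// ltr01.
- rewrite !mulr_ge0 ?invr_ge0 ?exprn_ge0 ?(ltW md)// !addr_ge0 ?modulus_ge0//.
  by rewrite !mulr_ge0 ?invr_ge0 ?exprn_ge0 ?(ltW rho0).
move=> w; rewrite !lt_min => /and3P[w1 w2 w3].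
have dw : modulus d / 2 <= modulus (d + w).
  have := modulusB (d + w) w; rewrite addrK; lra.
have dw0 : d + w != 0 by rewrite -modulus_gt0; lra.
have zE : z1 + w - z0 = d + w by rewrite addrAC.
rewrite -subr_eq0 zE (negbTE dw0).
have := hP w 3%N (ltW w1).
rewrite !big_nat_recr//= big_geq// add0r expr0 mulr1 expr1.
set E := F _ - (_ + _) => hE.
have FE : F (z1 + w) = E + (P 0%N + P 1%N * w + P 2%N * w ^+ 2) by rewrite /E subrK.
have -> : (F (z1 + w) - c0 - c1 * (d + w)) / (d + w) ^+ 2 - (b0 + b1 * w + b2 * w ^+ 2) =
    (E - w ^+ 3 * (b1 + 2 * d * b2 + b2 * w)) / (d + w) ^+ 2.
  rewrite FE /b2 /b1 /b0 /G0 /G1 /G2; field.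
  by rewrite d0 dw0.
have m0 := modulus_ge0 w.
rewrite modulusM modulusV (modulusX _ 2).
have n1 : modulus (E - w ^+ 3 * (b1 + 2 * d * b2 + b2 * w)) <=
    (2 * M / rho ^+ 3 + (modulus (b1 + 2 * d * b2) + modulus b2)) * modulus w ^+ 3.
  rewrite (le_trans (modulusB _ _))// [leRHS]mulrDl lerD//.
    rewrite (le_trans hE)// le_eqVlt; apply/orP; left; apply/eqP.
    by field; rewrite gt_eqF.
  rewrite (modulusM (w ^+ 3)) modulusX mulrC ler_wpM2r ?exprn_ge0//.
  rewrite (le_trans (modulusD _ _))// lerD2l modulusM ler_piMr ?modulus_ge0//.
  exact: ltW.
rewrite ler_pdivrMr; last by rewrite exprn_gt0// modulus_gt0.
rewrite (le_trans n1)//.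
set S := _ + (_ + _).
have S0 : 0 <= S * modulus w ^+ 3.
  by rewrite mulr_ge0 ?exprn_ge0// !addr_ge0 ?modulus_ge0// !mulr_ge0 ?invr_ge0 ?exprn_ge0 ?(ltW rho0).
rewrite [leRHS](_ : _ = (S * modulus w ^+ 3) * (4 * modulus (d + w) ^+ 2 / modulus d ^+ 2)); last first.
  by field; rewrite gt_eqF.
rewrite ler_peMr// ler_pdivlMr ?exprn_gt0// mul1r.
have -> : 4 * modulus (d + w) ^+ 2 = (2 * modulus (d + w)) ^+ 2 by ring.
by rewrite lerXn2r ?nnegrE ?mulr_ge0 ?modulus_ge0//; lra.
Qed.

(* Cauchy's estimate, obtained from the maximum principle for
   [second_quotient] instead of a contour integral. *)
Lemma second_coefficient_le F z0 a (rho M r B : R) : expansion F z0 a rho M ->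
  0 < r ->
  (forall w, `|complex.Re w| <= r -> `|complex.Im w| <= r -> analytic_at F (z0 + w)) ->
  (forall w, `|complex.Re w| <= r -> `|complex.Im w| <= r -> modulus (F (z0 + w)) <= B) ->
  modulus (a 2%N) <= 2 * B / r ^+ 2 + modulus (a 1%N) / r.
Proof.
move=> ha r0 hF hB.
pose H := second_quotient F z0 (a 0%N) (a 1%N) (a 2%N).
have -> : modulus (a 2%N) = modulus (H z0) by rewrite /H /second_quotient eqxx.
apply: (maximum_principle r0) => w w1 w2.
  have [->|w0] := eqVneq w 0; first by rewrite addr0; exact: expandable2_second_quotient ha.
  have [P [sig [L hP]]] := analytic_expansion (hF w w1 w2).
  apply: (expandable2_second_quotient_neq _ _ _ hP).
  by rewrite -subr_eq0 addrAC subrr add0r.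
move=> rw; have mw : 0 < modulus w by exact: lt_le_trans rw.
have w0 : w != 0 by rewrite -modulus_gt0.
rewrite /H /second_quotient -subr_eq0 addrAC subrr add0r (negbTE w0).
rewrite modulusM modulusV (modulusX w 2).
have B1 := hB w w1 w2.
have n0 : `|0 : R| <= r by rewrite normr0 ltW.
have B0 := hB 0 n0 n0; rewrite addr0 (expansion0 ha) in B0.
(* The linear term is kept as [|a 1|] instead of being estimated by [B], because the growth
   hypothesis on [V'] controls it directly. *)
rewrite (@le_trans _ _ ((2 * B + modulus (a 1%N) * modulus w) / modulus w ^+ 2))//.
  rewrite ler_wpM2r ?invr_ge0 ?exprn_ge0 ?(ltW mw)//.
  rewrite (le_trans (modulusB _ _))// (modulusM (a 1%N)) lerD2r.
  by rewrite (le_trans (modulusB _ _))//; lra.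
rewrite mulrDl lerD//.
  rewrite ler_wpM2l ?mulr_ge0// ?(le_trans (modulus_ge0 _) B0)//.
  by rewrite lef_pV2 ?posrE ?exprn_gt0// lerXn2r ?nnegrE ?(ltW r0) ?(ltW mw).
rewrite (_ : _ / _ ^+ 2 = modulus (a 1%N) / modulus w); last by field; rewrite gt_eqF.
by rewrite ler_wpM2l ?modulus_ge0// lef_pV2 ?posrE.
Qed.

End cauchy_estimate.

(** * Regularity and growth of the potential *)

Section regularity.
Context {R : realType}.

(** On the real axis the real parts of the coefficients sum to [V]. The imaginary part of [a 1] is
    [O(t)] for small real [t], hence 0; this identifies the modulus of [a 1] with [|V'|]. *)
Lemma expansion_real (F : R[i] -> R[i]) (V : R -> R) y a (rho M : R) :
  (forall y, F y%:C = (V y)%:C) -> expansion F y%:C a rho M ->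
  complex.Im (a 1%N) = 0 /\
  power_series_at V y (fun n => complex.Re (a n)) rho M.
Proof.
move=> FV ha; have [rho0 M0 hM hr] := ha.
have E (t : R) m : `|t| <= rho / 2 ->
    modulus ((V (y + t))%:C - \sum_(0 <= n < m) a n * (t ^+ n)%:C) <=
    2 * M * (`|t| / rho) ^+ m.
  move=> ht; have := hr t%:C m; rewrite modulus_real => /(_ ht).
  rewrite -rmorphD/= FV.
  by under eq_bigr do rewrite -rmorphXn/=.
have ReM (z : R[i]) (t : R) : complex.Re (z * t%:C) = complex.Re z * t.
  by case: z => u v /=; rewrite mulr0 subr0.
have ImM (z : R[i]) (t : R) : complex.Im (z * t%:C) = complex.Im z * t.
  by case: z => u v /=; rewrite mulr0 add0r.
split.
  have a00 : complex.Im (a 0%N) = 0 by rewrite -(expansion0 ha) FV.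
  apply/eqP; rewrite -normr_eq0 eq_le normr_ge0 andbT.
  apply/ler_addgt0Pr => e e0; rewrite add0r.
  pose C := 2 * M / rho ^+ 2.
  have C0 : 0 <= C by rewrite divr_ge0 ?mulr_ge0 ?exprn_ge0 ?(ltW rho0).
  pose t := Num.min (rho / 2) (e / (C + 1)).
  have C1 : 0 < C + 1 by rewrite ltr_wpDl.
  have t0 : 0 < t by rewrite lt_min !divr_gt0.
  have tn : `|t| = t by rewrite gtr0_norm.
  have t1 : `|t| <= rho / 2 by rewrite tn ge_min lexx.
  have t2 : t * (C + 1) <= e by rewrite -ler_pdivlMr// ge_min lexx orbT.
  have := le_trans (Im_le_modulus _) (E t 2%N t1).
  rewrite !big_nat_recr//= big_geq// add0r expr0 mulr1 expr1.
  rewrite raddfB/= raddfD/= ImM a00 sub0r add0r normrN normrM tn.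
  rewrite (_ : 2 * M * _ = (C * t) * t); last by rewrite /C; field; rewrite gt_eqF.
  by rewrite ler_pM2r// => h; rewrite (le_trans h)//; nra.
split => //.
- move=> n; rewrite (le_trans _ (hM n))// ler_wpM2r ?exprn_ge0 ?(ltW rho0)//.
  exact: Re_le_modulus.
- move=> t ht; apply/cvgrPdist_le => e e0.
  have ReS m : complex.Re (\sum_(0 <= n < m) a n * (t ^+ n)%:C) =
      pseries (fun n => complex.Re (a n)) t m.
    by rewrite raddf_sum; apply: eq_bigr => n _; exact: ReM.
  have : geometric (2 * M) (2^-1 : R) @ \oo --> 0.
    by apply: cvg_geometric; rewrite ger0_norm ?invr_ge0// invf_lt1// ltr1n.
  move=> /cvgrPdist_le/(_ e e0); apply: filterS => m; rewrite sub0r normrN => he.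
  rewrite (le_trans _ he)//.
  rewrite [leRHS]ger0_norm; last by rewrite /geometric/= mulr_ge0 ?mulr_ge0// exprn_ge0// invr_ge0.
  have q1 : `|t| / rho <= 2^-1 by rewrite ler_pdivrMr// mulrC ltW.
  rewrite (@le_trans _ _ (2 * M * (`|t| / rho) ^+ m))//; last first.
    by rewrite /geometric/= ler_wpM2l ?mulr_ge0// lerXn2r ?nnegrE ?invr_ge0 ?divr_ge0 ?(ltW rho0).
  rewrite (le_trans _ (E t m (ltW ht)))// (le_trans _ (Re_le_modulus _))//.
  by rewrite raddfB/= ReS.
Qed.

(** At a maximum point [m] of [|V|] on the interval, the mean value theorem gives
    [|V m| <= |V y| + r (C2 |V m| + C3)], and [r C2 <= 1/2] lets the term in [|V m|] be absorbed. *)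
Lemma local_growth (V : R -> R) (C2 C3 r y t : R) :
  (forall x, derivable V x 1) ->
  (forall x, `|derive1 V x| <= C2 * `|V x| + C3) -> 0 <= C2 -> 0 <= C3 ->
  0 < r -> r * C2 <= 2^-1 -> `|t| <= r ->
  `|V (y + t)| <= 2 * `|V y| + 2 * r * C3.
Proof.
move=> dV hV C20 C30 r0 rC tr.
have cV : continuous V by move=> x; apply: differentiable_continuous; exact/derivable1_diffP.
have cV' : {within `[y - r, y + r], continuous (fun x => `|V x|)}.
  by apply: continuous_subspaceT => x; apply: continuous_comp; [exact: cV|exact: norm_continuous].
have yr : y - r <= y + r by lra.
have [m] := EVT_max yr cV'; rewrite in_itv/= => /andP[m1 m2] mmax.
have dist x1 x2 : x1 <= x2 -> y - r <= x1 -> x2 <= y + r -> x2 - x1 <= r ->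
    `|V x2 - V x1| <= r * (C2 * `|V m| + C3).
  move=> x12 h1 h2 h3.
  have dd x : x \in `]x1, x2[ -> is_derive x (1 : R) V (derive1 V x).
    by move=> _; rewrite derive1E; exact: DeriveDef.
  have [x] := MVT_segment x12 dd (continuous_subspaceT cV).
  rewrite in_itv/= => /andP[c1 c2] ->.
  have xm : `|V x| <= `|V m| by apply: mmax; rewrite in_itv/=; apply/andP; split; lra.
  rewrite normrM mulrC ler_pM//.
    by rewrite ger0_norm ?subr_ge0.
  by rewrite (le_trans (hV x))// lerD2r ler_wpM2l.
have V1 : `|V m - V y| <= r * (C2 * `|V m| + C3).
  have [ym|my] := leP y m; first by apply: dist => //; lra.
  by rewrite distrC; apply: dist; lra.
have V2 : `|V m| <= `|V y| + `|V m - V y|.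
  by have := ler_normD (V y) (V m - V y); rewrite addrC subrK.
have V3 : `|V (y + t)| <= `|V m|.
  by apply: mmax; rewrite in_itv/=; move: tr; rewrite ler_norml => /andP[? ?]; apply/andP; split; lra.
have := normr_ge0 (V m); rewrite mulrDr mulrA in V1 *.
have : r * C2 * `|V m| <= 2^-1 * `|V m| by rewrite ler_wpM2r.
lra.
Qed.

Lemma admissible_potential_regular (V : R -> R) : admissible_potential V ->
  [/\ forall y, is_derive y (1 : R) V (derive1 V y),
      forall y, is_derive y (1 : R) (derive1 V) (derive1n 2 V y),
      continuous (derive1n 2 V),
      exists C2 C3 : R, [/\ 0 < C2, 0 < C3 & forall y, `|derive1 V y| <= C2 * `|V y| + C3]
    & exists A B : R, [/\ 0 < A, 0 < B & forall y, `|derive1n 2 V y| <= A * `|V y| + B]].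
Proof.
move=> [h0 [F [h00 hF FV [_ [C2 [C3 [C4 [C5 [[C20 C30 C40 C50] _ hC23 hC45]]]]]]]]].
have hexp (y : R) : exists a (rho M : R), [/\ expansion F y%:C a rho M,
    complex.Im (a 1%N) = 0, derive1 V y = complex.Re (a 1%N),
    derive1n 2 V y = 2 * complex.Re (a 2%N) &
    [/\ is_derive y (1 : R) V (derive1 V y), is_derive y (1 : R) (derive1 V) (derive1n 2 V y)
  & derivable (derive1n 2 V) y 1]].
  have Fy : analytic_at F y%:C by apply: hF; rewrite /= normr0.
  have [a [rho [M ha]]] := analytic_expansion Fy.
  have [Ia1 p0] := expansion_real FV ha.
  have [d0 p1] := power_series_at_derive p0.
  have [d1 p2] := power_series_at_derive p1.
  (* A third differentiation, for the continuity of the second derivative. *)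
  have [d2 _] := power_series_at_derive p2.
  have e1 : derive1 V y = complex.Re (a 1%N) by rewrite derive1E derive_val.
  have e2 : derive1n 2 V y = 2 * complex.Re (a 2%N).
    by rewrite [LHS](derive1E (derive1 V)) derive_val.
  exists a, rho, M; split; [exact: ha|exact: Ia1|exact: e1|exact: e2|split].
  - by rewrite e1; exact: d0.
  - by rewrite e2; exact: d1.
  - by case: d2.
have dV y : is_derive y (1 : R) V (derive1 V y) by have [? [? [? [_ _ _ _ []]]]] := hexp y.
have dV' y : is_derive y (1 : R) (derive1 V) (derive1n 2 V y) by have [? [? [? [_ _ _ _ []]]]] := hexp y.
split => //.
- move=> y; have [? [? [? [_ _ _ _ [_ _ d]]]]] := hexp y.
  by apply: differentiable_continuous; exact/derivable1_diffP.
- by exists C2, C3.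
(* The first bound keeps the square inside the strip, the second is the smallness required by
   [local_growth]; neither depends on [y]. *)
pose r := Num.min (h0 / 2) (2^-1 / C2).
have r0 : 0 < r by rewrite lt_min !divr_gt0// invr_gt0.
have rh : r < h0 by rewrite (@le_lt_trans _ _ (h0 / 2)) ?ge_min ?lexx//; lra.
have rC : r * C2 <= 2^-1 by rewrite -ler_pdivlMr// ge_min lexx orbT.
(* Twice the bound of [second_coefficient_le], split into its part proportional to [|V y|] and its
   constant part; the outer 2 is the factorial in [V'' = 2 Re (a 2)]. *)
exists (2 * (2 * (C4 * 2) / r ^+ 2 + C2 / r)),
  (2 * (2 * (C4 * (2 * r * C3) + C5) / r ^+ 2 + C3 / r)); split.
- by do ?[apply: addr_gt0|apply: divr_gt0|apply: exprn_gt0|apply: mulr_gt0].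
- by do ?[apply: addr_gt0|apply: divr_gt0|apply: exprn_gt0|apply: mulr_gt0].
move=> y; have [a [rho [M [ha Ia1 e1 e2 _]]]] := hexp y.
have dVx x : derivable V x 1 by case: (dV x).
have := @second_coefficient_le _ F y%:C a rho M r (C4 * (2 * `|V y| + 2 * r * C3) + C5) ha r0.
have bnd w : `|complex.Re w| <= r -> `|complex.Im w| <= r ->
    modulus (F (y%:C + w)) <= C4 * (2 * `|V y| + 2 * r * C3) + C5.
  case: w => s h /= sr hr.
  have -> : y%:C + (s +i* h) = (y + s) +i* h by apply/eqP; rewrite eq_complex/= add0r !eqxx.
  rewrite -lecR -modulusE (le_trans (hC45 _ _ _))//; first exact: le_lt_trans rh.
  rewrite lecR lerD2r ler_pM2l//.
  have := local_growth y dVx hC23 (ltW C20) (ltW C30) r0 rC sr.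
  by [].
have an w : `|complex.Re w| <= r -> `|complex.Im w| <= r -> analytic_at F (y%:C + w).
  case: w => s h /= sr hr; apply: hF.
  by rewrite /= add0r; exact: le_lt_trans rh.
move=> /(_ an bnd) h2.
have m1 : modulus (a 1%N) <= C2 * `|V y| + C3.
  by rewrite (le_trans (modulus_le _))// Ia1 normr0 addr0 -e1.
rewrite e2 normrM ger0_norm//.
have := le_trans (Re_le_modulus _) h2.
have h3 : modulus (a 1%N) / r <= (C2 * `|V y| + C3) / r by rewrite ler_pM2r ?invr_gt0.
move=> h4; have {h4} := le_trans h4 (lerD (lexx _) h3).
set X := `|complex.Re _| => h5.
rewrite (_ : _ + _ = 2 * (2 * (C4 * (2 * `|V y| + 2 * r * C3) + C5) / r ^+ 2 + (C2 * `|V y| + C3) / r)).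
  by rewrite ler_pM2l.
by field; rewrite gt_eqF.
Qed.

End regularity.

(** * The coefficient K2 *)

Section integral_sum.
Context d (T : measurableType d) {R : realType}.
Variable mu : {measure set T -> \bar R}.

Lemma Rintegral_sum_seq (I : eqType) (r : seq I) (f : I -> T -> R) :
  (forall i, i \in r -> mu.-integrable setT (EFin \o f i)) ->
  mu.-integrable setT (EFin \o (fun x => \sum_(i <- r) f i x)) /\
  \int[mu]_x (\sum_(i <- r) f i x) = \sum_(i <- r) \int[mu]_x f i x.
Proof.
elim: r => [|i r IH] intf.
  under [X in EFin \o X]eq_fun do rewrite big_nil.
  under eq_Rintegral do rewrite big_nil.
  rewrite big_nil /Rintegral integral0; split => //; exact: integrable0.
have ifi : mu.-integrable setT (EFin \o f i) by apply: intf; rewrite mem_head.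
have [ir Er] : mu.-integrable setT (EFin \o (fun x => \sum_(i <- r) f i x)) /\
  \int[mu]_x (\sum_(i <- r) f i x) = \sum_(i <- r) \int[mu]_x f i x.
  by apply: IH => j jr; apply: intf; rewrite inE jr orbT.
under [X in EFin \o X]eq_fun do rewrite big_cons.
under eq_Rintegral do rewrite big_cons.
rewrite big_cons -Er; split; first exact: RintegrableD.
by rewrite RintegralD.
Qed.

End integral_sum.

Section correlation.
Context {R : realType}.
Local Notation mu := (@lebesgue_measure R).
Local Notation mu2 := (prodm mu mu).
Variable eta : R -> R.
Hypothesis heta : piecewise_continuous eta.
Hypothesis hdecay : exponentially_decaying eta.
Variables (h : R -> R) (k : R).
Hypothesis ch : continuous h.
Hypothesis h1 : forall x, `|h x| <= 1.

Let ie := integrable_profile heta hdecay.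

Definition correlation (x : R) : R := \int[mu]_x1 (eta x1 * h (k * `|x - x1|)).

Let mh2 : measurable_fun setT (fun z : R * R => h (k * `|z.1 - z.2|)).
Proof.
apply: (measurableT_comp (f := h)); first exact: continuous_measurable_fun.
apply: measurable_funM => //; apply: measurableT_comp => //.
by apply: measurable_funB; [exact: measurable_fst|exact: measurable_snd].
Qed.

Let mh (x : R) : measurable_fun setT (fun x1 : R => h (k * `|x - x1|)).
Proof.
apply: (measurableT_comp (f := h)); first exact: continuous_measurable_fun.
apply: measurable_funM => //; apply: measurableT_comp => //.
exact: measurable_funB.
Qed.

Lemma integrable_correlation_kernel x :
  mu.-integrable setT (EFin \o (fun x1 => eta x1 * h (k * `|x - x1|))).
Proof.
apply: (bounded_integrableM (K := 1)) => //; exact: (mh x).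
Qed.

Lemma integrable_correlation : mu.-integrable setT (EFin \o (fun x => eta x * correlation x)) /\
  \int[mu]_x (eta x * correlation x) =
  \int[mu2]_z (eta z.1 * eta z.2 * h (k * `|z.1 - z.2|)).
Proof.
have i2 : mu2.-integrable setT (EFin \o (fun z => eta z.1 * eta z.2 * h (k * `|z.1 - z.2|))).
  by apply: (bounded_integrableM (K := 1)) => //; exact: (integrable_tensor ie ie).
have ix x : mu.-integrable setT (EFin \o (fun x1 => eta x * eta x1 * h (k * `|x - x1|))).
  apply: eq_integrable (RintegrableZl (eta x) measurableT (integrable_correlation_kernel x)) => //.
  by move=> x1 _; rewrite /= mulrA.
have E x : eta x * correlation x = \int[mu]_x1 (eta x * eta x1 * h (k * `|x - x1|)).
  rewrite -(RintegralZl _ measurableT (integrable_correlation_kernel x)).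
  by apply: eq_Rintegral => x1 _; rewrite mulrA.
split.
  apply: eq_integrable (integrable_Rintegral_prod i2 ix) => // x _.
  by rewrite /= E.
rewrite [RHS](Rintegral_prod i2).
by apply: eq_Rintegral => x _; rewrite E.
Qed.

End correlation.

Section assembly.
Context {R : realType}.
Local Notation mu := (@lebesgue_measure R).
Local Notation mu2 := (prodm mu mu).
Variables (V eta : R -> R) (Lam : nat -> R) (psi : nat -> R -> R) (p : nat).
Variables (tau : R) (U : R * R -> R).
Hypothesis heta : piecewise_continuous eta.
Hypothesis hdecay : exponentially_decaying eta.
Hypothesis htau : tau = -1 \/ tau = 1.
Hypothesis p0 : (0 < p)%N.
Hypothesis iI : forall j, (1 <= j <= p)%N ->
  mu.-integrable setT (EFin \o (fun y => psi p y * psi j y * derive1 V y)).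
Hypothesis I0 : Ipj V psi p p = 0.
Hypothesis iV2 : mu.-integrable setT (EFin \o (fun y => derive1n 2 V y * psi p y ^+ 2)).
Hypothesis iU : mu2.-integrable setT (EFin \o (fun z => source V eta psi p z * U z)).
Hypothesis k0 : forall j, (1 <= j < p)%N -> 0 < wavenum Lam p j.

Let k j := wavenum Lam p j.
Let f := source V eta psi p.
Let c j := correlation eta (@cos R) (k j).
Let s j := correlation eta (@sin R) (k j).

Let tau2 : tau * tau = 1.
Proof. by case: htau => ->; rewrite ?mulrNN mulr1. Qed.

Let expi_tau t : expi (tau * t) = cos t +i* (tau * sin t).
Proof.
by rewrite /expi; case: htau => ->; rewrite ?mulN1r ?mul1r ?cosN ?sinN.
Qed.

Let ikernel j x (h : R -> R) : continuous h -> (forall t, `|h t| <= 1) ->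
  mu.-integrable setT (EFin \o (fun x1 => eta x1 * h (k j * `|x - x1|))).
Proof. by move=> ch h1; exact: integrable_correlation_kernel. Qed.

Let cint_source j (z : R * R) : (1 <= j < p)%N ->
  cint (leb2 R) (fun w : R * R =>
    expi (tau * k j * `|z.1 - w.1|) * (psi j w.2 * f w)%:C) =
  (Ipj V psi p j * c j z.1) +i* (tau * (Ipj V psi p j * s j z.1)).
Proof.
move=> /andP[j1 jp]; have ij : (1 <= j <= p)%N by rewrite j1 ltnW.
have E (t : R) (h : R -> R) : continuous h -> (forall t, `|h t| <= 1) ->
    \int[mu2]_w ((t * (eta w.1 * h (k j * `|z.1 - w.1|))) *
      (psi p w.2 * psi j w.2 * derive1 V w.2)) =
    t * (Ipj V psi p j * correlation eta h (k j) z.1).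
  move=> ch h1; have i1 := ikernel j z.1 ch h1.
  rewrite (Rintegral_tensor (RintegrableZl t measurableT i1) (iI ij)).
  by rewrite (RintegralZl _ measurableT i1) -mulrA [_ * \int[_]_x _]mulrC.
rewrite /cint; congr (_ +i* _).
  rewrite -[RHS]mul1r -(E 1 _ (@continuous_cos R) (@cos_max R)).
  apply: eq_Rintegral => w _; rewrite -mulrA expi_tau /= mulr0 subr0 /f /source.
  by ring.
rewrite -(E tau _ (@continuous_sin R) (@sin_max R)).
apply: eq_Rintegral => w _; rewrite -mulrA expi_tau /= mulr0 add0r /f /source.
by ring.
Qed.

(* The non-oscillating summand of [Gop] is proportional to [Ipj V psi p p = 0]. *)
Let middle (z : R * R) :
  \int[leb2 R]_w (`|z.1 - w.1| * psi p w.2 * f w) = 0.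
Proof.
have i1 : mu.-integrable setT (EFin \o (fun x : R => `|z.1 - x| * eta x)).
  have ix := Rintegrable_norm measurableT (integrable_profileX heta hdecay).
  have ie := Rintegrable_norm measurableT (integrable_profile heta hdecay).
  apply: (Rle_integrable measurableT _ _
    (RintegrableD measurableT (RintegrableZl `|z.1| measurableT ie) ix)).
    apply: measurable_funM; last exact: piecewise_continuous_measurable.
    by apply: measurableT_comp => //; exact: measurable_funB.
  move=> x _; rewrite /= !normrM normr_id -mulrDl ler_wpM2r//.
  exact: ler_normB.
have ip : (1 <= p <= p)%N by rewrite p0 leqnn.
have := Rintegral_tensor i1 (iI ip).
rewrite [X in _ * X]I0 mulr0 => <-.
by apply: eq_Rintegral => w _; rewrite /f /source /=; ring.
Qed.

Let weight j (y : R) := psi j y * Ipj V psi p j / (2 * k j).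

(** Multiplication by [i tau] sends the cosine correlations to the imaginary part and the sine ones
    to the real part, where the two factors [tau] cancel and a minus sign remains. *)
Let GopE (z : R * R) : Gop Lam psi p tau f U z =
  (U z - \sum_(1 <= j < p) weight j z.2 * s j z.1) +i*
  (tau * \sum_(1 <= j < p) weight j z.2 * c j z.1).
Proof.
rewrite /Gop middle mulr0 subr0.
rewrite (eq_big_nat _ _ (F2 := fun j => (- (weight j z.2 * s j z.1)) +i*
    (tau * (weight j z.2 * c j z.1)))); last first.
  move=> j jp; rewrite cint_source//.
  have kj : 2 * wavenum Lam p j != 0 by rewrite mulf_neq0 ?gt_eqF ?k0.
  apply/eqP; rewrite eq_complex /= !(mul0r, mulr0, mul1r, oppr0, subr0, sub0r, addr0, add0r).
  apply/andP; split; apply/eqP; rewrite /weight /k; last by ring.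
  congr (- _); rewrite -[RHS]mul1r -tau2; ring.
apply/eqP; rewrite eq_complex raddfD raddfD /= !raddf_sum /= addr0.
by rewrite -mulr_sumr sumrN addrC !eqxx.
Qed.

Let isum (h : R -> R) j : continuous h -> (forall t, `|h t| <= 1) -> (1 <= j < p)%N ->
  mu2.-integrable setT (EFin \o (fun z => f z * (weight j z.2 * correlation eta h (k j) z.1))) /\
  \int[mu2]_z (f z * (weight j z.2 * correlation eta h (k j) z.1)) =
  Ipj V psi p j ^+ 2 / (2 * k j) *
    \int[mu2]_z (eta z.1 * eta z.2 * h (k j * `|z.1 - z.2|)).
Proof.
move=> ch h1 /andP[j1 jp]; have ij : (1 <= j <= p)%N by rewrite j1 ltnW.
have [i1 E1] := integrable_correlation heta hdecay (k j) ch h1.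
have i2 := RintegrableZl (Ipj V psi p j / (2 * k j)) measurableT (iI ij).
have E : (fun z : R * R => f z * (weight j z.2 * correlation eta h (k j) z.1)) =
    (fun z => (eta z.1 * correlation eta h (k j) z.1) *
      (Ipj V psi p j / (2 * k j) * (psi p z.2 * psi j z.2 * derive1 V z.2))).
  by apply/funext => z; rewrite /f /source /weight; ring.
rewrite E; split; first exact: (integrable_tensor i1 i2).
rewrite (Rintegral_tensor i1 i2) E1 (RintegralZl _ measurableT (iI ij)).
by rewrite -/(Ipj V psi p j); ring.
Qed.

Let potential (z : R * R) := eta z.1 ^+ 2 / 2 * derive1n 2 V z.2 * psi p z.2 ^+ 2.

Let ipotential : mu2.-integrable setT (EFin \o potential).
Proof.
have i1 := RintegrableZl 2^-1 measurableT (integrable_profile_sqr heta hdecay).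
apply: eq_integrable (integrable_tensor i1 iV2) => // z _ /=.
by congr EFin; rewrite /potential /=; ring.
Qed.

Let Khalf (z : R[i]) : 2^-1 * z = (2^-1 * complex.Re z) +i* (2^-1 * complex.Im z).
Proof.
have -> : (2^-1 : R[i]) = (2^-1 : R)%:C by rewrite fmorphV/= rmorph_nat.
by case: z => x y; apply/eqP; rewrite eq_complex /= !mul0r subr0 addr0 !eqxx.
Qed.

Let nat_range j : j \in index_iota 1 p -> (1 <= j < p)%N.
Proof. by rewrite mem_index_iota. Qed.

Theorem Re_K2 : complex.Re (K2 V eta Lam psi p tau U) =
    2^-1 * \int[leb2 R]_z
      (eta z.1 ^+ 2 / 2 * derive1n 2 V z.2 * psi p z.2 ^+ 2
       - eta z.1 * derive1 V z.2 * psi p z.2 * U z)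
    + \sum_(1 <= j < p)
        Ipj V psi p j ^+ 2 * Hpj eta Lam p j / (4 * Num.sqrt (Lam p - Lam j)).
Proof.
rewrite /K2 Khalf /= /cint /=.
have is1 j : j \in index_iota 1 p -> mu2.-integrable setT
    (EFin \o (fun z => f z * (weight j z.2 * s j z.1))).
  by move=> /nat_range jp; have [] := isum (@continuous_sin R) (@sin_max R) jp.
have [isumj Esum] := Rintegral_sum_seq is1.
have iB := RintegrableB measurableT ipotential iU.
have -> : \int[leb2 R]_z complex.Re ((eta z.1 ^+ 2 / 2 * derive1n 2 V z.2 * psi p z.2 ^+ 2)%:C
    - (f z)%:C * Gop Lam psi p tau f U z) =
    \int[mu2]_z ((potential z - f z * U z) +
      \sum_(1 <= j < p) f z * (weight j z.2 * s j z.1)).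
  apply: eq_Rintegral => z _; rewrite GopE /= mul0r subr0 -mulr_sumr /potential /=.
  by ring.
rewrite (RintegralD measurableT iB isumj) mulrDr; congr (_ + _).
rewrite Esum mulr_sumr; apply: eq_big_nat => j jp.
have [_ ->] := isum (@continuous_sin R) (@sin_max R) jp.
have kj : 0 < k j by exact: k0.
(* The [1 / pi] in [Hpj] leaves exactly the double sine integral; the 4 combines the 2 in the kernel
   of [Gop] with the prefactor of [K2]. *)
rewrite /Hpj (pv_sqmod_fourier heta hdecay) mulKf ?gt_eqF ?pi_gt0//.
by rewrite /k /wavenum in kj *; field; rewrite gt_eqF.
Qed.

Theorem Im_K2 : tau * complex.Im (K2 V eta Lam psi p tau U) =
    - \sum_(1 <= j < p)
        Ipj V psi p j ^+ 2 / (4 * Num.sqrt (Lam p - Lam j))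
        * sqmod (fourier eta (Num.sqrt (Lam p - Lam j))).
Proof.
rewrite /K2 Khalf /= /cint /=.
have ic1 j : j \in index_iota 1 p -> mu2.-integrable setT
    (EFin \o (fun z => f z * (weight j z.2 * c j z.1))).
  by move=> /nat_range jp; have [] := isum (@continuous_cos R) (@cos_max R) jp.
have [isumj Esum] := Rintegral_sum_seq ic1.
have -> : \int[leb2 R]_z complex.Im ((eta z.1 ^+ 2 / 2 * derive1n 2 V z.2 * psi p z.2 ^+ 2)%:C
    - (f z)%:C * Gop Lam psi p tau f U z) =
    \int[mu2]_z (- tau * \sum_(1 <= j < p) f z * (weight j z.2 * c j z.1)).
  apply: eq_Rintegral => z _; rewrite GopE /= mul0r addr0 -mulr_sumr.
  by ring.
rewrite (RintegralZl _ measurableT isumj) Esum mulrCA mulNr mulrN mulrA tau2 mul1r.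
rewrite mulrN mulr_sumr; congr (- _); apply: eq_big_nat => j jp.
have [_ ->] := isum (@continuous_cos R) (@cos_max R) jp.
have kj : 0 < k j by exact: k0.
have -> : \int[mu2]_z (eta z.1 * eta z.2 * cos (k j * `|z.1 - z.2|)) =
    sqmod (fourier eta (k j)).
  (* The cosine is even, so the absolute value may be dropped; for the sine it may not, whence the
     principal value in the real part. *)
  rewrite (sqmod_fourier heta hdecay); apply: eq_Rintegral => z _; congr (_ * _).
  by have [_|_] := ger0P (z.1 - z.2); rewrite // mulrN cosN.
by rewrite /k /wavenum in kj *; field; rewrite gt_eqF.
Qed.

End assembly.

(** * Integrability supplied by the domain of the operator *)

Section eigenfunctions.
Context {R : realType}.
Local Notation mu := (@lebesgue_measure R).

Lemma eigenfunction_regular (V psi : R -> R) (lam : R) : continuous V ->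
  in_eigenspace (schrodinger V) lam%:C (fun y => (psi y)%:C) ->
  [/\ psi \in Lfun mu 2%:E,
      mu.-integrable setT (EFin \o (fun y => (1 + `|V y| ^+ 2) * psi y ^+ 2))
    & exists g h : R -> R, [/\ g \in Lfun mu 2%:E, h \in Lfun mu 2%:E,
        weak_deriv1 psi g, weak_deriv1 g h &
        {ae mu, forall y, h y = (V y - lam) * psi y}]].
Proof.
move=> cV [u1 [u2 [[[psi2 _] [u12 _] [u22 _] [w1 _] [w2 _]] Voo _ eq]]].
have hpsi : psi \in Lfun mu 2%:E by exact: psi2.
have mpsi : measurable_fun setT psi by exact: Lfun_measurable hpsi.
have mV : measurable_fun setT V by exact: continuous_measurable_fun.
split => //.
  apply/integrableP; split.
    apply/measurable_EFinP; apply: measurable_funM; last exact: measurable_funX.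
    apply: measurable_funD => //; apply: measurable_funX; exact: measurableT_comp.
  move: Voo; apply: le_lt_trans; rewrite le_eqVlt; apply/orP; left; apply/eqP.
  apply: eq_integral => y _; rewrite /= /sqmod /= expr0n /= addr0 ger0_norm//.
  by rewrite mulr_ge0 ?sqr_ge0// addr_ge0// sqr_ge0.
exists (@complex.Re R \o u1), (@complex.Re R \o u2); split => //.
apply: ae_impl eq => y /(congr1 (@complex.Re R)) /=.
case: (u2 y) => a b /=; lra.
Qed.

(** From [A |V| + B <= (A + B) (1 + |V| ^ 2)] and [|psi1 psi2| <= psi1 ^ 2 + psi2 ^ 2]: linear
    growth in [|V|] is within the weight that the operator domain provides. *)
Lemma integrable_weighted (V W psi1 psi2 : R -> R) (A B : R) :
  measurable_fun setT W -> measurable_fun setT psi1 -> measurable_fun setT psi2 ->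
  mu.-integrable setT (EFin \o (fun y => (1 + `|V y| ^+ 2) * psi1 y ^+ 2)) ->
  mu.-integrable setT (EFin \o (fun y => (1 + `|V y| ^+ 2) * psi2 y ^+ 2)) ->
  0 <= A -> 0 <= B -> (forall y, `|W y| <= A * `|V y| + B) ->
  mu.-integrable setT (EFin \o (fun y => psi1 y * psi2 y * W y)).
Proof.
move=> mW m1 m2 i1 i2 A0 B0 hW.
apply: (Rle_integrable measurableT _ _
  (RintegrableZl (A + B) measurableT (RintegrableD measurableT i1 i2))).
  by apply: measurable_funM => //; exact: measurable_funM.
move=> y _; rewrite -mulrDr normrM mulrA mulrC ler_pM//.
  rewrite (le_trans (hW y))// mulrDl lerD//.
    rewrite ler_wpM2l//; by have := sqr_ge0 (`|V y| - 1); have := sqr_ge0 `|V y|; lra.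
  by rewrite ler_peMr// lerDl sqr_ge0.
rewrite normrM -(real_normK (num_real (psi1 y))) -(real_normK (num_real (psi2 y))).
have := sqr_ge0 (`|psi1 y| - `|psi2 y|).
by have := sqr_ge0 `|psi1 y|; have := sqr_ge0 `|psi2 y|; lra.
Qed.

(** The source is square integrable, since [(A |V| + B) ^ 2 <= 2 (A ^ 2 + B ^ 2) (1 + |V| ^ 2)], and
    so is [U]. *)
Lemma integrable_source_mul (V eta : R -> R) (psi : nat -> R -> R) p (U : R * R -> R)
    (A B : R) : measurable_fun setT (derive1 V) -> measurable_fun setT (psi p) ->
  mu.-integrable setT (EFin \o (fun y => (1 + `|V y| ^+ 2) * psi p y ^+ 2)) ->
  0 <= A -> 0 <= B -> (forall y, `|derive1 V y| <= A * `|V y| + B) ->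
  measurable_fun setT eta -> mu.-integrable setT (EFin \o (fun x => eta x ^+ 2)) ->
  U \in Lfun (leb2 R) 2%:E ->
  (prodm mu mu).-integrable setT (EFin \o (fun z => source V eta psi p z * U z)).
Proof.
move=> mW mpsi iS A0 B0 hW meta ieta hU.
have iU := Lfun2_mul_integrable hU hU.
have i1 := integrable_tensor ieta (RintegrableZl (2 * (A ^+ 2 + B ^+ 2)) measurableT iS).
apply: (Rle_integrable measurableT _ _ (RintegrableD measurableT i1 iU)).
  apply: measurable_funM; last exact: Lfun_measurable hU.
  apply: measurable_funM; last exact: measurableT_comp measurable_snd.
  apply: measurable_funM; first exact: measurableT_comp measurable_fst.
  exact: measurableT_comp measurable_snd.
move=> z _; rewrite /source /= normrM.
set f := eta z.1 * _ * _.
have fU : `|f| * `|U z| <= f ^+ 2 + U z * U z.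
  rewrite -expr2 -(real_normK (num_real f)) -(real_normK (num_real (U z))).
  have := sqr_ge0 (`|f| - `|U z|).
  by have := sqr_ge0 `|f|; have := sqr_ge0 `|U z|; lra.
rewrite (le_trans fU)// lerD2r.
have -> : f ^+ 2 = eta z.1 ^+ 2 * (derive1 V z.2 ^+ 2 * psi p z.2 ^+ 2).
  by rewrite /f; ring.
rewrite ler_wpM2l ?sqr_ge0// [leRHS]mulrA ler_wpM2r ?sqr_ge0// -(real_normK (num_real (derive1 V z.2))).
have h : `|derive1 V z.2| ^+ 2 <= (A * `|V z.2| + B) ^+ 2.
  by rewrite lerXn2r ?nnegrE ?addr_ge0 ?mulr_ge0.
rewrite (le_trans h)//.
have := sqr_ge0 (A * `|V z.2| - B); have := sqr_ge0 (B * `|V z.2|); have := sqr_ge0 A.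
by rewrite !exprMn !sqrrD !exprMn; nra.
Qed.

End eigenfunctions.

Theorem mainTheorem1 (R : realType) (V eta : R -> R)
    (N : option nat) (Lam : nat -> R) (psi : nat -> R -> R)
    (hV : admissible_potential V)
    (hspec : spectral_setting V N Lam psi)
    (heta : piecewise_continuous eta)
    (hdecay : exponentially_decaying eta)
    (p : nat) (hp : eigen_index N p)
    (tau : R) (htau : tau = -1 \/ tau = 1)
    (U : R * R -> R)
    (hU : is_Uperp V Lam psi p (source V eta psi p) U) :
  complex.Re (K2 V eta Lam psi p tau U) =
    2^-1 * \int[leb2 R]_z
      (eta z.1 ^+ 2 / 2 * derive1n 2 V z.2 * psi p z.2 ^+ 2
       - eta z.1 * derive1 V z.2 * psi p z.2 * U z)
    + \sum_(1 <= j < p)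
        Ipj V psi p j ^+ 2 * Hpj eta Lam p j / (4 * Num.sqrt (Lam p - Lam j))
  /\
  tau * complex.Im (K2 V eta Lam psi p tau U) =
    - \sum_(1 <= j < p)
        Ipj V psi p j ^+ 2 / (4 * Num.sqrt (Lam p - Lam j))
        * sqmod (fourier eta (Num.sqrt (Lam p - Lam j))).
Proof.
have [dV dV' cV2 [A [B [/ltW A0 /ltW B0 hAB]]] [A' [B' [/ltW A'0 /ltW B'0 hAB']]]] :=
  admissible_potential_regular hV.
have cV : continuous V := is_derive_continuous dV.
have cV' : continuous (derive1 V) := is_derive_continuous dV'.
have mV' : measurable_fun setT (derive1 V) by exact: continuous_measurable_fun.
have mV2 : measurable_fun setT (derive1n 2 V) by exact: continuous_measurable_fun.
have idx j : (1 <= j <= p)%N -> eigen_index N j.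
  move=> /andP[j1 jp]; rewrite /eigen_index j1; case: N {hspec} hp => //= n /andP[_ pn].
  exact: leq_trans pn.
have p1 : (1 <= p)%N by case/andP: hp.
have reg j : (1 <= j <= p)%N -> [/\ measurable_fun setT (psi j) & _] :=
  fun jp => let: And3 a b c := eigenfunction_regular cV (ss_eigenfunction hspec (idx j jp)) in
    conj (Lfun_measurable a) b.
have pp : (1 <= p <= p)%N by rewrite p1 leqnn.
have [mp ip] := reg p pp.
have iI j : (1 <= j <= p)%N ->
    (@lebesgue_measure R).-integrable setT (EFin \o (fun y => psi p y * psi j y * derive1 V y)).
  by move=> /reg[mj ij]; exact: integrable_weighted hAB.
have I0 : Ipj V psi p p = 0.
  have [hpsi _ [g [h [hg hh w1 w2 eq]]]] :=
    eigenfunction_regular cV (ss_eigenfunction hspec (idx p pp)).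
  (* The potential part of the energy, for which [|V - Lam p| <= |V| + |Lam p|]. *)
  have iVl : (@lebesgue_measure R).-integrable setT
      (EFin \o (fun y => psi p y * psi p y * (V y - Lam p))).
    apply: (integrable_weighted (A := 1) (B := `|Lam p|) _ mp mp ip ip) => //.
      by apply: measurable_funB => //; exact: continuous_measurable_fun.
    by move=> y; rewrite mul1r ler_normB.
  rewrite /Ipj -[RHS](Rintegral_virial dV cV' hpsi hg hh w1 w2 eq).
  - by apply: eq_Rintegral => y _; rewrite mulrC -expr2.
  - by apply: eq_integrable iVl => // y _ /=; rewrite mulrC -expr2.
  - by apply: eq_integrable (iI p pp) => // y _ /=; rewrite mulrC -expr2.
have iV2 : (@lebesgue_measure R).-integrable setT (EFin \o (fun y => derive1n 2 V y * psi p y ^+ 2)).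
  have := integrable_weighted mV2 mp mp ip ip A'0 B'0 hAB'.
  by apply: eq_integrable => // y _; rewrite [X in EFin X = _]mulrC.
have hU2 : U \in Lfun (leb2 R) 2%:E.
  by have [[? [? [? [? [? [? [[[? _ _] _] _ _ _ _]]]]]]] _] := hU.
have iU := integrable_source_mul mV' mp ip A0 B0 hAB
  (piecewise_continuous_measurable heta) (integrable_profile_sqr heta hdecay) hU2.
have k0 j : (1 <= j < p)%N -> 0 < wavenum Lam p j.
  move=> /andP[j1 jp]; rewrite sqrtr_gt0 subr_gt0.
  by apply: (ss_ascending hspec) => //; apply: idx; rewrite j1 ltnW.
split; first exact: Re_K2.
exact: Im_K2.
Qed.
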